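(* Let $n \ge 2$ be an integer. (i) We have $$n^n \Omega_n (1-r^n)^{1-n} \le \mathrm{cap}_{n,1}(\overline{B}(0,r), B(0,1)) \le n^n \Omega_n \frac{1-r^n}{(1-r)^n}$$ for every $0 \le r<1$. (ii) We have $$\mathrm{cap}_{n,1}(\{x\}, \Omega) = n^n \Omega_n$$ whenever $x \in \mathbf{R}^n$ and $\Omega$ is a bounded open set in $\mathbf{R}^n$ containing $x$.
   Context: $\Omega_n=|B(0,1)|$ is the Lebesgue measure of the unit ball of $\mathbf{R}^n$; $B(a,r)=\{x\in\mathbf{R}^n:|x-a|<r\}$ and $\overline{B}(a,r)=\{x\in\mathbf{R}^n:|x-a|\le r\}$ (so $\overline{B}(0,0)=\{0\}$). Functions are real-valued unless stated otherwise. Lorentz spaces. For an open set $\Omega\subset\mathbf{R}^n$ and measurable $f:\Omega\to\mathbf{R}$, let $\lambda_{[f]}(t)=|\{x\in\Omega:|f(x)|>t\}|$, $t\ge 0$, and $f^*(t)=\inf\{v\ge 0:\lambda_{[f]}(v)\le t\}$, $f^{**}(t)=\frac1t\int_0^t f^*(s)\,ds$. Define $\|f\|_{L^{n,1}(\Omega)}=\int_0^\infty t^{1/n}f^*(t)\,\frac{dt}{t}$ and the equivalent norm $\|f\|_{L^{(n,1)}(\Omega)}=\int_0^\infty t^{1/n}f^{**}(t)\,\frac{dt}{t}$. For vector-valued $f$, the norm of $f$ is the norm of the Euclidean length $|f|$. Sobolev-Lorentz spaces. $H^{1,(n,1)}(\Omega)$ is the completion of $\{\phi\in C^\infty(\Omega):\|\phi\|_{H^{1,(n,1)}(\Omega)}<\infty\}$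 with respect to the norm $\|\phi\|_{H^{1,(n,1)}(\Omega)}=\|\phi\|_{L^{(n,1)}(\Omega)}+\|\nabla\phi\|_{L^{(n,1)}(\Omega;\mathbf{R}^n)}$, and $H_0^{1,(n,1)}(\Omega)$ is the closure of $C_0^\infty(\Omega)$ in $H^{1,(n,1)}(\Omega)$. $\nabla u$ is the distributional gradient. Relative capacity. For $\Omega\subset\mathbf{R}^n$ bounded and open and $E\subset\Omega$, $$\mathrm{cap}_{n,1}(E,\Omega)=\inf\{\|\nabla u\|_{L^{n,1}(\Omega;\mathbf{R}^n)}^n: u\in H_0^{1,(n,1)}(\Omega),\ u\ge 1 \text{ in a neighborhood of } E\},$$ with the value $\infty$ if there are no such $u$. *)

(* Defs.v *)
From HB Require Import structures.
From mathcomp Require Import all_boot all_order all_algebra.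
From mathcomp Require Import all_classical all_reals all_analysis.

Set Implicit Arguments.
Unset Strict Implicit.
Unset Printing Implicit Defensive.

Import Order.TTheory GRing.Theory Num.Theory.
Import numFieldNormedType.Exports.

Local Open Scope classical_set_scope.
Local Open Scope ring_scope.

(* R^n is 'rV[R]_n.  The library norm `|x| on it is the sup norm: it gives the
   usual topology and bounded sets, but the Euclidean length is enorm below. *)

(* The sigma-algebra generated by the coordinates: the Borel sets of R^n.  It
   lacks the completion, but every Lebesgue measurable function is a.e. equal to
   a Borel one, and Lebesgue null sets are exactly the negligible sets of
   lebesgue_rV. *)
Definition rV_display : measure_display.
Proof. exact: default_measure_display. Qed.

Section measurable_rV.
Context {R : realType} (n : nat).

Let coors : 'I_n -> 'rV[R]_n -> measurableTypeR R := fun i x => x ord0 i.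

Let rV_set0 : g_sigma_preimage coors set0.
Proof. exact: sigma_algebra0. Qed.

Let rV_setC A : g_sigma_preimage coors A -> g_sigma_preimage coors (~` A).
Proof. exact: sigma_algebraC. Qed.

Let rV_bigcup (F : _^nat) : (forall i, g_sigma_preimage coors (F i)) ->
  g_sigma_preimage coors (\bigcup_i (F i)).
Proof. exact: sigma_algebra_bigcup. Qed.

HB.instance Definition _ := @isMeasurable.Build rV_display
  'rV[R]_n (g_sigma_preimage coors) rV_set0 rV_setC rV_bigcup.

End measurable_rV.

Lemma measurable_coord (R : realType) (n : nat) (i : 'I_n) :
  measurable_fun [set: 'rV[R]_n] (fun x => x ord0 i : measurableTypeR R).
Proof.
move=> _ Y mY; rewrite setTI; apply: sub_sigma_algebra => /=.
rewrite -bigcup_seq/=; exists i => /=; first by rewrite mem_index_enum.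
by exists Y => //; rewrite setTI.
Qed.

Lemma measurable_fun_rV d (T : measurableType d) (R : realType) (n : nat)
    (f : T -> 'rV[R]_n) :
  (forall i, measurable_fun setT (fun t => f t ord0 i : measurableTypeR R)) ->
  measurable_fun setT f.
Proof.
move=> mf _ Y mY; rewrite setTI.
suff : measurable `<=` [set A : set 'rV[R]_n | measurable (f @^-1` A)] by exact.
apply: smallest_sub.
  split => /=.
  - by rewrite preimage_set0.
  - move=> A /= mA; rewrite setTD preimage_setC; exact: measurableC.
  - move=> F mF; rewrite preimage_bigcup; exact: bigcupT_measurable.
rewrite -bigcup_seq => A [i _ [B mB <-]] /=.
by rewrite setTI -[X in measurable X]setTI; exact: mf.
Qed.

Section lebesgue_rV.
Context {R : realType}.

Definition cons_rV (n : nat) (p : measurableTypeR R * 'rV[R]_n) : 'rV[R]_n.+1 :=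
  \row_i (if unlift ord0 i is Some j then p.2 ord0 j else (p.1 : R)).

Definition uncons_rV (n : nat) (x : 'rV[R]_n.+1) : measurableTypeR R * 'rV[R]_n :=
  (x ord0 ord0, \row_j x ord0 (lift ord0 j)).

Lemma measurable_cons_rV (n : nat) : measurable_fun setT (@cons_rV n).
Proof.
apply: measurable_fun_rV => i; case: (unliftP ord0 i) => [j|] ->.
  rewrite [X in measurable_fun _ X](_ : _ =
      (fun x : 'rV[R]_n => x ord0 j : measurableTypeR R) \o snd).
    by apply: measurableT_comp; [exact: measurable_coord|exact: measurable_snd].
  by apply/funext => p; rewrite mxE liftK.
rewrite [X in measurable_fun _ X](_ : _ = fst); first exact: measurable_fst.
by apply/funext => p; rewrite mxE unlift_none.
Qed.

Lemma measurable_uncons_rV (n : nat) : measurable_fun setT (@uncons_rV n).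
Proof.
apply: measurable_fun_pair; first exact: measurable_coord.
apply: measurable_fun_rV => j.
rewrite [X in measurable_fun _ X](_ : _ =
  (fun x : 'rV[R]_n.+1 => x ord0 (lift ord0 j) : measurableTypeR R)).
  exact: measurable_coord.
by apply/funext => x; rewrite mxE.
Qed.

Lemma cons_rVK (n : nat) : cancel (@cons_rV n) (@uncons_rV n).
Proof.
case=> a x; rewrite /uncons_rV /cons_rV mxE unlift_none; congr (_, _).
by apply/rowP => j; rewrite !mxE liftK.
Qed.

Section step.
Variables (n : nat) (mu : {sigma_finite_measure set 'rV[R]_n -> \bar R}).

Definition lebesgue_rV_step : set 'rV[R]_n.+1 -> \bar R :=
  pushforward (@lebesgue_measure R \x mu)%E (@cons_rV n).

Let mcons := @measurable_cons_rV n.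

HB.instance Definition _ := Measure.copy lebesgue_rV_step
  (measure_function_pushforward__canonical__measure_function_Measure
     [the {measure set _ -> \bar R} of (@lebesgue_measure R \x mu)%E] mcons).

Let step_sigma_finite : sigma_finite setT lebesgue_rV_step.
Proof.
have /sigma_finiteP[F [FT ndF Foo]] := sigma_finiteT (@lebesgue_measure R).
have /sigma_finiteP[G [GT ndG Goo]] := sigma_finiteT mu.
exists (fun k => @uncons_rV n @^-1` (F k `*` G k)).
  apply/esym; rewrite -preimage_bigcup -subTset => x _ /=.
  have [i _ Fi] : (\bigcup_i F i) (uncons_rV x).1 by rewrite -FT.
  have [j _ Gj] : (\bigcup_i G i) (uncons_rV x).2 by rewrite -GT.
  exists (maxn i j) => //; split.
  - by move: Fi; apply/subsetPset/ndF/leq_maxl.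
  - by move: Gj; apply/subsetPset/ndG/leq_maxr.
move=> k; have [mF Fk] := Foo k; have [mG Gk] := Goo k; split.
  rewrite -[X in measurable X]setTI.
  by apply: measurable_uncons_rV => //; exact: measurableX.
rewrite /lebesgue_rV_step /pushforward -comp_preimage.
rewrite (_ : _ \o _ = id); last by apply/funext => p /=; exact: cons_rVK.
by rewrite preimage_id product_measure1E// lte_mul_pinfty// ge0_fin_numE.
Qed.

HB.instance Definition _ := Measure_isSigmaFinite.Build _ _ _
  lebesgue_rV_step step_sigma_finite.

End step.

Fixpoint lebesgue_rV (n : nat) : {sigma_finite_measure set 'rV[R]_n -> \bar R} :=
  match n with
  | 0%N => [the {sigma_finite_measure set 'rV[R]_0 -> \bar R} of \d_(0 : 'rV[R]_0)]
  | n'.+1 => [the {sigma_finite_measure set 'rV[R]_n'.+1 -> \bar R} of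
               lebesgue_rV_step (lebesgue_rV n')]
  end.
End lebesgue_rV.

Section euclidean.
Context {R : realType} {n : nat}.
Implicit Types (a x : 'rV[R]_n) (r : R).

Definition enorm x : R := Num.sqrt (\sum_i x ord0 i ^+ 2).

Definition eball a r : set 'rV[R]_n := [set x | enorm (x - a) < r].

Definition closed_eball a r : set 'rV[R]_n := [set x | enorm (x - a) <= r].

End euclidean.

(* Functions on Omega are total functions on R^n whose values outside Omega are
   irrelevant, except that test functions are extended by zero. *)

(* rearrangement is f^* and rearrangement_avg is f^**; lorentz is the quasinorm
   of L^{n,1}(Omega) and lorentz_avg the norm of L^{(n,1)}(Omega), where the
   first index n is the dimension of the space.  All take values in [0, +oo]. *)
Section lorentz.
Context {R : realType} {n : nat}.
Implicit Types (Omega : set 'rV[R]_n) (f : 'rV[R]_n -> R) (t : R).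
Local Open Scope ereal_scope.

Definition distribution_fun Omega f t : \bar R :=
  lebesgue_rV n (Omega `&` [set x | (t < `|f x|)%R]).

Definition rearrangement Omega f t : \bar R :=
  ereal_inf [set v%:E | v in
    [set v : R | (0 <= v)%R /\ distribution_fun Omega f v <= t%:E]].

Definition rearrangement_avg Omega f t : \bar R :=
  (t^-1)%:E * \int[lebesgue_measure]_(s in `[0%R, t]) rearrangement Omega f s.

Definition lorentz Omega f : \bar R :=
  \int[lebesgue_measure]_(t in `]0%R, +oo[)
    ((t `^ n%:R^-1 / t)%:E * rearrangement Omega f t).

Definition lorentz_avg Omega f : \bar R :=
  \int[lebesgue_measure]_(t in `]0%R, +oo[)
    ((t `^ n%:R^-1 / t)%:E * rearrangement_avg Omega f t).

End lorentz.

Section sobolev_lorentz.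
Context {R : realType} {n : nat}.
Implicit Types (Omega E : set 'rV[R]_n) (u phi : 'rV[R]_n -> R).
Implicit Types (v : 'rV[R]_n -> 'rV[R]_n).

Definition partial (i : 'I_n) phi : 'rV[R]_n -> R :=
  fun x => 'D_(delta_mx ord0 i) phi x.

Definition grad phi : 'rV[R]_n -> 'rV[R]_n := fun x => \row_i partial i phi x.

Definition smooth Omega phi : Prop :=
  forall (s : seq 'I_n) (x : 'rV[R]_n), Omega x ->
    {for x, continuous (foldr partial phi s)} /\
    forall i, derivable (foldr partial phi s) x (delta_mx ord0 i).

Definition test_fun Omega phi : Prop :=
  smooth Omega phi /\
  exists K : set 'rV[R]_n,
    [/\ compact K, K `<=` Omega & forall x, ~ K x -> phi x = 0].

Definition loc_integrable Omega u : Prop :=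
  measurable_fun Omega u /\
  forall K : set 'rV[R]_n, compact K -> K `<=` Omega ->
    (lebesgue_rV n).-integrable K (EFin \o u).

Definition weak_grad Omega u v : Prop :=
  [/\ loc_integrable Omega u,
      forall i, loc_integrable Omega (fun x => v x ord0 i)
    & forall phi i, test_fun Omega phi ->
        \int[lebesgue_rV n]_(x in Omega) (u x * partial i phi x) =
        - \int[lebesgue_rV n]_(x in Omega) (v x ord0 i * phi x)].

Definition sobolev_norm Omega u v : \bar R :=
  (lorentz_avg Omega u + lorentz_avg Omega (enorm \o v))%E.

(* H1 is the completion H^{1,(n,1)}(Omega), realized inside the Banach space of
   pairs (u, v) in L^{(n,1)} x L^{(n,1)}: the limits of pairs (phi, grad phi),
   where necessarily v is the distributional gradient of u.  H10 is the closure
   of C_0^oo(Omega) in H1. *)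
Definition H1 Omega u v : Prop :=
  weak_grad Omega u v /\
  forall eps : R, 0 < eps -> exists phi,
    [/\ smooth Omega phi,
        (sobolev_norm Omega phi (grad phi) < +oo)%E
      & (sobolev_norm Omega (u \- phi)%R (v \- grad phi)%R < eps%:E)%E].

Definition H10 Omega u v : Prop :=
  H1 Omega u v /\
  forall eps : R, 0 < eps -> exists phi,
    test_fun Omega phi /\
    (sobolev_norm Omega (u \- phi)%R (v \- grad phi)%R < eps%:E)%E.

(* u is a class of functions modulo null sets, hence the almost everywhere. *)
Definition ge1_near Omega E u : Prop :=
  exists U : set 'rV[R]_n,
    [/\ open U, E `<=` U, U `<=` Omega
      & {ae lebesgue_rV n, forall x, U x -> 1 <= u x}].

Definition capacity E Omega : \bar R :=
  ereal_inf [set c : \bar R | exists u v,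
    [/\ H10 Omega u v, ge1_near Omega E u
      & c = ((lorentz Omega (enorm \o v)) ^+ n)%E]].

End sobolev_lorentz.

(* Main.v *)
(* Lower bound.  Let Omega be contained in B(x, M) and let phi be a test function
   that is at least 1 on a shell r1 <= |y - x| < r'.  Integrating grad phi outwards
   along the rays from x and averaging over the shell gives
     |B(0,1)| <= 1/n * int_{|z-x| >= r1} |grad phi(z)| |z-x|^(1-n) dz.
   Among the sets D outside B(x, r1) of given measure, the integral of the weight
   |z-x|^(1-n) is largest on a shell B(x, rho) \ B(x, r1), where it equals
   n |B(0,1)| (rho - r1); this is at most
     n (|B(0,1)| (1 - (r1/M)^n))^((n-1)/n) |D|^(1/n).
   Taking D = {|grad phi| > s} and integrating over s bounds the integral by a
   multiple of n int_0^oo |{|grad phi| > s}|^(1/n) ds = ||grad phi||_{n,1}.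

   Upper bound.  If B(x, s) is contained in Omega and L > 1/(s - r), there is a smooth
   radial cutoff with |grad phi| <= L supported in the shell B(x, s) \ B(x, r), so
   ||grad phi||_{n,1} is at most n L times the n-th root of the measure of the shell.
   For a point, r = 0 in both bounds. *)

(* An admissible [u] is a limit of test functions in the norm built on f^**, and it is at least 1
   only almost everywhere near the set; a test function close to [u] need not be at least 1 there.
   Averaging over a shell of positive measure removes this obstacle: on the shell 1 <= |phi| + |u -
   phi| almost everywhere, and the error term is controlled by the same weighted integral as the
   gradient. The average avoids polar coordinates: for fixed s the map y -> x + s y is an affine
   change of variables, and the integrals in s and y are exchanged.

   Approximation is measured with f^** while the capacity uses f^*; the inequality f^* <= f^** links
   the two. The condition n >= 2 makes the f^** norm of a test function finite, since f^** decays
   only like 1/t and t^(1/n - 2) must be integrable at infinity.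

   In the upper bound the slope 1/(s - r) is the limiting value: a smooth cutoff that is constant
   near both ends of the shell must be steeper, so L is kept strictly above it and sent to the limit
   at the end. *)
Require Import Defs.
From HB Require Import structures.
From mathcomp Require Import all_boot all_order all_algebra.
From mathcomp Require Import all_classical all_reals all_analysis.
From mathcomp Require Import measurable_realfun.
From mathcomp Require Import ring lra.

Set Implicit Arguments.
Unset Strict Implicit.
Unset Printing Implicit Defensive.

Import Order.TTheory GRing.Theory Num.Theory.
Import numFieldNormedType.Exports.

Local Open Scope classical_set_scope.
Local Open Scope ring_scope.

(** * The Euclidean norm *)

(* No measurability: both sides are suprema over simple functions, so the lemma
   applies to rearrangements of arbitrary functions. *)
Lemma le_integral_ge0 d (T : measurableType d) (R : realType)
    (mu : {measure set T -> \bar R}) (D : set T) (f g : T -> \bar R) :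
  (forall x, D x -> 0 <= f x)%E -> (forall x, D x -> f x <= g x)%E ->
  (\int[mu]_(x in D) f x <= \int[mu]_(x in D) g x)%E.
Proof.
move=> f0 fg; rewrite !(integral_mkcond D).
rewrite !ge0_integralTE; last 2 first.
  by move=> x; apply: erestrict_ge0 => // y Dy; exact: le_trans (f0 _ Dy) (fg _ Dy).
  by move=> x; apply: erestrict_ge0.
apply: ereal_sup_le => _ [h hf <-]; exists h => // x.
by apply: le_trans (hf x) _; apply: lee_restrict.
Qed.

Section enorm_theory.
Context {R : realType} {n : nat}.
Implicit Types (x y : 'rV[R]_n) (c : R).

Lemma enorm_ge0 x : 0 <= enorm x. Proof. exact: sqrtr_ge0. Qed.

Lemma sumsq_ge0 x : 0 <= \sum_i x ord0 i ^+ 2.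
Proof. by apply: sumr_ge0 => i _; exact: sqr_ge0. Qed.

Lemma enorm_sqr x : enorm x ^+ 2 = \sum_i x ord0 i ^+ 2.
Proof. by rewrite sqr_sqrtr// sumsq_ge0. Qed.

Lemma enorm0 : enorm (0 : 'rV[R]_n) = 0.
Proof.
by rewrite /enorm big1 ?sqrtr0// => i _; rewrite mxE expr0n.
Qed.

Lemma enormZ c x : enorm (c *: x) = `|c| * enorm x.
Proof.
rewrite /enorm; under eq_bigr do rewrite mxE exprMn.
by rewrite -mulr_sumr sqrtrM ?sqr_ge0// sqrtr_sqr.
Qed.

Lemma enormN x : enorm (- x) = enorm x.
Proof. by rewrite -scaleN1r enormZ normrN1 mul1r. Qed.

Lemma coord_le_enorm x i : `|x ord0 i| <= enorm x.
Proof.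
rewrite -(@ler_pXn2r _ 2)// ?nnegrE ?enorm_ge0// enorm_sqr real_normK ?num_real//.
by rewrite (bigD1 i)//= lerDl sumr_ge0// => j _; exact: sqr_ge0.
Qed.

Lemma enorm_eq0 x : enorm x = 0 -> x = 0.
Proof.
move=> x0; apply/rowP => i; rewrite mxE; apply/eqP.
by rewrite -normr_le0 -x0 coord_le_enorm.
Qed.

Lemma norm_le_enorm x : `|x| <= enorm x.
Proof.
rewrite /Num.norm /= mx_normrE; apply: bigmax_le; first exact: enorm_ge0.
by move=> [i j] _ /=; rewrite (ord1 i) coord_le_enorm.
Qed.

Lemma coord_le_norm x i : `|x ord0 i| <= `|x|.
Proof.
rewrite [leRHS]/Num.norm/= mx_normrE.
exact: (le_bigmax _ (fun ij : 'I_1 * 'I_n => `|x ij.1 ij.2|) (ord0, i)).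
Qed.

Lemma enorm_le_norm x : enorm x <= n%:R * `|x|.
Proof.
rewrite -(@ler_pXn2r _ 2)// ?nnegrE ?enorm_ge0 ?mulr_ge0// enorm_sqr.
apply: (@le_trans _ _ (\sum_(i < n) `|x| ^+ 2)).
  apply: ler_sum => i _; rewrite -[leLHS]real_normK ?num_real//.
  by rewrite lerXn2r ?nnegrE// coord_le_norm.
rewrite sumr_const card_ord -[leLHS]mulr_natl exprMn ler_wpM2r ?sqr_ge0//.
by rewrite -natrX ler_nat; case: (n) => // k; rewrite expnS expn1 leq_pmull.
Qed.

(** Cauchy-Schwarz: after division by the norms, use 2ab <= a^2 + b^2 in each coordinate; both
    normalised sums of squares are 1. Zero vectors are treated apart because of the division. *)
Lemma dot_le_enorm x y : `|\sum_i x ord0 i * y ord0 i| <= enorm x * enorm y.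
Proof.
have [/eqP/enorm_eq0 ->|x0] := boolP (enorm x == 0).
  by rewrite enorm0 mul0r big1 ?normr0// => i _; rewrite mxE mul0r.
have [/eqP/enorm_eq0 ->|y0] := boolP (enorm y == 0).
  by rewrite enorm0 mulr0 big1 ?normr0// => i _; rewrite mxE mulr0.
have xp : 0 < enorm x by rewrite lt_neqAle eq_sym x0 enorm_ge0.
have yp : 0 < enorm y by rewrite lt_neqAle eq_sym y0 enorm_ge0.
apply: le_trans (ler_norm_sum _ _ _) _.
rewrite -[leRHS]mul1r -ler_pdivrMr ?mulr_gt0//.
apply: (@le_trans _ _ (\sum_i (x ord0 i ^+ 2 / enorm x ^+ 2 +
    y ord0 i ^+ 2 / enorm y ^+ 2) / 2)).
  rewrite mulr_suml; apply: ler_sum => i _.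
  rewrite normrM -[X in X / _ + _]real_normK ?num_real//.
  rewrite -[X in (_ + X / _) / _]real_normK ?num_real//.
  set a := `|_|; set b := `|_|.
  have : 0 <= (a / enorm x - b / enorm y) ^+ 2 by exact: sqr_ge0.
  rewrite sqrrB !expr_div_n invfM.
  suff -> : a / enorm x * (b / enorm y) = a * b * ((enorm x)^-1 * (enorm y)^-1) by lra.
  by ring.
by rewrite -mulr_suml big_split/= -!mulr_suml -!enorm_sqr !divff ?sqrf_eq0//; lra.
Qed.

Lemma enormD x y : enorm (x + y) <= enorm x + enorm y.
Proof.
rewrite -(@ler_pXn2r _ 2)// ?nnegrE ?addr_ge0 ?enorm_ge0// sqrrD !enorm_sqr.
under eq_bigr do rewrite mxE sqrrD.
rewrite !big_split/= !lerD2r lerD2l -mulr2n lerMn2r/=.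
by apply: le_trans (ler_norm _) (dot_le_enorm _ _).
Qed.

Lemma enormB x y : enorm (x - y) = enorm (y - x).
Proof. by rewrite -opprB enormN. Qed.

Lemma enorm_dist x y : `|enorm x - enorm y| <= enorm (x - y).
Proof.
have h (u v : 'rV[R]_n) : enorm u - enorm v <= enorm (u - v).
  by have := enormD (u - v) v; rewrite subrK; lra.
by rewrite ler_norml h andbT lerNl opprB enormB h.
Qed.

Lemma continuous_enormB (a : 'rV[R]_n) : continuous (fun x => enorm (x - a)).
Proof.
move=> x; apply/(@cvgrPdist_lt _ _ _ (nbhs x) (nbhs_filter x)) => e e0.
apply/nbhs_ballP; exists (e / n.+1%:R); first by rewrite /= divr_gt0// ltr0n.
move=> y; rewrite -ball_normE /ball_/= => xy.
apply: le_lt_trans (enorm_dist _ _) _.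
rewrite opprB addrA subrK; apply: le_lt_trans (enorm_le_norm _) _.
apply: (@le_lt_trans _ _ (n.+1%:R * `|x - y|)).
  by rewrite ler_wpM2r// ler_nat.
by rewrite mulrC -ltr_pdivlMr ?ltr0n.
Qed.

Lemma open_eball (a : 'rV[R]_n) r : open (eball a r).
Proof.
rewrite (_ : eball a r = (fun x => enorm (x - a)) @^-1` [set x | x < r])//.
apply: open_comp; last exact: open_lt.
by move=> x _; exact: continuous_enormB.
Qed.

Lemma closed_closed_eball (a : 'rV[R]_n) r : closed (closed_eball a r).
Proof.
rewrite (_ : closed_eball a r = (fun x => enorm (x - a)) @^-1` [set x | x <= r])//.
apply: preimage_closed; last exact: closed_le.
by move=> x _; exact: continuous_enormB.
Qed.

Lemma nbhs_eball (a : 'rV[R]_n) (U : set 'rV[R]_n) : nbhs a U ->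
  exists2 e, 0 < e & eball a e `<=` U.
Proof.
move=> /nbhs_ballP[e /= e0 eU]; exists e => // y ya; apply: eU.
rewrite -ball_normE /ball_/= distrC; apply: le_lt_trans ya.
exact: norm_le_enorm.
Qed.

End enorm_theory.

Lemma compact_closed_eball (R : realType) (n : nat) (a : 'rV[R]_n) r :
  compact (closed_eball a r).
Proof.
apply: bounded_closed_compact; last exact: closed_closed_eball.
exists (`|a| + r); split; first exact: num_real.
move=> M /ltW rM x /= xr; apply: le_trans rM.
rewrite -(subrK a x) addrC; apply: le_trans (ler_normD _ _) _.
by rewrite lerD2l; exact: le_trans (norm_le_enorm _) xr.
Qed.

(** The part of the closed ball of radius r + 1 outside [U] is compact, so the distance to [a]
    attains its minimum there, and that minimum exceeds r. This turns the neighborhood in the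
    definition of the capacity into a larger concentric ball. *)
Lemma closed_eball_sub_open (R : realType) (n : nat) (a : 'rV[R]_n) (r : R)
    (U : set 'rV[R]_n) : open U -> closed_eball a r `<=` U ->
  exists2 r', r < r' & eball a r' `<=` U.
Proof.
move=> oU aU.
pose C := closed_eball a (r + 1) `&` ~` U.
have cC : compact C.
  apply: (subclosed_compact _ (@compact_closed_eball R n a (r + 1))).
    apply: closedI; first exact: closed_closed_eball.
    exact: open_closedC.
  by move=> x [].
have [C0|/set0P C0] := eqVneq C set0.
  exists (r + 1); first by rewrite ltrDl.
  move=> x xr; apply: contrapT => Ux; suff : C x by rewrite C0.
  by split => //; exact: ltW.
have cf : {within C, continuous (fun x => enorm (x - a))}.
  by apply: continuous_subspaceT => x; exact: continuous_enormB.
have [c Cc cm] := compact_EVT_min C0 cC cf.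
move: (Cc); rewrite inE => -[cr Uc].
have rc : r < enorm (c - a).
  by rewrite ltNge; apply/negP => h; apply: Uc; exact: aU.
exists (enorm (c - a)) => // x xc; apply: contrapT => Ux.
have Cx : C x by split => //; apply: ltW; exact: lt_le_trans xc cr.
have := cm x; rewrite inE => /(_ Cx).
by rewrite leNgt; move/negP; apply.
Qed.

(** * Lebesgue measure on R^n *)

(** The sigma-algebra is generated by the coordinates, so [U] is written as a countable union of
    boxes: those with rational centre and half-side 1/(k+1) that are contained in [U]. *)
Lemma measurable_open_rV (R : realType) (n : nat) (U : set 'rV[R]_n) :
  open U -> measurable U.
Proof.
move=> oU.
pose B (q : 'rV[rat]_n) (k : nat) : set 'rV[R]_n :=
  \big[setI/setT]_(i < n) [set x | `|x ord0 i - ratr (q ord0 i)| < k.+1%:R^-1].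
have BP q k x : B q k x <-> forall i, `|x ord0 i - ratr (q ord0 i)| < k.+1%:R^-1.
  rewrite /B -bigcap_seq; split => [h i|h i _]; last exact: h.
  by apply: (h i); rewrite /= mem_index_enum.
have mB q k : measurable (B q k).
  rewrite /B -bigcap_seq; apply: fin_bigcap_measurable => [|i _]; first exact: finite_seq.
  rewrite -[X in measurable X]setTI.
  have := @measurable_coord R n i measurableT
    [set t : R | `|t - ratr (q ord0 i)| < k.+1%:R^-1].
  apply; apply: open_measurable.
  rewrite (_ : [set _ | _] = ball (ratr (q ord0 i) : R) k.+1%:R^-1).
    exact: ball_open.
  by apply/seteqP; split => t /=; rewrite -ball_normE /ball_/= distrC.
rewrite (_ : U = \bigcup_(p : 'rV[rat]_n * nat)
    (if `[< B p.1 p.2 `<=` U >] then B p.1 p.2 else set0)).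
  apply: countable_bigcupT_measurable; first exact: countableP.
  by move=> [q k] /=; case: ifP.
apply/seteqP; split; last first.
  by move=> x [[q k] _] /=; case: asboolP => // h /h.
move=> x Ux.
have /nbhs_ballP[e /= e0 eU] : nbhs x U by exact: open_nbhs_nbhs.
(* Both x and y will lie within 1/(k+1) of the rational centre in every coordinate, whence e / 2. *)
have [k _ kP] := near_infty_natSinv_lt (PosNum (divr_gt0 e0 (ltr0n R 2))).
have ke : k.+1%:R^-1 < e / 2 by exact: (kP k (leqnn k)).
have /choice[q qP] : forall i : 'I_n, exists q : rat,
    `|x ord0 i - ratr q| < k.+1%:R^-1.
  move=> i; have : x ord0 i - k.+1%:R^-1 < x ord0 i by rewrite ltrBlDr ltrDl.
  move=> /rat_in_itvoo[q]; rewrite in_itv/= => /andP[q1 q2]; exists q.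
  rewrite ger0_norm ?subr_ge0 ?(ltW q2)//.
  by rewrite ltrBlDr -ltrBlDl in q1.
have Bx : B (\row_i q i) k x by apply/BP => i; rewrite mxE.
exists (\row_i q i, k) => //=; rewrite asboolT// => y /BP By.
apply: eU; rewrite -ball_normE /ball_/=.
rewrite /Num.norm/= mx_normrE; apply: (le_lt_trans (y := k.+1%:R^-1 + k.+1%:R^-1)).
  apply: bigmax_le; first by rewrite addr_ge0.
  move=> [i j] _ /=; rewrite !mxE (ord1 i).
  rewrite -(subrKA (ratr (q j))); apply: le_trans (ler_normD _ _) _.
  apply: lerD; first exact/ltW.
  by have := By j; rewrite mxE distrC => /ltW.
by rewrite [e]splitr ltrD.
Qed.

Lemma measurable_continuous_rV (R : realType) (n : nat) (f : 'rV[R]_n -> R) :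
  continuous f -> measurable_fun setT f.
Proof.
move=> /continuousP cf; apply: (measurability _ (RGenOpens.measurableE R)).
move=> _ [_ [a [b ->] <-]]; rewrite setTI; apply: measurable_open_rV.
exact/cf/interval_open.
Qed.

Lemma measurable_enorm_comp d (T : measurableType d) (R : realType) (n : nat)
    (D : set T) (v : T -> 'rV[R]_n) :
  measurable D -> (forall i, measurable_fun D (fun x => v x ord0 i)) ->
  measurable_fun D (fun x => enorm (v x)).
Proof.
move=> mD mv; rewrite /enorm.
apply: (@measurableT_comp _ _ _ _ _ _ (@Num.sqrt R)).
  apply: continuous_measurable_fun; exact: sqrt_continuous.
apply: measurable_sum => i; exact: measurable_funX.
Qed.

(** * Tonelli's theorem and affine changes of variables *)

Section integral_rV.
Context {R : realType}.
Notation mu := (@lebesgue_measure R).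
Local Open Scope ereal_scope.

Lemma integral_rVS (n : nat) (f : 'rV[R]_n.+1 -> \bar R) :
  measurable_fun setT f -> (forall x, 0 <= f x) ->
  \int[lebesgue_rV n.+1]_x f x =
  \int[mu]_t \int[lebesgue_rV n]_y f (cons_rV (t, y)).
Proof.
move=> mf f0.
transitivity (\int[pushforward (mu \x lebesgue_rV n) (@cons_rV R n)]_x f x) => //.
rewrite ge0_integral_pushforward//; last exact: measurable_cons_rV.
rewrite preimage_setT fubini_tonelli1//.
  by apply: measurableT_comp => //; exact: measurable_cons_rV.
by move=> x /=; exact: f0.
Qed.

(** The image of Lebesgue measure under t -> a + s t, multiplied by s, gives every half-open
    interval its length, so it is Lebesgue measure by uniqueness. *)
Lemma ge0_integral_affine (g : R -> \bar R) (a s : R) : (0 < s)%R ->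
  measurable_fun setT g -> (forall t, 0 <= g t) ->
  \int[mu]_t g t = s%:E * \int[mu]_t g (a + s * t)%R.
Proof.
move=> s0 mg g0.
pose phi (t : measurableTypeR R) : measurableTypeR R := (a + s * t)%R.
have mphi : measurable_fun setT phi.
  apply: measurable_funD; first exact: measurable_cst.
  exact: mulrl_measurable.
pose m : {measure set _ -> \bar R} :=
  measure_function_pushforward__canonical__measure_function_Measure
    (@lebesgue_measure R) mphi.
pose k : {nonneg R} := NngNum (ltW s0).
transitivity (\int[mscale k m]_t g t).
  apply: eq_measure_integral => A mA _.
  apply: lebesgue_measure_unique => //= _ [[u v] _ <-] /=.
  rewrite /mscale/= /m/= /pushforward.
  rewrite (_ : phi @^-1` _ = `]((u - a) / s)%R, ((v - a) / s)%R]%classic); last first.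
    apply/seteqP; split => t /=; rewrite !in_itv/= /phi.
      by rewrite ltr_pdivrMr// ler_pdivlMr// mulrC ltrBlDl lerBrDl.
    by rewrite ltr_pdivrMr// ler_pdivlMr// [(t * s)%R]mulrC ltrBlDl lerBrDl.
  rewrite !lebesgue_measure_itv/= !lte_fin ltr_pM2r ?invr_gt0// ltrD2r.
  case: ifPn => _; last by rewrite mule0.
  by rewrite -!EFinD -EFinM; congr EFin; field; rewrite gt_eqF.
rewrite ge0_integral_mscale//=; congr (_ * _).
by rewrite ge0_integral_pushforward.
Qed.

Lemma measurable_affine_rV n (a : 'rV[R]_n) (s : R) :
  measurable_fun setT (fun x : 'rV[R]_n => a + s *: x)%R.
Proof.
apply: measurable_fun_rV => i.
rewrite (_ : (fun _ => _) = (fun x : 'rV[R]_n => a ord0 i + s * x ord0 i)%R).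
  apply: measurable_funD; first exact: measurable_cst.
  by apply: measurable_funM; [exact: measurable_cst|exact: measurable_coord].
by apply/funext => x; rewrite !mxE.
Qed.

(** Induction on the dimension, one coordinate at a time. The formula serves three purposes: the
    volume of balls, translation invariance, and the substitution z = x + s y along rays. *)
Lemma integral_affine_rV n (a : 'rV[R]_n) (s : R) (f : 'rV[R]_n -> \bar R) :
  (0 < s)%R -> measurable_fun setT f -> (forall x, 0 <= f x) ->
  \int[lebesgue_rV n]_x f x =
  (s ^+ n)%:E * \int[lebesgue_rV n]_x f (a + s *: x)%R.
Proof.
move=> s0; elim: n a f => [|n IH] a f mf f0.
  rewrite expr0 mul1e; apply: eq_integral => x _; congr f.
  by apply/rowP => -[].
rewrite integral_rVS// integral_rVS; last 2 first.
  - by apply: measurableT_comp => //; exact: measurable_affine_rV.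
  - by move=> x; exact: f0.
pose a' : 'rV[R]_n := (\row_j a ord0 (lift ord0 j))%R.
pose g t := \int[lebesgue_rV n]_y f (cons_rV (t, y)).
have mfc : measurable_fun setT (f \o @cons_rV R n).
  by apply: measurableT_comp => //; exact: measurable_cons_rV.
have mg : measurable_fun setT g.
  by apply: (measurable_fun_fubini_tonelli_F (f \o @cons_rV R n)) => //= x; exact: f0.
have g0 t : 0 <= g t by apply: integral_ge0.
rewrite (ge0_integral_affine (a ord0 ord0) s0 mg)//.
rewrite exprS EFinM -muleA; congr (_ * _).
have e t : g (a ord0 ord0 + s * t)%R =
    (s ^+ n)%:E * \int[lebesgue_rV n]_y f (a + s *: cons_rV (t, y))%R.
  rewrite /g (IH a') //; last first.
    exact: (measurableT_comp mfc (pair1_measurable _)).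
  congr (_ * _); apply: eq_integral => y _; congr f.
  apply/rowP => i; rewrite !mxE; by case: unliftP => [j|] -> /=; rewrite ?mxE.
under eq_integral do rewrite e.
rewrite ge0_integralZl//.
- pose h := (fun p : measurableTypeR R * 'rV[R]_n => f (a + s *: cons_rV p)%R).
  apply: (measurable_fun_fubini_tonelli_F h) => [|x]; last exact: f0.
  apply: (measurableT_comp mf).
  apply: (measurableT_comp (measurable_affine_rV a s)); exact: measurable_cons_rV.
- by move=> t _; apply: integral_ge0.
- by rewrite lee_fin exprn_ge0// ltW.
Qed.
End integral_rV.

Lemma integral_indicT d (T : measurableType d) (R : realType)
    (mu : {measure set T -> \bar R}) (A : set T) : measurable A ->
  (\int[mu]_x (\1_A x)%:E = mu A)%E.
Proof. by move=> mA; rewrite integral_indic// setIT. Qed.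

Lemma measurable_inv (R : realType) :
  measurable_fun setT (fun x : R => x^-1 : R).
Proof.
rewrite -(setvU [set 0 : R]); apply/measurable_funU => //.
  exact: measurableC.
split.
  apply: open_continuous_measurable_fun.
    exact/closed_openC/accessible_closed_set1/hausdorff_accessible/Rhausdorff.
  by move=> x; rewrite inE => /eqP x0; exact: inv_continuous.
exact: measurable_fun_set1.
Qed.

Lemma measurable_setlt d (T : measurableType d) (R : realType) (f g : T -> R) :
  measurable_fun setT f -> measurable_fun setT g ->
  measurable [set x | f x < g x].
Proof.
move=> mf mg; have := measurable_fun_ltr mf mg measurableT (I : measurable [set true]).
by rewrite setTI.
Qed.

Lemma measurable_setle d (T : measurableType d) (R : realType) (f g : T -> R) :
  measurable_fun setT f -> measurable_fun setT g ->
  measurable [set x | f x <= g x].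
Proof.
move=> mf mg; have := measurable_fun_ler mf mg measurableT (I : measurable [set true]).
by rewrite setTI.
Qed.

Lemma integral_itv_is_derive (R : realType) (f F : R -> R) (a b : R) : a <= b ->
  {within `[a, b], continuous f} ->
  (forall x, a <= x <= b -> is_derive x 1 F (f x)) ->
  (\int[lebesgue_measure]_(x in `[a, b]) (f x)%:E = (F b - F a)%:E)%E.
Proof.
rewrite le_eqVlt => /predU1P[<- _ _|ab cf dF].
  by rewrite set_itv1 integral_set1 subrr.
have cF x : a <= x <= b -> {for x, continuous F}.
  move=> /dF[dFx _]; exact/differentiable_continuous/derivable1_diffP.
rewrite (continuous_FTC2 (F := F) ab cf) ?EFinB//.
- split.
  + by move=> x; rewrite in_itv/= => /andP[ax xb]; case: (dF x) => //; rewrite !ltW.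
  + by apply: cvg_at_right_filter; apply: cF; rewrite lexx ltW.
  + by apply: cvg_at_left_filter; apply: cF; rewrite lexx ltW.
- move=> x; rewrite in_itv/= => /andP[ax xb]; rewrite derive1E.
  by apply: derive_val; apply: dF; rewrite !ltW.
Qed.

Section inv_powers.
Context {R : realType}.

Lemma is_derive_invX (m : nat) (x : R) : 0 < x ->
  is_derive x 1 (fun s : R => (s^-1) ^+ m) (- m%:R * (x^-1) ^+ m.+1).
Proof.
move=> x0.
have h : is_derive x 1 (fun s : R => s^-1) (- (x^-1) ^+ 2).
  have := @is_deriveV R id x 1 1 (lt0r_neq0 x0) (is_derive_id _ _).
  by rewrite -exprVn /GRing.scale/= mulr1.
have := @is_deriveX _ _ _ m _ _ _ h.
rewrite (_ : _ ^+ m = (fun s : R => (s^-1) ^+ m)); last first.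
  by apply/funext => s; elim: m => [|k ih]; rewrite ?expr0// !exprS -ih.
rewrite (_ : _ *: _ = - m%:R * (x^-1) ^+ m.+1)//.
rewrite /GRing.scale/=; case: m => [|k]; first by rewrite !mul0r oppr0 mul0r.
by rewrite mulrN mulNr -mulrA -exprD addn2.
Qed.

Lemma continuous_invX (m : nat) (x : R) : 0 < x ->
  {for x, continuous (fun s : R => (s^-1) ^+ m)}.
Proof.
move=> x0; apply/differentiable_continuous/derivable1_diffP.
by case: (is_derive_invX m x0).
Qed.

Lemma integral_invX (m : nat) (a b : R) : 0 < a -> a <= b ->
  (\int[lebesgue_measure]_(s in `[a, b]) (m%:R * (s^-1) ^+ m.+1)%:E =
   ((a^-1) ^+ m - (b^-1) ^+ m)%:E)%E.
Proof.
move=> a0 ab.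
have d x : a <= x <= b ->
    is_derive x 1 (fun s : R => - 1 * (s^-1) ^+ m) (m%:R * (x^-1) ^+ m.+1).
  move=> /andP[ax _].
  have := @is_deriveZ _ _ _ _ (- 1) _ _ _ (is_derive_invX m (lt_le_trans a0 ax)).
  rewrite (_ : _ *: (_ * _) = m%:R * (x^-1) ^+ m.+1)//.
  by rewrite /GRing.scale/= mulN1r mulNr opprK.
have c : {within `[a, b], continuous (fun s : R => m%:R * (s^-1) ^+ m.+1)}.
  apply: continuous_in_subspaceT => x; rewrite inE/= in_itv/= => /andP[ax _].
  apply: cvgM; first exact: cvg_cst.
  exact: continuous_invX (lt_le_trans a0 ax).
by rewrite (integral_itv_is_derive ab c d); congr EFin; rewrite !mulN1r opprK addrC.
Qed.
End inv_powers.

Lemma measurable_eball (R : realType) n (a : 'rV[R]_n) r : measurable (eball a r).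
Proof. by apply: measurable_open_rV; exact: open_eball. Qed.

(** * Volumes of balls *)

Section ball_measure.
Context {R : realType} {m : nat}.
Notation n := m.+1.
Implicit Types (a : 'rV[R]_n) (r : R).

Lemma measurable_enorm : measurable_fun setT (@enorm R n).
Proof.
apply: measurable_continuous_rV => x.
by have := @continuous_enormB R n 0 x; under eq_fun do rewrite subr0.
Qed.

Lemma lebesgue_eball a r : 0 <= r ->
  lebesgue_rV n (eball a r) = ((r ^+ n)%:E * lebesgue_rV n (eball 0 1))%E.
Proof.
rewrite le_eqVlt => /predU1P[<-|r0].
  rewrite expr0n/= mul0e (_ : eball a 0 = set0) ?measure0//.
  apply/seteqP; split => // x; rewrite /eball/= => h.
  by have := enorm_ge0 (x - a); rewrite leNgt h.
rewrite -integral_indicT; last exact: measurable_eball.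
have mb : measurable_fun setT (fun x : 'rV[R]_n => (\1_(eball a r) x)%:E : \bar R).
  by apply/measurable_EFinP/measurable_indic; exact: measurable_eball.
rewrite (integral_affine_rV a r0 mb)//.
congr (_ * _)%E.
rewrite -integral_indicT; last exact: measurable_eball.
apply: eq_integral => x _; rewrite !indicE; congr (nat_of_bool _)%:R%:E.
have e : (enorm (a + r *: x - a) < r) = (enorm (x - 0) < 1).
  by rewrite [a + _]addrC addrK subr0 enormZ gtr0_norm// -[ltRHS]mulr1 ltr_pM2l.
by apply/idP/idP; rewrite !inE /eball/= e.
Qed.
End ball_measure.

Lemma measurable_box (R : realType) n (M : R) :
  measurable [set x : 'rV[R]_n | forall i, `|x ord0 i| <= M].
Proof.
rewrite (_ : mkset _ = \bigcap_i [set x : 'rV[R]_n | `|x ord0 i| <= M]); last first.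
  by apply/seteqP; split => x h i; [move=> _; exact: h|exact: h].
apply: fin_bigcap_measurable => // i _; apply: measurable_setle => //.
by apply: measurableT_comp => //; exact: measurable_coord.
Qed.

Lemma lebesgue_box_fin (R : realType) n (M : R) : 0 <= M ->
  (lebesgue_rV n [set x : 'rV[R]_n | forall i, (`|x ord0 i| <= M)%R] < +oo)%E.
Proof.
move=> M0; elim: n => [|n IH].
  by rewrite /= diracE ltry.
pose B := [set x : 'rV[R]_n | forall i, `|x ord0 i| <= M].
have mB : measurable B by exact: measurable_box.
rewrite /= /lebesgue_rV_step /pushforward.
rewrite (_ : _ @^-1` _ = `[- M, M]%classic `*` B); last first.
  apply/seteqP; split => [[t y] /= h|[t y] /= [+ h] i].
    split; first by have := h ord0; rewrite mxE unlift_none /= in_itv/= ler_norml.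
    by move=> i /=; have := h (lift ord0 i); rewrite mxE liftK.
  rewrite in_itv/= -ler_norml => tM; rewrite mxE.
  by case: unliftP => [j|] _ //=; exact: h.
rewrite product_measure1E// lte_mul_pinfty//.
rewrite (_ : _ `[- M, M]%classic = lebesgue_measure `[- M, M]%classic)//.
by rewrite lebesgue_measure_itv/=; case: ifP.
Qed.

(** The ball lies in a cube of finite measure. Hence [fine] loses nothing and the volume of the unit
    ball can be used as a real number. *)
Lemma unit_ball_fin_num (R : realType) n :
  lebesgue_rV n (eball (0 : 'rV[R]_n) 1) \is a fin_num.
Proof.
rewrite ge0_fin_numE//; apply: le_lt_trans (@lebesgue_box_fin R n 1 ler01).
apply: le_measure; rewrite ?inE; [exact: measurable_eball|exact: measurable_box|].
move=> x; rewrite /eball/= subr0 => /ltW x1 i; exact: le_trans (coord_le_enorm _ _) x1.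
Qed.

(** * The bathtub principle and the layer cake formula *)

Section bathtub.
Context {R : realType} {m : nat}.
Notation n := m.+1.
Notation leb := (lebesgue_rV n).
Let Om : R := fine (leb (eball (0 : 'rV[R]_n) 1)).

Lemma lebesgue_eballE (x : 'rV[R]_n) (s : R) : 0 <= s ->
  leb (eball x s) = (Om * s ^+ n)%:E.
Proof.
move=> s0; rewrite lebesgue_eball// -(fineK (unit_ball_fin_num R n)) -EFinM.
by rewrite mulrC.
Qed.

Lemma lebesgue_shell (x : 'rV[R]_n) (r s : R) : 0 <= r -> r <= s ->
  leb (eball x s `\` eball x r) = (Om * (s ^+ n - r ^+ n))%:E.
Proof.
move=> r0 rs; have s0 := le_trans r0 rs.
rewrite measureD//=; [|exact: measurable_eball|exact: measurable_eball|]; last first.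
  by rewrite -[X in (X < _)%E]/(leb _) lebesgue_eballE// ltry.
rewrite (_ : eball x s `&` eball x r = eball x r); last first.
  by apply/setIidPr => y; rewrite /eball/= => yr; exact: lt_le_trans yr rs.
rewrite -[X in (X - _)%E]/(leb _) -[X in (_ - X)%E]/(leb _).
by rewrite !lebesgue_eballE// -EFinB -mulrBr.
Qed.

Lemma unit_ball_ge0 : 0 <= Om. Proof. exact: fine_ge0. Qed.

Lemma root_pow (b : R) : 0 <= b -> (b `^ n%:R^-1) ^+ n = b.
Proof.
by move=> b0; rewrite -powR_mulrn ?powR_ge0// -powRrM mulVf ?powRr1// pnatr_eq0.
Qed.

Lemma pow_root (b : R) : 0 <= b -> (b ^+ n) `^ n%:R^-1 = b.
Proof.
by move=> b0; rewrite -powR_mulrn// -powRrM divff ?powRr1// pnatr_eq0.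
Qed.

(* |z - x|^(1-n) <= rho^(1-n) + m int_r^rho s^(-n) 1_{|z-x| < s} ds, with equality
   on the shell r <= |z - x| < rho, which has the same measure as D. *)
Lemma shell_weight_bound (x : 'rV[R]_n) (D : set 'rV[R]_n) (r rho : R) :
  measurable D -> 0 < r -> r <= rho -> D `<=` ~` eball x r ->
  leb D = (Om * (rho ^+ n - r ^+ n))%:E ->
  (\int[leb]_(z in D) (((enorm (z - x))^-1) ^+ m)%:E <=
    (n%:R * Om * (rho - r))%:E)%E.
Proof.
move=> mD r0 rrho Dr Dm.
have rho0 := lt_le_trans r0 rrho.
have mB : measurable [set p : 'rV[R]_n * measurableTypeR R |
    enorm (p.1 - x) < (p.2 : R)].
  apply: measurable_setlt => //.
  apply: (@measurableT_comp _ _ _ _ _ _ (fun z : 'rV[R]_n => enorm (z - x)) _ fst) => //.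
  by apply: measurable_continuous_rV; exact: continuous_enormB.
pose w (s : measurableTypeR R) : R := \1_(`[r, rho]%classic) s * (m%:R * (s^-1) ^+ n).
have w0 s : 0 <= w s.
  rewrite /w indicE; have [|_] := boolP (s \in _); last by rewrite mul0r.
  rewrite inE/= in_itv/= => /andP[rs _]; rewrite mul1r mulr_ge0// exprn_ge0// invr_ge0.
  by rewrite (le_trans (ltW r0)).
have mw : measurable_fun setT w.
  apply: measurable_funM; first by apply: measurable_indic; exact: measurable_itv.
  apply: measurable_funM; first exact: measurable_cst.
  by apply: measurable_funX; exact: measurable_inv.
pose h (p : 'rV[R]_n * measurableTypeR R) : R :=
  \1_D p.1 * w p.2 * \1_[set p : 'rV[R]_n * measurableTypeR R |
    enorm (p.1 - x) < (p.2 : R)] p.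
have h0 p : 0 <= h p by apply: mulr_ge0; [apply: mulr_ge0 => //; rewrite indicE|rewrite indicE].
have mh : measurable_fun setT (EFin \o h).
  apply/measurable_EFinP; apply: measurable_funM; last exact: measurable_indic.
  apply: measurable_funM; last exact: measurableT_comp.
  by apply: (@measurableT_comp _ _ _ _ _ _ (\1_D : 'rV[R]_n -> R) _ fst).
have gle z : D z -> ((((enorm (z - x))^-1) ^+ m)%:E <=
    ((rho^-1) ^+ m)%:E + \int[lebesgue_measure]_s (h (z, s))%:E)%E.
  move=> Dz; have rz : r <= enorm (z - x) by rewrite leNgt; apply/negP; exact: Dr.
  have z0 := lt_le_trans r0 rz.
  have [zrho|rhoz] := ltP (enorm (z - x)) rho; last first.
    rewrite -[leLHS]adde0; apply: leeD; last first.
      by apply: integral_ge0 => s _; rewrite lee_fin.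
    by rewrite lee_fin lerXn2r ?nnegrE ?invr_ge0 ?(ltW z0) ?(ltW rho0)// lef_pV2.
  set g := ((enorm (z - x))^-1 ^+ m)%R; set g' := (rho^-1 ^+ m)%R.
  suff : ((g - g')%:E <= \int[lebesgue_measure]_s (h (z, s))%:E)%E.
    move=> /(leeD2l g'%:E); apply: le_trans.
    by rewrite -EFinD lee_fin; lra.
  rewrite -integral_invX ?(ltW zrho)// -integral_itv_obnd_cbnd; last first.
    apply/measurable_EFinP; apply: measurable_funM; first exact: measurable_cst.
    by apply: measurable_funTS; apply: measurable_funX; exact: measurable_inv.
  rewrite integral_mkcond; apply: le_integral_ge0 => s _.
    apply: erestrict_ge0 => t; rewrite /= in_itv/= => /andP[zt _].
    by rewrite lee_fin mulr_ge0// exprn_ge0// invr_ge0 (le_trans (ltW z0))// ltW.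
  rewrite patchE; case: ifPn => [|_]; last by rewrite lee_fin.
  rewrite inE/= in_itv/= => /andP[zs srho].
  rewrite lee_fin /h /w !indicE !mem_set//= ?mul1r ?mulr1//.
  by rewrite in_itv/= srho andbT (le_trans rz)// ltW.
apply: (@le_trans _ _ (\int[leb]_z ((\1_D z * (rho^-1) ^+ m)%:E +
    \int[lebesgue_measure]_s (h (z, s))%:E))%E).
  rewrite integral_mkcond; apply: le_integral_ge0 => z _.
    by apply: erestrict_ge0 => t _; rewrite lee_fin exprn_ge0// invr_ge0 enorm_ge0.
  rewrite patchE; case: ifPn => zD; last first.
    apply: adde_ge0; last by apply: integral_ge0 => s _; rewrite lee_fin.
    by rewrite lee_fin indicE mulr_ge0// exprn_ge0// invr_ge0 ltW.
  by rewrite indicE zD mul1r; apply: gle; exact/set_mem.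
rewrite ge0_integralD//=; last 4 first.
- by move=> z _; rewrite lee_fin indicE mulr_ge0// exprn_ge0// invr_ge0 ltW.
- by apply/measurable_EFinP; apply: measurable_funM => //; exact: measurable_indic.
- by move=> z _; apply: integral_ge0 => s _; rewrite lee_fin.
- exact: (measurable_fun_fubini_tonelli_F (EFin \o h)).
rewrite (fubini_tonelli (EFin \o h))//=.
have -> : (\int[leb]_z (\1_D z * (rho^-1) ^+ m)%:E =
    (Om * (rho ^+ n - r ^+ n) * (rho^-1) ^+ m)%:E)%E.
  under eq_integral do rewrite mulrC EFinM.
  rewrite ge0_integralZl_EFin//; last 2 first.
  - by apply/measurable_EFinP; exact: measurable_indic.
  - by rewrite exprn_ge0// invr_ge0 ltW.
  have -> : (\int[leb]_z (\1_D z)%:E = leb D)%E by exact: integral_indicT.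
  by rewrite Dm -EFinM mulrC.
(* [f] is m s^(-n) Om (s^n - r^n), obtained from the weight by bounding the measure of D inside B(x,
   s) by that of B(x, s) minus B(x, r); [F] is its primitive. The terms in rho^(-m) cancel in the
   final sum. *)
pose f (s : R) := m%:R * Om - (r ^+ n * Om) * (m%:R * (s^-1) ^+ n).
pose F (s : R) := (m%:R * Om) * s + (r ^+ n * Om) * (s^-1) ^+ m.
have dF s : r <= s <= rho -> is_derive s 1 F (f s).
  move=> /andP[rs _].
  have h1 := @is_deriveZ _ _ _ _ (m%:R * Om) _ _ _ (@is_derive_id R R s 1).
  have h2 := @is_deriveZ _ _ _ _ (r ^+ n * Om) _ _ _
    (is_derive_invX m (lt_le_trans r0 rs)).
  apply: (@is_derive_eq _ _ _ _ _ _ _ _ (is_deriveD h1 h2)).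
  by rewrite /f /GRing.scale/=; ring.
have cf : {within `[r, rho], continuous f}.
  apply: continuous_in_subspaceT => s; rewrite inE/= in_itv/= => /andP[rs _].
  apply: cvgB; first exact: cvg_cst.
  apply: cvgM; first exact: cvg_cst.
  apply: cvgM; first exact: cvg_cst.
  exact: continuous_invX (lt_le_trans r0 rs).
apply: (@le_trans _ _ ((Om * (rho ^+ n - r ^+ n) * (rho^-1) ^+ m)%:E +
   \int[lebesgue_measure]_(s in `[r, rho]) (f s)%:E)%E).
  apply: leeD2l; rewrite [leRHS]integral_mkcond; apply: le_integral_ge0 => s _.
    by apply: integral_ge0 => z _; rewrite lee_fin.
  rewrite patchE; case: ifPn => sr; last first.
    rewrite integral0_eq// => z _.
    by rewrite /h /w/= [\1_(`[_, _]%classic) _]indicE (negbTE sr)/= mul0r mulr0 mul0r.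
  have := sr; rewrite inE/= in_itv/= => /andP[rs srho].
  have s0 := lt_le_trans r0 rs.
  have -> : (\int[leb]_x (h (x, s))%:E =
     (w s)%:E * leb (D `&` [set z | (enorm (z - x) < s)%R]))%E.
    have mE : measurable (eball x s) by exact: measurable_eball.
    rewrite -integral_indicT; last exact: measurableI.
    rewrite -ge0_integralZl_EFin//; last first.
      by apply/measurable_EFinP; apply: measurable_indic; exact: measurableI.
    apply: eq_integral => z _; rewrite -EFinM /h/= indicI/=.
    rewrite [_ * w s]mulrC -mulrA; congr (_ * (_ * _))%:E.
  have : (leb (D `&` eball x s) <= leb (eball x s `\` eball x r))%E.
    apply: le_measure; rewrite ?inE; last by move=> z [/Dr].
      by apply: measurableI => //; exact: measurable_eball.
    by apply: measurableD; exact: measurable_eball.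
  rewrite lebesgue_shell ?(ltW r0)// => /lee_wpmul2l h1.
  apply: (le_trans (h1 (w s)%:E _)); first by rewrite lee_fin.
  rewrite -EFinM lee_fin /w indicE sr mul1r /f exprVn.
  rewrite le_eqVlt; apply/orP; left; apply/eqP; field.
  by rewrite ?expf_neq0 ?gt_eqF.
rewrite (integral_itv_is_derive rrho cf dF) -EFinD lee_fin /F.
rewrite !exprVn !exprS le_eqVlt; apply/orP; left; apply/eqP.
rewrite -[n%:R]natr1; field.
by rewrite !expf_neq0 ?gt_eqF.
Qed.

(** Put q = r / rho and divide by rho^n: the claim becomes (1 - q)^n <= (1 - q^n) (1 - (r/M)^n)^m.
    One factor uses q^n <= q, the other m use (r/M)^n <= q^n <= q. This is the origin of the factor
    1 - (r/M)^n in the capacity bound. *)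
Lemma shell_dim_bound (r rho M : R) : 0 < r -> r <= rho -> rho <= M ->
  (rho - r) ^+ n <= (rho ^+ n - r ^+ n) * (1 - (r / M) ^+ n) ^+ m.
Proof.
move=> r0 rrho rhoM.
have rho0 := lt_le_trans r0 rrho; have M0 := lt_le_trans rho0 rhoM.
pose q := r / rho.
have q0 : 0 <= q by rewrite divr_ge0// ltW.
have q1 : q <= 1 by rewrite ler_pdivrMr// mul1r.
have rE : r = q * rho by rewrite /q divfK// gt_eqF.
have qn : q ^+ n <= q.
  by rewrite exprS ler_piMr// exprn_ile1.
have rMq : (r / M) ^+ n <= q ^+ n.
  apply: lerXn2r; rewrite ?nnegrE ?divr_ge0 ?(ltW r0) ?(ltW M0) ?(ltW rho0)//.
  by rewrite /q ler_pM2l// lef_pV2.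
have -> : rho - r = (1 - q) * rho by rewrite mulrBl -rE mul1r.
have -> : rho ^+ n - r ^+ n = (1 - q ^+ n) * rho ^+ n.
  by rewrite mulrBl -exprMn -rE mul1r.
rewrite exprMn.
have h1 : 0 <= 1 - q by lra.
have h2 : 1 - q <= 1 - (r / M) ^+ n by lra.
rewrite mulrAC ler_pM2r ?exprn_gt0// exprS ler_pM ?exprn_ge0//; first by lra.
by apply: lerXn2r; rewrite ?nnegrE//; lra.
Qed.

(** The worst [D] of given measure is a shell r <= |z - x| < rho; containment in B(x, M) forces rho
    <= M, and [shell_dim_bound] then converts rho - r into a power of the measure of [D]. *)
Lemma bathtub (x : 'rV[R]_n) (D : set 'rV[R]_n) (r M : R) :
  measurable D -> 0 < r -> r <= M ->
  D `<=` ~` eball x r -> D `<=` eball x M ->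
  (\int[leb]_(z in D) (((enorm (z - x))^-1) ^+ m)%:E <=
    (n%:R * ((Om * (1 - (r / M) ^+ n)) ^+ m) `^ n%:R^-1 *
      (fine (leb D)) `^ n%:R^-1)%:E)%E.
Proof.
move=> mD r0 rM Dr DM; have M0 := lt_le_trans r0 rM.
have Dle : (leb D <= (Om * (M ^+ n - r ^+ n))%:E)%E.
  rewrite -(lebesgue_shell x (ltW r0) rM); apply: le_measure; rewrite ?inE//.
    by apply: measurableD; exact: measurable_eball.
  by move=> z Dz; split; [exact: DM|exact: Dr].
have Dfin : leb D \is a fin_num.
  by rewrite ge0_fin_numE//; exact: le_lt_trans Dle (ltry _).
set a := fine (leb D); have a0 : 0 <= a by exact: fine_ge0.
have aE : leb D = a%:E by rewrite fineK.
rewrite aE lee_fin in Dle.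
(* The radius rho is found by dividing by [Om]; if [Om] is 0, then [D] is null and the left side
   vanishes. *)
have [Om0|Om_neq0] := eqVneq Om 0.
  have D0 : leb D = 0%E.
    by rewrite aE; congr EFin; apply: le_anti; rewrite a0 andbT (le_trans Dle)// Om0 mul0r.
  rewrite null_set_integral//; last first.
    apply: measurable_funTS; apply/measurable_EFinP; apply: measurable_funX.
    apply: (measurableT_comp (@measurable_inv R)).
    by apply: measurable_continuous_rV; exact: continuous_enormB.
  by rewrite lee_fin !mulr_ge0 ?powR_ge0.
have Om0 : 0 < Om by rewrite lt_neqAle eq_sym Om_neq0 unit_ball_ge0.
(* rho = b^(1/n) solves Om (rho^n - r^n) = a, so the shell has the measure of [D]. *)
pose b := a / Om + r ^+ n.
have b0 : 0 <= b by rewrite addr_ge0 ?divr_ge0 ?exprn_ge0// ltW.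
pose rho := b `^ n%:R^-1.
have rhon : rho ^+ n = b by exact: root_pow.
have rho0 : 0 <= rho by exact: powR_ge0.
have rrho : r <= rho.
  rewrite -(@ler_pXn2r _ n)// ?nnegrE ?(ltW r0)// rhon /b lerDr.
  by rewrite divr_ge0// ltW.
have rhoM : rho <= M.
  rewrite -(@ler_pXn2r _ n)// ?nnegrE ?(ltW M0)// rhon /b -lerBrDr.
  by rewrite ler_pdivrMr// mulrC.
have aE' : a = Om * (rho ^+ n - r ^+ n).
  by rewrite rhon /b addrK mulrCA divff ?mulr1.
have := shell_weight_bound mD r0 rrho Dr; rewrite aE aE' => /(_ erefl) h.
apply: (le_trans h); rewrite lee_fin -!mulrA ler_wpM2l//.
have c0 : 0 <= 1 - (r / M) ^+ n.
  by rewrite subr_ge0 exprn_ile1 ?divr_ge0 ?(ltW r0) ?(ltW M0)// ler_pdivrMr// mul1r.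
have p1 : 0 <= (Om * (1 - (r / M) ^+ n)) ^+ m.
  by apply: exprn_ge0; apply: mulr_ge0 => //; exact: ltW.
have p2 : 0 <= Om * (rho ^+ n - r ^+ n) by rewrite -aE'.
have p3 : 0 <= Om * (rho - r) by rewrite mulr_ge0 ?subr_ge0// ltW.
rewrite -powRM// -[leLHS]pow_root//.
apply: ge0_ler_powR; rewrite ?nnegrE ?invr_ge0 ?ler0n//.
- exact: exprn_ge0.
- exact: mulr_ge0.
rewrite exprMn.
apply: (le_trans (ler_wpM2l (exprn_ge0 n (ltW Om0)) (shell_dim_bound r0 rrho rhoM))).
rewrite le_eqVlt; apply/orP; left; apply/eqP.
move: (rho ^+ n - r ^+ n) (1 - (r / M) ^+ n) => A c.
rewrite exprMn [Om ^+ n]exprS; move: (Om ^+ m) (c ^+ m) => u v; ring.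
Qed.
End bathtub.

(** * The Lorentz quasinorm and the distribution function *)

Section lorentz_lower.
Context {R : realType} {m : nat}.
Notation n := m.+1.
Notation leb := (lebesgue_rV n).
Notation mu := (@lebesgue_measure R).
Let p : R := n%:R^-1.
Let Om : R := fine (leb (eball (0 : 'rV[R]_n) 1)).

Lemma measurable_powR_div : measurable_fun setT (fun t : R => t `^ p / t).
Proof.
apply: measurable_funM; first exact: measurable_powR.
exact: measurable_inv.
Qed.

Lemma integral_powR_div_cc (e L : R) : 0 < e -> e <= L ->
  (\int[mu]_(t in `[e, L]) (t `^ p / t)%:E = (n%:R * (L `^ p - e `^ p))%:E)%E.
Proof.
move=> e0 eL.
have d t : e <= t <= L ->
    is_derive t 1 (fun t : R => n%:R * t `^ p) (t `^ p / t).
  move=> /andP[et _]; have t0 := lt_le_trans e0 et.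
  have h := @is_deriveZ _ _ _ _ (n%:R) _ _ _ (is_derive1_powR p t0).
  apply: (@is_derive_eq _ _ _ _ _ _ _ _ h).
  rewrite /GRing.scale/= mulrA mulfV ?pnatr_eq0// mul1r.
  by rewrite powRB ?powRr1 ?(ltW t0)// (gt_eqF t0) implybT.
have c : {within `[e, L], continuous (fun t : R => t `^ p / t)}.
  apply: continuous_in_subspaceT => t; rewrite inE/= in_itv/= => /andP[et _].
  have t0 := lt_le_trans e0 et.
  have c1 : {for t, continuous (fun t : R => t `^ p)}.
    apply/differentiable_continuous/derivable1_diffP.
    by case: (is_derive1_powR p t0).
  apply: cvgM; first exact: c1.
  by apply: inv_continuous; rewrite gt_eqF.
by rewrite (integral_itv_is_derive eL c d) mulrBr.
Qed.

Lemma powR_div_ge0 (t : R) : 0 <= t -> 0 <= t `^ p / t.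
Proof. by move=> t0; rewrite divr_ge0// powR_ge0. Qed.

(** The integrand may blow up at 0, so the fundamental theorem of calculus is applied away from 0.
    Monotone convergence along [L/(k+1), L] gives one inequality, a single truncation with small
    loss the other. *)
Lemma integral_powR_div (L : R) : 0 <= L ->
  (\int[mu]_(t in `]0%R, L]) (t `^ p / t)%:E = (n%:R * L `^ p)%:E)%E.
Proof.
rewrite le_eqVlt => /predU1P[<-|L0].
  rewrite set_itvoc0 integral_set0 powR0 ?mulr0// /p invr_eq0 pnatr_eq0//.
have mf : measurable_fun setT (fun t : R => (t `^ p / t)%:E).
  by apply/measurable_EFinP; exact: measurable_powR_div.
apply/eqP; rewrite eq_le; apply/andP; split.
  pose F (k : nat) : set (measurableTypeR R) := `[L / k.+1%:R, L]%classic.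
  have FE : `]0%R, L]%classic = \bigcup_k F k.
    apply/seteqP; split => t /=.
      rewrite in_itv/= => /andP[t0 tL].
      have [k _ kP] := near_infty_natSinv_lt (PosNum (divr_gt0 t0 L0)).
      exists k => //; rewrite /F/= in_itv/= tL andbT mulrC -ler_pdivlMr//.
      by apply: ltW; exact: (kP k (leqnn k)).
    move=> [k _]; rewrite /F/= !in_itv/= => /andP[t0 ->]; rewrite andbT.
    by apply: lt_le_trans t0; rewrite divr_gt0.
  rewrite FE.
  have cF := @ge0_nondecreasing_set_cvg_integral _ _ R F
    (fun t : R => (t `^ p / t)%:E) mu.
  rewrite -(cvg_lim _ (cF _ _ _ _))//; last 4 first.
  - move=> i j ij; rewrite subsetEset => t; rewrite /F/= !in_itv/= => /andP[it ->].
    rewrite andbT; apply: le_trans it.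
    by rewrite ler_pM2l// lef_pV2 ?posrE ?ltr0n// ler_nat ltnS.
  - by move=> i; exact: measurable_itv.
  - by move=> i; exact: measurable_funTS.
  - move=> i t; rewrite /F/= in_itv/= => /andP[it _]; rewrite lee_fin powR_div_ge0//.
    by apply: le_trans it; rewrite divr_ge0// ltW.
  apply: lime_le.
    apply: cvgP; apply: cF.
    - move=> i j ij; rewrite subsetEset => t; rewrite /F/= !in_itv/= => /andP[it ->].
      rewrite andbT; apply: le_trans it.
      by rewrite ler_pM2l// lef_pV2 ?posrE ?ltr0n// ler_nat ltnS.
    - by move=> i; exact: measurable_itv.
    - by move=> i; exact: measurable_funTS.
    - move=> i t; rewrite /F/= in_itv/= => /andP[it _]; rewrite lee_fin powR_div_ge0//.
      by apply: le_trans it; rewrite divr_ge0// ltW.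
  apply: nearW => k; rewrite /F integral_powR_div_cc ?divr_gt0//; last first.
    by rewrite ler_pdivrMr// ler_peMr ?(ltW L0)// ler1n.
  by rewrite lee_fin ler_wpM2l// gerBl powR_ge0.
apply/lee_addgt0Pr => d d0.
(* The truncation is at d'^n, whose n-th root is d': the lost part is n d' <= d, and d' <= L^(1/n)
   keeps the truncation point below L. *)
pose d' := Num.min (d / n%:R) (L `^ p).
have d'0 : 0 < d' by rewrite lt_min divr_gt0// powR_gt0.
have e0 : 0 < d' ^+ n by rewrite exprn_gt0.
have eL : d' ^+ n <= L.
  rewrite -(root_pow (m := m) (ltW L0)) lerXn2r ?nnegrE ?(ltW d'0) ?powR_ge0//.
  by rewrite /d' ge_min lexx orbT.
apply: (@le_trans _ _ (\int[mu]_(t in `[(d' ^+ n)%R, L]) (t `^ p / t)%:E + d%:E)%E).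
  rewrite integral_powR_div_cc// -EFinD lee_fin (pow_root (m := m) (ltW d'0)).
  have : d' <= d / n%:R by rewrite /d' ge_min lexx.
  by rewrite ler_pdivlMr// => h; lra.
apply: leeD2r; apply: ge0_subset_integral => //=.
- exact: measurable_funTS.
- by move=> t; rewrite in_itv/= => /andP[t0 _]; rewrite lee_fin powR_div_ge0// ltW.
- move=> t /=; rewrite !in_itv/= => /andP[t0 ->]; rewrite andbT.
  exact: lt_le_trans t0.
Qed.

Section one_function.
Variables (Omega : set 'rV[R]_n) (f : 'rV[R]_n -> R).
Hypothesis mOmega : measurable Omega.
Hypothesis finOmega : (leb Omega < +oo)%E.
Hypothesis mf : measurable_fun Omega f.

Lemma measurable_superlevel s : measurable (Omega `&` [set x | s < `|f x|]).
Proof.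
have := @measurableT_comp _ _ _ _ _ _ (@Num.norm R R) _ f => h.
have mnf : measurable_fun Omega (fun x => `|f x|) by apply: h.
rewrite (_ : [set x | _] = (fun x => `|f x|) @^-1` `]s, +oo[%classic).
  by apply: mnf => //; exact: measurable_itv.
by apply/seteqP; split => x /=; rewrite in_itv/= andbT.
Qed.

Lemma distribution_fun_fin s : distribution_fun Omega f s \is a fin_num.
Proof.
rewrite ge0_fin_numE//; apply: le_lt_trans finOmega.
by apply: le_measure; rewrite ?inE//; exact: measurable_superlevel.
Qed.

(** A real-valued form of the distribution function, which is finite because [Omega] has finite
    measure; its n-th root can then be taken with [powR]. *)
Definition distr s : R := fine (distribution_fun Omega f s).

Lemma distrE s : distribution_fun Omega f s = (distr s)%:E.
Proof. by rewrite fineK// distribution_fun_fin. Qed.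

Lemma distr_ge0 s : 0 <= distr s. Proof. exact: fine_ge0. Qed.

Lemma distr_nonincreasing s t : s <= t -> distr t <= distr s.
Proof.
move=> st; rewrite -lee_fin -!distrE; apply: le_measure; rewrite ?inE.
- exact: measurable_superlevel.
- exact: measurable_superlevel.
- by move=> x [Ox /= tx]; split => //=; exact: le_lt_trans tx.
Qed.

Lemma measurable_distr : measurable_fun setT distr.
Proof.
by apply: nonincreasing_measurable => // s t st; exact: distr_nonincreasing.
Qed.

(* f^*(t) is at least the length of {s >= 0 : t < distr s}; apply Tonelli. *)
Lemma layer_le_lorentz :
  (\int[mu]_(s in `[0%R, +oo[) (n%:R * (distr s) `^ p)%:E <= lorentz Omega f)%E.
Proof.
have mS : measurable [set q : measurableTypeR R * measurableTypeR R |
    (q.1 : R) < distr q.2].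
  apply: measurable_setlt => //.
  by apply: (@measurableT_comp _ _ _ _ _ _ distr _ snd) => //; exact: measurable_distr.
pose w (t : measurableTypeR R) : R := \1_(`]0%R, +oo[%classic) t * (t `^ p / t).
pose u (s : measurableTypeR R) : R := \1_(`[0%R, +oo[%classic) s.
pose h (q : measurableTypeR R * measurableTypeR R) : R :=
  w q.1 * (u q.2 * \1_[set q : measurableTypeR R * measurableTypeR R |
    (q.1 : R) < distr q.2] q).
have w0 t : 0 <= w t.
  rewrite /w indicE; have [|_] := boolP (t \in _); last by rewrite mul0r.
  by rewrite inE/= in_itv/= andbT mul1r => /ltW/powR_div_ge0.
have mw : measurable_fun setT w.
  apply: measurable_funM; last exact: measurable_powR_div.
  by apply: measurable_indic; exact: measurable_itv.
have mu' : measurable_fun setT u by apply: measurable_indic; exact: measurable_itv.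
have h0 q : 0 <= h q by apply: mulr_ge0 => //; rewrite /u !indicE mulr_ge0.
have mh : measurable_fun setT (EFin \o h).
  apply/measurable_EFinP; apply: measurable_funM.
    by apply: (@measurableT_comp _ _ _ _ _ _ w _ fst).
  apply: measurable_funM.
    by apply: (@measurableT_comp _ _ _ _ _ _ u _ snd).
  exact: measurable_indic.
(* n (distr s)^(1/n) is the integral of t^(1/n - 1) over 0 < t < distr s, so the left side becomes a
   double integral over the region t < distr s. *)
apply: (@le_trans _ _ (\int[mu]_s \int[mu]_t (h (t, s))%:E)%E).
  rewrite integral_mkcond; apply: le_integral_ge0 => s _.
    by apply: erestrict_ge0 => t _; rewrite lee_fin mulr_ge0// powR_ge0.
  rewrite patchE; case: ifPn => sr; last by apply: integral_ge0 => t _; rewrite lee_fin.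
  rewrite -integral_powR_div ?distr_ge0// -integral_itv_bndo_bndc; last first.
    by apply/measurable_EFinP; apply: measurable_funTS; exact: measurable_powR_div.
  rewrite integral_mkcond; apply: le_integral_ge0 => t _.
    apply: erestrict_ge0 => t'; rewrite /= in_itv/= => /andP[/ltW t0 _].
    by rewrite lee_fin powR_div_ge0.
  rewrite patchE; case: ifPn => [|_]; last by rewrite lee_fin.
  rewrite inE/= in_itv/= => /andP[t0 ts].
  rewrite lee_fin /h/= /w /u [\1_(`[_, +oo[%classic) _]indicE sr !indicE !mem_set//=.
    by rewrite !mul1r mulr1.
  by rewrite in_itv/= t0.
rewrite -(fubini_tonelli (EFin \o h))//=.
rewrite /lorentz [leRHS]integral_mkcond; apply: le_integral_ge0 => t _.
  by apply: integral_ge0 => s _; rewrite lee_fin.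
rewrite patchE; case: ifPn => tr; last first.
  by rewrite integral0_eq// => s _; rewrite /h/= /w indicE (negbTE tr) !mul0r.
have := tr; rewrite inE/= in_itv/= andbT => t0.
have wt : w t = t `^ p / t by rewrite /w indicE tr mul1r.
under eq_integral do rewrite /h/= EFinM.
rewrite ge0_integralZl_EFin//; last 2 first.
- by move=> s _; rewrite lee_fin /u !indicE mulr_ge0.
- apply/measurable_EFinP; apply: measurable_funM => //.
  have mc : measurable_fun setT (fun s : measurableTypeR R => (t, s)).
    exact: pair1_measurable.
  by apply: (@measurableT_comp _ _ _ _ _ _
    (\1_[set q : measurableTypeR R * measurableTypeR R | (q.1 : R) < distr q.2] : _ -> R) _
    (fun s : measurableTypeR R => (t, s))); first exact: measurable_indic.
rewrite wt; apply: lee_wpmul2l; first by rewrite lee_fin powR_div_ge0// ltW.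
(* Every level v admissible in the infimum satisfies distr v <= t; by monotonicity, s >= 0 and t <
   distr s then force s < v. *)
apply: le_ereal_inf_tmp => _ [v [v0 lv] <-].
rewrite (_ : v%:E = \int[mu]_s (\1_(`[0%R, v[%classic) s)%:E)%E; last first.
  rewrite integral_indicT//.
  rewrite (_ : _ `[0%R, v[%classic = lebesgue_measure `[0%R, v[%classic)//.
  by rewrite lebesgue_measure_itv/= lte_fin; case: ltgtP v0 => // [_ _|<- _]; rewrite -?EFinB ?subr0.
apply: le_integral_ge0 => s _; first by rewrite lee_fin /u !indicE mulr_ge0.
rewrite lee_fin /u !indicE.
have [|_] := boolP (s \in _); last by rewrite mul0r.
rewrite inE/= in_itv/= andbT => s0; rewrite mul1r.
have [|_] := boolP ((t, s) \in _); last by [].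
rewrite inE/= => ts; rewrite mem_set//= in_itv/= s0/= ltNge; apply/negP => vs.
have := distr_nonincreasing vs; rewrite leNgt => /negP; apply.
by apply: le_lt_trans ts; rewrite -lee_fin -distrE.
Qed.
End one_function.
End lorentz_lower.

Section weight_lorentz.
Context {R : realType} {m : nat}.
Notation n := m.+1.
Notation leb := (lebesgue_rV n).
Notation mu := (@lebesgue_measure R).
Let p : R := n%:R^-1.
Let Om : R := fine (leb (eball (0 : 'rV[R]_n) 1)).

Lemma lebesgue_bounded_lty (Omega : set 'rV[R]_n) (x : 'rV[R]_n) (M : R) :
  0 <= M -> measurable Omega -> Omega `<=` eball x M -> (leb Omega < +oo)%E.
Proof.
move=> M0 mO OM; apply: (@le_lt_trans _ _ (leb (eball x M))).
  by apply: le_measure; rewrite ?inE//; exact: measurable_eball.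
by rewrite lebesgue_eballE// ltry.
Qed.

(* Layer cake: write |f| as the integral of the indicators of {|f| > s} and apply
   bathtub to each of these sets. *)
Lemma integral_weight_le_lorentz (Omega : set 'rV[R]_n) (f : 'rV[R]_n -> R)
    (x : 'rV[R]_n) (r M : R) :
  measurable Omega -> Omega `<=` eball x M -> 0 < r -> r <= M ->
  measurable_fun Omega f ->
  (\int[leb]_(z in Omega `\` eball x r) (`|f z| * ((enorm (z - x))^-1) ^+ m)%:E
   <= (((Om * (1 - (r / M) ^+ n)) ^+ m) `^ p)%:E * lorentz Omega f)%E.
Proof.
move=> mO OM r0 rM mf; have M0 := lt_le_trans r0 rM.
have finO := lebesgue_bounded_lty (ltW M0) mO OM.
set K := _ `^ p; have K0 : 0 <= K by exact: powR_ge0.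
pose O' := Omega `\` eball x r.
have mO' : measurable O' by apply: measurableD => //; exact: measurable_eball.
pose g z : R := ((enorm (z - x))^-1) ^+ m.
have g0 z : 0 <= g z by rewrite exprn_ge0// invr_ge0 enorm_ge0.
have mg : measurable_fun setT g.
  apply: measurable_funX; apply: (measurableT_comp (@measurable_inv R)).
  by apply: measurable_continuous_rV; exact: continuous_enormB.
(* Extension by zero makes |f| measurable on the whole space, as the exchange of integrals
   requires. *)
pose F z := `|(f \_ Omega) z|.
have mF : measurable_fun setT F.
  by apply: measurableT_comp => //; apply/(measurable_restrictT f mO).
have FE z : Omega z -> F z = `|f z| by move=> Oz; rewrite /F patchE mem_set.
have mS : measurable [set q : 'rV[R]_n * measurableTypeR R | (q.2 : R) < F q.1].
  apply: measurable_setlt => //.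
  by apply: (@measurableT_comp _ _ _ _ _ _ F _ fst).
pose w (z : 'rV[R]_n) : R := \1_O' z * g z.
pose u (s : measurableTypeR R) : R := \1_(`[0%R, +oo[%classic) s.
pose h (q : 'rV[R]_n * measurableTypeR R) : R :=
  w q.1 * (u q.2 *
    \1_[set q : 'rV[R]_n * measurableTypeR R | (q.2 : R) < F q.1] q).
have w0 z : 0 <= w z by rewrite /w indicE mulr_ge0.
have mw : measurable_fun setT w by apply: measurable_funM => //; exact: measurable_indic.
have u0 s : 0 <= u s by rewrite /u indicE.
have mu' : measurable_fun setT u by apply: measurable_indic; exact: measurable_itv.
have h0 q : 0 <= h q by apply: mulr_ge0 => //; rewrite indicE mulr_ge0.
have mh : measurable_fun setT (EFin \o h).
  apply/measurable_EFinP; apply: measurable_funM.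
    by apply: (@measurableT_comp _ _ _ _ _ _ w _ fst).
  apply: measurable_funM; last exact: measurable_indic.
  by apply: (@measurableT_comp _ _ _ _ _ _ u _ snd).
apply: (@le_trans _ _ (\int[leb]_z \int[mu]_s (h (z, s))%:E)%E).
  rewrite integral_mkcond; apply: le_integral_ge0 => z _.
    by apply: erestrict_ge0 => t _; rewrite lee_fin mulr_ge0//; exact: g0.
  rewrite patchE; case: ifPn => zO; last by apply: integral_ge0 => t _; rewrite lee_fin.
  have wz : w z = g z by rewrite /w indicE zO mul1r.
  under eq_integral do rewrite /h/= EFinM.
  rewrite ge0_integralZl_EFin//; last 2 first.
  - by move=> s _; rewrite lee_fin indicE mulr_ge0.
  - apply/measurable_EFinP; apply: measurable_funM => //.
    have mc : measurable_fun setT (fun s : measurableTypeR R => (z, s)).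
      exact: pair1_measurable.
    by apply: (@measurableT_comp _ _ _ _ _ _
      (\1_[set q : 'rV[R]_n * measurableTypeR R | (q.2 : R) < F q.1] : _ -> R) _
      (fun s : measurableTypeR R => (z, s))); first exact: measurable_indic.
  rewrite wz mulrC EFinM; apply: lee_wpmul2l; first by rewrite lee_fin; exact: g0.
  have [Oz _] := set_mem zO.
  rewrite -FE// (_ : (F z)%:E = \int[mu]_s (\1_(`[0%R, F z[%classic) s)%:E)%E; last first.
    rewrite integral_indicT//.
    rewrite (_ : _ `[0%R, F z[%classic = lebesgue_measure `[0%R, F z[%classic)//.
    have : 0 <= F z by exact: normr_ge0.
    rewrite lebesgue_measure_itv/= lte_fin le_eqVlt => /predU1P[<-|->].
      by rewrite ltxx.
    by rewrite -EFinB subr0.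
  apply: le_integral_ge0 => s _; first by rewrite lee_fin indicE.
  rewrite lee_fin /u !indicE.
  have [|_] := boolP (s \in `[0%R, F z[%classic); last by rewrite mulr_ge0.
  rewrite inE/= in_itv/= => /andP[s0 sF]; rewrite !mem_set//= ?mulr1//.
  by rewrite in_itv/= s0.
rewrite (fubini_tonelli (EFin \o h))//=.
apply: (@le_trans _ _ (K%:E * \int[mu]_(s in `[0%R, +oo[) (n%:R * (distr Omega f s) `^ p)%:E)%E); last first.
  by apply: lee_wpmul2l; [rewrite lee_fin|exact: layer_le_lorentz].
have md : measurable_fun setT (fun s => (n%:R * (distr Omega f s) `^ p)%:E : \bar R).
  apply/measurable_EFinP; apply: measurable_funM; first exact: measurable_cst.
  apply: (measurableT_comp (measurable_powR p)).
  exact: measurable_distr.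
rewrite -ge0_integralZl_EFin//; last 2 first.
- by move=> s _; rewrite lee_fin mulr_ge0// powR_ge0.
- exact: measurable_funTS.
rewrite [leRHS]integral_mkcond; apply: le_integral_ge0 => s _.
  by apply: integral_ge0 => z _; rewrite lee_fin.
rewrite patchE; case: ifPn => sr; last first.
  by rewrite integral0_eq// => z _; rewrite /h/= /u indicE (negbTE sr) mul0r mulr0.
pose D := O' `&` [set z | s < F z].
have DE : D = O' `&` (Omega `&` [set z | s < `|f z|]).
  apply/seteqP; split => z [[Oz zr]]/=.
    by rewrite FE// => sF.
  by move=> [_ sF]; split => //=; rewrite FE.
have mD : measurable D.
  by rewrite DE; apply: measurableI => //; exact: measurable_superlevel.
have Ds : (leb D <= (distr Omega f s)%:E)%E.
  rewrite -distrE//; apply: le_measure; rewrite ?inE//.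
    exact: measurable_superlevel.
  by rewrite DE; exact: subIsetr.
rewrite (_ : \int[leb]_z (h (z, s))%:E = \int[leb]_(z in D) (g z)%:E)%E; last first.
  rewrite [RHS]integral_mkcond; apply: eq_integral => z _.
  rewrite patchE /h/= /u [\1_(`[_, +oo[%classic) _]indicE sr mul1r /w !indicE.
  rewrite /D in_setI; have [zO|_] := boolP (z \in O'); last by rewrite !mul0r.
  rewrite mul1r/=; have [|] := boolP (z \in [set z | s < F z]).
    by rewrite inE/= => sF; rewrite mem_set//= mulr1.
  by rewrite notin_setE/= => sF; rewrite memNset//= mulr0.
have Dfin : leb D \is a fin_num by rewrite ge0_fin_numE//; exact: le_lt_trans Ds (ltry _).
have hb : (\int[leb]_(z in D) (g z)%:E <= (n%:R * K * (fine (leb D)) `^ p)%:E)%E.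
  apply: bathtub => //; first by move=> z [[_ zr] _].
  by move=> z [[Oz _] _]; exact: OM.
have hab : (fine (leb D)) `^ p <= (distr Omega f s) `^ p.
  apply: ge0_ler_powR; rewrite ?nnegrE ?invr_ge0//; [exact: fine_ge0|exact: fine_ge0|].
  by rewrite -lee_fin fineK.
apply: (le_trans hb); rewrite -[leRHS]EFinM lee_fin.
rewrite [n%:R * K]mulrC -[leLHS]mulrA.
by apply: ler_wpM2l; [exact: K0|apply: ler_wpM2l; [exact: ler0n|exact: hab]].
Qed.
End weight_lorentz.

(** * Integration along rays *)

Lemma continuous_sum (T : topologicalType) (R : realType) (I : Type) (r : seq I)
    (F : I -> T -> R) :
  (forall i, continuous (F i)) -> continuous (fun x => \sum_(i <- r) F i x).
Proof.
move=> cF; elim: r => [|i r IH] x.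
  by rewrite /continuous_at; under eq_fun do rewrite big_nil; rewrite big_nil; exact: cvg_cst.
rewrite /continuous_at; under eq_fun do rewrite big_cons.
by rewrite big_cons; apply: cvgD; [exact: cF|exact: IH].
Qed.

Section rays.
Context {R : realType}.

Lemma mean_value0 (F F' : R -> R) (a : R) :
  (forall t : R, is_derive t 1 F (F' t)) ->
  exists2 xi, `|xi| <= `|a| & F a - F 0 = a * F' xi.
Proof.
move=> dF.
have cF : continuous F.
  by move=> t; apply/differentiable_continuous/derivable1_diffP; case: (dF t).
have [a0|a0] := leP 0 a.
  have [c] := MVT_segment a0 (fun x _ => dF x) (continuous_subspaceT cF).
  rewrite in_itv/= => /andP[c0 ca] e; exists c; first by rewrite !ger0_norm.
  by rewrite e subr0 mulrC.
have [c] := MVT_segment (ltW a0) (fun x _ => dF x) (continuous_subspaceT cF).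
rewrite in_itv/= => /andP[c0 ca] e; exists c.
  by rewrite ler0_norm// ltr0_norm// lerN2.
by rewrite -opprB e sub0r mulrN opprK mulrC.
Qed.

Lemma is_derive_line (n : nat) (f : 'rV[R]_n -> R) (w v : 'rV[R]_n) (t : R) :
  derivable f (w + t *: v) v ->
  is_derive t 1 (fun t : R => f (w + t *: v)) ('D_v f (w + t *: v)).
Proof.
move=> df.
have e : (fun h : R => h^-1 *: (((fun t : R => f (w + t *: v)) \o shift t) (h *: 1) -
      f (w + t *: v))) =
    (fun h : R => h^-1 *: ((f \o shift (w + t *: v)) (h *: v) - f (w + t *: v))).
  apply/funext => h /=; congr (_ *: (f _ - _)).
  by rewrite (_ : h *: (1 : R) = h) ?scalerDl 1?addrCA//; exact: mulr1.
split; first by rewrite /derivable e.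
by rewrite /derive e.
Qed.

(* The chain rule for a C^1 function: change one coordinate at a time and use the
   mean value theorem. *)
Lemma is_derive_ray (n : nat) (f : 'rV[R]_n -> R) (z y : 'rV[R]_n) :
  (forall i, continuous (partial i f)) ->
  (forall i x, derivable f x (delta_mx ord0 i)) ->
  is_derive (0 : R) 1 (fun h : R => f (z + h *: y))
    (\sum_i y ord0 i * partial i f z).
Proof.
move=> cf df.
set S := \sum_i _.
suff H : (fun h : R => h^-1 *: (((fun h : R => f (z + h *: y)) \o shift 0) (h *: 1) -
    f (z + 0 *: y))) @ 0^' --> S.
  split; first by apply/cvg_ex; exists S.
  exact/cvg_lim.
apply/cvgrPdist_le => e e0.
pose N := \sum_i `|y ord0 i|.
have N0 : 0 <= N by apply: sumr_ge0.
pose e' := e / (N + 1).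
have e'0 : 0 < e' by rewrite divr_gt0// ltr_wpDl.
have nz : nbhs z [set w | forall i : 'I_n,
    `|partial i f z - partial i f w| < e'].
  apply: (@filter_forall _ 'I_n
    (fun i w => `|partial i f z - partial i f w| < e') (nbhs z) (nbhs_filter z)).
  by move=> i; exact: (@cvgr_dist_lt _ _ _ (nbhs z) _ _ _ (cf i z) _ e'0).
have [d /= d0 dP] := (nbhs_ballP z _).1 nz.
rewrite /dnbhs; near=> h.
have h0 : h != 0 by near: h; exact: nbhs_dnbhs_neq.
have hd : `|h| * (`|y| + 1) < d.
  rewrite -ltr_pdivlMr ?ltr_wpDl//; near: h.
  apply: dnbhs0_lt; rewrite divr_gt0// ltr_wpDl//.
(* [tr k] keeps the first k coordinates of h y, so z + tr k runs from z to z + h y along the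
   coordinate axes. *)
pose tr k : 'rV[R]_n := \row_i (if (i < k)%N then h * y ord0 i else 0).
have trS (k : 'I_n) : tr k.+1 = tr k + (h * y ord0 k) *: delta_mx ord0 k.
  apply/rowP => i; rewrite !mxE eqxx/= ltnS leq_eqVlt.
  have [->|ik] := eqVneq i k; first by rewrite eqxx ltnn/= add0r mulr1.
  by rewrite (negbTE (_ : val i != val k))//= mulr0 addr0.
have tele : f (z + h *: y) - f z =
    \sum_(k < n) (f (z + tr k.+1) - f (z + tr k)).
  rewrite -(big_mkord xpredT (fun k => f (z + tr k.+1) - f (z + tr k))).
  rewrite telescope_sumr//; congr (f _ - f _).
    by congr (_ + _); apply/rowP => i; rewrite !mxE ltn_ord.
  rewrite -[LHS]addr0; congr (_ + _); apply/rowP => i; by rewrite !mxE.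
(* The mean value point stays within |h| |y| of z in the sup norm, hence in the ball where each
   partial derivative differs from its value at z by less than e'. *)
have step (k : 'I_n) : `|h * y ord0 k * partial k f z -
    (f (z + tr k.+1) - f (z + tr k))| <= `|h| * `|y ord0 k| * e'.
  rewrite trS addrA.
  have [xi xil] := @mean_value0 (fun t => f (z + tr k + t *: delta_mx ord0 k))
    (fun t => partial k f (z + tr k + t *: delta_mx ord0 k)) (h * y ord0 k)
    (fun t => is_derive_line (df k _)).
  rewrite /= scale0r addr0 => ->.
  rewrite -mulrBr !normrM ler_wpM2l ?mulr_ge0//; apply/ltW/dP.
  rewrite -ball_normE /ball_/= -addrA opprD addrA subrr sub0r normrN.
  apply: le_lt_trans hd.
  rewrite [leLHS]/Num.norm/= mx_normrE; apply: bigmax_le; first by rewrite mulr_ge0// addr_ge0.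
  move=> [i j] _ /=; rewrite (ord1 i) !mxE eqxx/=.
  have hle l : `|h * y ord0 l| <= `|h| * (`|y| + 1).
    by rewrite normrM ler_wpM2l// (le_trans (coord_le_norm y l))// lerDl.
  have [->|jk] := eqVneq j k; first by rewrite ltnn add0r mulr1 (le_trans xil).
  rewrite mulr0 addr0; case: ifP => _; first exact: hle.
  by rewrite normr0 mulr_ge0// addr_ge0.
rewrite /= scale0r addr0 (_ : h *: (1 : R) = h) ?addr0 ?tele; last exact: mulr1.
rewrite (_ : S = h^-1 * \sum_(k < n) (h * y ord0 k * partial k f z)); last first.
  rewrite mulr_sumr; apply: eq_bigr => k _.
  by rewrite -mulrA mulKf.
rewrite -mulrBr -sumrB normrM normfV ler_pdivrMl ?normr_gt0//.
apply: le_trans (ler_norm_sum _ _ _) _.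
apply: (@le_trans _ _ (\sum_(k < n) `|h| * `|y ord0 k| * e')).
  by apply: ler_sum => k _; exact: step.
rewrite -mulr_suml -mulr_sumr -mulrA ler_wpM2l// -/N /e'.
by rewrite mulrA ler_pdivrMr ?ltr_wpDl// mulrC ler_wpM2l ?(ltW e0)// lerDl.
Unshelve. all: by end_near. Qed.

Lemma is_derive_ray_at (n : nat) (f : 'rV[R]_n -> R) (x y : 'rV[R]_n) (s : R) :
  (forall i, continuous (partial i f)) ->
  (forall i x, derivable f x (delta_mx ord0 i)) ->
  is_derive s 1 (fun s : R => f (x + s *: y))
    (\sum_i y ord0 i * partial i f (x + s *: y)).
Proof.
move=> cf df.
have [d v] := is_derive_ray (x + s *: y) y cf df.
have e : (fun h : R => h^-1 *: (((fun s : R => f (x + s *: y)) \o shift s) (h *: 1) -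
      f (x + s *: y))) =
  (fun h : R => h^-1 *: (((fun h : R => f (x + s *: y + h *: y)) \o shift 0) (h *: 1) -
    f (x + s *: y + 0 *: y))).
  apply/funext => h /=; rewrite scale0r !addr0; congr (_ *: (f _ - _)).
  by rewrite scalerDl -addrA [_ + s *: y]addrC.
split; first by rewrite /derivable e.
by rewrite /derive e.
Qed.

(** As f vanishes at the far end of the ray, f (x + y) is minus the integral of the derivative of s
    -> f (x + s y) over [1, T]; then apply Cauchy-Schwarz. The vector y is not normalised, so that
    the bound can be integrated against Lebesgue measure in y. *)
Lemma ray_integral_bound (n : nat) (f : 'rV[R]_n -> R) (x y : 'rV[R]_n) (T : R) :
  1 <= T ->
  (forall i, continuous (partial i f)) ->
  (forall i x, derivable f x (delta_mx ord0 i)) ->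
  f (x + T *: y) = 0 ->
  (`|f (x + y)|%:E <= \int[lebesgue_measure]_(s in `[1%R, T])
    (enorm y * enorm (grad f (x + s *: y)))%:E)%E.
Proof.
move=> T1 cf df fT.
pose g s := \sum_i y ord0 i * partial i f (x + s *: y).
have cg : continuous g.
  apply: continuous_sum => i s; apply: cvgM; first exact: cvg_cst.
  apply: (@continuous_comp _ _ _ (fun s : R => x + s *: y) (partial i f)).
    apply: cvgD; first exact: cvg_cst.
    by apply: cvgZr_tmp; exact: cvg_id.
  exact: cf.
have := integral_itv_is_derive T1 (continuous_subspaceT cg)
  (fun s _ => is_derive_ray_at x y s cf df).
rewrite fT scale1r sub0r => e.
rewrite -normrN -[leLHS]/(`|(- f (x + y))%:E|)%E -e.
have mg : measurable_fun `[1%R, T] (EFin \o g).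
  apply/measurable_EFinP; apply: measurable_funTS; exact: continuous_measurable_fun.
apply: le_trans (le_abse_integral _ _ _) _ => //.
apply: le_integral_ge0 => s _ //; rewrite lee_fin /g.
rewrite (_ : \sum_i _ = \sum_i y ord0 i * grad f (x + s *: y) ord0 i).
  exact: dot_le_enorm.
by apply: eq_bigr => i _; rewrite mxE.
Qed.
End rays.

Lemma is_derive_near0 (R : realType) (V : normedModType R) (f : V -> R) (z v : V)
    (U : set V) :
  open U -> U z -> (forall w, U w -> f w = 0) -> is_derive z v f 0.
Proof.
move=> oU Uz fU.
have cl : (fun h : R => h *: v + z) @ 0^' --> z.
  apply: cvg_within_filter.
  have : (fun h : R => h *: v + z) @ nbhs (0 : R) --> (0 *: v + z).
    by apply: cvgD; [apply: cvgZr_tmp; exact: cvg_id|exact: cvg_cst].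
  by rewrite scale0r add0r.
have H : (fun h : R => h^-1 *: ((f \o shift z) (h *: v) - f z)) @ 0^' --> (0 : R).
  apply: cvg_near_cst.
  have : nbhs z U by exact: open_nbhs_nbhs.
  move=> /cl; apply: (@filterS _ (0 : R)^') => h /= Uh.
  by rewrite (fU _ Uh) (fU _ Uz) subrr scaler0.
by split; [apply/cvg_ex; exists 0|exact/cvg_lim].
Qed.

Lemma is_derive_near_eq (R : realType) (V : normedModType R) (f g : V -> R)
    (z v : V) (df : R) (U : set V) :
  open U -> U z -> (forall w, U w -> f w = g w) -> is_derive z v g df ->
  is_derive z v f df.
Proof.
move=> oU Uz fg dg.
have d0 : is_derive z v (f \- g) 0.
  by apply: (is_derive_near0 v oU Uz) => w Uw /=; rewrite fg// subrr.
have := is_deriveD dg d0; rewrite addr0 (_ : g + (f \- g) = f)//.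
by apply/funext => w; rewrite [LHS]/= addrC subrK.
Qed.

(** * Test functions extended by zero *)

Section test_functions.
Context {R : realType} {n : nat}.
Implicit Types (Omega K : set 'rV[R]_n) (f phi : 'rV[R]_n -> R).

(** The complement of K is open, so vanishing there passes to all iterated partial derivatives: one
    compact set serves them all. *)
Lemma test_fun_support Omega phi : test_fun Omega phi ->
  exists K, [/\ compact K, K `<=` Omega &
    forall s x, ~ K x -> foldr partial phi s x = 0].
Proof.
move=> [_ [K [cK KO phi0]]]; exists K; split => //.
have oK : open (~` K).
  by apply: closed_openC; apply: compact_closed => //; exact: norm_hausdorff.
elim => [|i s IH] x Kx /=; first exact: phi0.
by have [_] := is_derive_near0 (delta_mx ord0 i) oK Kx IH.
Qed.

(** Smoothness is assumed on [Omega] only, but rays leave [Omega]: off the support every derivative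
    is locally zero, so the extension by zero is smooth everywhere. *)
Lemma test_fun_smooth Omega phi : test_fun Omega phi -> smooth setT phi.
Proof.
move=> tphi; have [K [cK KO phi0]] := test_fun_support tphi.
have oK : open (~` K).
  by apply: closed_openC; apply: compact_closed => //; exact: norm_hausdorff.
move=> s x _; have [Kx|Kx] := pselect (K x).
  by have [h _] := tphi; apply: h; exact: KO.
split; last by move=> i; have [] := is_derive_near0 (delta_mx ord0 i) oK Kx (phi0 s).
suff : foldr partial phi s @ x --> (0 : R) by rewrite -(phi0 s x Kx).
apply: (@cvg_near_cst _ _ _ _ (nbhs x) (nbhs_filter x)).
have nK : nbhs x (~` K) by exact: open_nbhs_nbhs.
apply: (@filterS _ (nbhs x) (nbhs_filter x) (~` K)) => // w Kw; exact: phi0.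
Qed.

Lemma smooth_continuous_partial phi : smooth setT phi ->
  forall i, continuous (partial i phi).
Proof. by move=> sphi i x; have [] := sphi [:: i] x I. Qed.

Lemma smooth_continuous phi : smooth setT phi -> continuous phi.
Proof. by move=> sphi x; have [] := sphi [::] x I. Qed.

Lemma smooth_derivable phi : smooth setT phi ->
  forall i x, derivable phi x (delta_mx ord0 i).
Proof. by move=> sphi i x; have [_] := sphi [::] x I. Qed.

Lemma continuous_enorm_grad phi : smooth setT phi ->
  continuous (fun x => enorm (grad phi x)).
Proof.
move=> sphi x.
have c : {for x, continuous (fun x => \sum_i partial i phi x ^+ 2)}.
  apply: continuous_sum => i y.
  have h := @smooth_continuous_partial phi sphi i y; exact: (cvgM h h).
have := @continuous_comp _ _ _ _ (@Num.sqrt R) x c (@sqrt_continuous R _).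
rewrite (_ : _ \o _ = (fun x => enorm (grad phi x)))//.
by apply/funext => y /=; rewrite /enorm; congr Num.sqrt; apply: eq_bigr => i _; rewrite mxE.
Qed.

Lemma continuous_compact_bounded f K : compact K -> continuous f ->
  (forall x, ~ K x -> f x = 0) -> exists2 C, 0 <= C & forall x, `|f x| <= C.
Proof.
move=> cK cf f0.
have [K0|/set0P K0] := eqVneq K set0.
  by exists 0 => // x; rewrite f0 ?normr0// K0.
have ca : {within K, continuous (fun x => `|f x|)}.
  by apply: continuous_subspaceT => x; exact: (@cvg_norm _ R^o _ _ _ _ _ (cf x)).
have [c _ cm] := compact_EVT_max K0 cK ca.
exists `|f c| => // x; have [Kx|/f0 ->] := pselect (K x); last by rewrite normr0.
by apply: cm; rewrite inE.
Qed.
End test_functions.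

Section shell_integral.
Context {R : realType} {m : nat}.
Notation n := m.+1.
Notation leb := (lebesgue_rV n).
Notation mu := (@lebesgue_measure R).

Lemma measurable_scaled_translate (a b : 'rV[R]_n) (c : measurableTypeR R -> R) :
  measurable_fun setT c ->
  measurable_fun setT
    (fun q : 'rV[R]_n * measurableTypeR R => a + c q.2 *: (q.1 - b)).
Proof.
move=> mc; apply: measurable_fun_rV => i.
rewrite (_ : (fun _ => _) = (fun q : 'rV[R]_n * measurableTypeR R =>
    a ord0 i + c q.2 * (q.1 ord0 i - b ord0 i))); last first.
  by apply/funext => q; rewrite !mxE.
apply: measurable_funD; first exact: measurable_cst.
apply: measurable_funM.
  by apply: (@measurableT_comp _ _ _ _ _ _ c _ snd).
apply: measurable_funB; last exact: measurable_cst.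
apply: (@measurableT_comp _ _ _ _ _ _ (fun z : 'rV[R]_n => z ord0 i) _ fst) => //.
exact: measurable_coord.
Qed.

(* Integrate ray_integral_bound over the shell r1 <= |y| < r', and substitute
   z = x + s y.  For fixed z the integral of s^(-n-1) over the s for which y lies in
   the shell is (r'^n - r1^n) / (n |z - x|^n). *)
Lemma shell_integral_bound (phi : 'rV[R]_n -> R) (x : 'rV[R]_n) (r1 r' T : R) :
  smooth setT phi -> 0 < r1 -> r1 <= r' -> 1 <= T ->
  (forall y, r1 <= enorm y -> phi (x + T *: y) = 0) ->
  (\int[leb]_(z in eball x r' `\` eball x r1) `|phi z|%:E <=
    ((r' ^+ n - r1 ^+ n) / n%:R)%:E *
    \int[leb]_(z in ~` eball x r1)
      (enorm (grad phi z) * ((enorm (z - x))^-1) ^+ m)%:E)%E.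
Proof.
move=> sphi r10 r1r' T1 phiT.
pose N z := enorm (grad phi z).
have N0 z : 0 <= N z by exact: enorm_ge0.
have mN : measurable_fun setT N.
  by apply: measurable_continuous_rV; exact: continuous_enorm_grad.
pose A0 : set 'rV[R]_n := eball 0 r' `\` eball 0 r1.
have mA0 : measurable A0 by apply: measurableD; exact: measurable_eball.
have A0P y : A0 y <-> r1 <= enorm y < r'.
  rewrite /A0/= /eball/= subr0; split; first by move=> [-> /negP]; rewrite -leNgt => ->.
  by move=> /andP[yr1 ->]; split => //; apply/negP; rewrite -leNgt.
have mI : measurable_fun setT (\1_(`[1, T]%classic) : measurableTypeR R -> R).
  by apply: measurable_indic; exact: measurable_itv.
have mIA : measurable_fun setT (\1_A0 : 'rV[R]_n -> R) by exact: measurable_indic.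
(* The integrand before the substitution. The term q.1 - 0 gives the argument of [N] the form
   handled by [measurable_scaled_translate]. *)
pose H (q : 'rV[R]_n * measurableTypeR R) : R :=
  \1_(`[1, T]%classic) q.2 * (\1_A0 q.1 * enorm q.1 * N (x + (q.2 : R) *: (q.1 - 0))).
have H0 q : 0 <= H q by rewrite /H !indicE !mulr_ge0// enorm_ge0.
have mH : measurable_fun setT (EFin \o H).
  apply/measurable_EFinP; apply: measurable_funM.
    by apply: (@measurableT_comp _ _ _ _ _ _ (\1_(`[1, T]%classic) : measurableTypeR R -> R) _ snd).
  apply: measurable_funM.
    apply: measurable_funM.
      by apply: (@measurableT_comp _ _ _ _ _ _ (\1_A0 : 'rV[R]_n -> R) _ fst).
    apply: (@measurableT_comp _ _ _ _ _ _ (@enorm R n) _ fst) => //.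
    exact: measurable_enorm.
  exact: (@measurableT_comp _ _ _ _ _ _ N _ _ mN
    (@measurable_scaled_translate x 0 id (@measurable_id _ _ setT))).
pose q_ (s : R) z : R := \1_A0 (0 + s^-1 *: (z - x)) * enorm (0 + s^-1 *: (z - x)) * N z.
have q0 s z : 0 <= q_ s z by rewrite /q_ !indicE !mulr_ge0// enorm_ge0.
(* The integrand after z = x + s y at fixed s, with Jacobian s^(-n); y has become (z - x) / s. *)
pose H2 (q : 'rV[R]_n * measurableTypeR R) : R :=
  \1_(`[1, T]%classic) q.2 * ((q.2 : R)^-1) ^+ n * q_ q.2 q.1.
have H20 z s : 0 <= H2 (z, s).
  rewrite /H2/= !indicE; have [|_] := boolP (s \in _); last by rewrite !mul0r.
  rewrite inE/= in_itv/= => /andP[s1 _]; rewrite mul1r mulr_ge0// exprn_ge0//.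
  by rewrite invr_ge0 (le_trans _ s1).
have mH2 : measurable_fun setT (EFin \o H2).
  have mst : measurable_fun setT (fun q : 'rV[R]_n * measurableTypeR R =>
      0 + (q.2 : R)^-1 *: (q.1 - x)).
    exact: (@measurable_scaled_translate 0 x (@GRing.inv R) (@measurable_inv R)).
  apply/measurable_EFinP; apply: measurable_funM.
    apply: measurable_funM.
      by apply: (@measurableT_comp _ _ _ _ _ _ (\1_(`[1, T]%classic) : measurableTypeR R -> R) _ snd).
    apply: measurable_funX.
    by apply: (@measurableT_comp _ _ _ _ _ _ (@GRing.inv R : measurableTypeR R -> R)
      _ snd) => //; exact: measurable_inv.
  apply: measurable_funM; last by apply: (@measurableT_comp _ _ _ _ _ _ N _ fst).
  apply: measurable_funM.
    exact: (@measurableT_comp _ _ _ _ _ _ (\1_A0 : 'rV[R]_n -> R) _ _ mIA mst).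
  exact: (@measurableT_comp _ _ _ _ _ _ (@enorm R n) _ _ measurable_enorm mst).
have mphi : measurable_fun setT phi.
  by apply: measurable_continuous_rV; exact: smooth_continuous.
apply: (@le_trans _ _ (\int[leb]_y \int[mu]_s (H (y, s))%:E)%E).
  have mA : measurable (eball x r' `\` eball x r1).
    by apply: measurableD; exact: measurable_eball.
  rewrite integral_mkcond.
  have mf : measurable_fun setT
      ((fun z => `|phi z|%:E : \bar R) \_ (eball x r' `\` eball x r1)).
    apply/(measurable_restrictT _ mA).
    by apply/measurable_EFinP; apply: measurable_funTS; exact: measurableT_comp.
  rewrite (integral_affine_rV x ltr01 mf); last first.
    by move=> z; apply: erestrict_ge0 => t _; rewrite lee_fin.
  rewrite expr1n mul1e; apply: le_integral_ge0 => y _.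
    by apply: erestrict_ge0 => t _; rewrite lee_fin.
  rewrite scale1r patchE; case: ifPn => [|_]; last first.
    by apply: integral_ge0 => s _; rewrite lee_fin.
  rewrite inE => -[]; rewrite /eball/= [x + y]addrC addrK => yr' /negP yr1.
  rewrite -leNgt in yr1; rewrite [y + x]addrC.
  have Ay : A0 y by apply/A0P; rewrite yr1.
  apply: (le_trans (ray_integral_bound T1 (smooth_continuous_partial sphi)
    (smooth_derivable sphi) (phiT _ yr1))).
  rewrite integral_mkcond; apply: le_integral_ge0 => s _.
    by apply: erestrict_ge0 => t _; rewrite lee_fin mulr_ge0 ?enorm_ge0.
  rewrite patchE /H/= indicE; case: ifPn => _; last by rewrite mul0r.
  by rewrite indicE mem_set// !mul1r subr0.
rewrite (fubini_tonelli (EFin \o H))//=.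
apply: (@le_trans _ _ (\int[mu]_s \int[leb]_z (H2 (z, s))%:E)%E).
  apply: le_integral_ge0 => s _; first by apply: integral_ge0 => y _; rewrite lee_fin.
  have [sT|sT] := boolP (s \in `[1, T]%classic); last first.
    rewrite integral0_eq; last by move=> y _; rewrite /H/= indicE (negbTE sT) mul0r.
    by apply: integral_ge0 => y _; rewrite lee_fin.
  have := sT; rewrite inE/= in_itv/= => /andP[s1 _].
  have s0 : 0 < s by exact: lt_le_trans s1.
  have mq : measurable_fun setT (fun z => (q_ s z)%:E).
    have mst : measurable_fun setT (fun z : 'rV[R]_n => 0 + s^-1 *: (z - x)).
      rewrite (_ : (fun _ => _) = (fun z : 'rV[R]_n => - (s^-1 *: x) + s^-1 *: z)).
        exact: measurable_affine_rV.
      by apply/funext => z; rewrite add0r scalerBr addrC.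
    apply/measurable_EFinP; apply: measurable_funM => //.
    apply: measurable_funM.
      exact: (@measurableT_comp _ _ _ _ _ _ (\1_A0 : 'rV[R]_n -> R) _ _ mIA mst).
    exact: (@measurableT_comp _ _ _ _ _ _ (@enorm R n) _ _ measurable_enorm mst).
  have e1 y : (H (y, s))%:E = (q_ s (x + s *: y))%:E.
    rewrite /H/= indicE sT mul1r subr0 /q_ add0r addrAC subrr add0r scalerA mulVf ?gt_eqF//.
    by rewrite scale1r.
  under eq_integral do rewrite e1.
  have e2 z : (H2 (z, s))%:E = (((s^-1) ^+ n)%:E * (q_ s z)%:E)%E.
    by rewrite /H2/= indicE sT mul1r EFinM.
  under [leRHS]eq_integral do rewrite e2.
  rewrite ge0_integralZl_EFin//; last 2 first.
  - by move=> z _; rewrite lee_fin; exact: q0.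
  - by rewrite exprn_ge0// invr_ge0 ltW.
  rewrite (integral_affine_rV x s0 mq); last by move=> z; rewrite lee_fin.
  by rewrite muleA -EFinM -exprMn mulVf ?gt_eqF// expr1n mul1e.
rewrite -(fubini_tonelli (EFin \o H2))//=; last by move=> [].
have mg : measurable_fun setT (fun z : 'rV[R]_n =>
    (N z * ((enorm (z - x))^-1) ^+ m)%:E).
  apply/measurable_EFinP; apply: measurable_funM => //.
  apply: measurable_funX; apply: (measurableT_comp (@measurable_inv R)).
  by apply: measurable_continuous_rV; exact: continuous_enormB.
have c0 : 0 <= (r' ^+ n - r1 ^+ n) / n%:R.
  by rewrite divr_ge0// subr_ge0 lerXn2r ?nnegrE ?(ltW r10) ?(le_trans (ltW r10)).
rewrite -ge0_integralZl_EFin//; last 3 first.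
- by apply: measurableC; exact: measurable_eball.
- by move=> z _; rewrite lee_fin mulr_ge0 ?exprn_ge0 ?invr_ge0 ?enorm_ge0.
- exact: measurable_funTS.
rewrite [leRHS]integral_mkcond; apply: le_integral_ge0 => z _.
  by apply: integral_ge0 => s _; rewrite lee_fin.
set rho := enorm (z - x).
(* For fixed z, membership of (z - x) / s in the shell confines s to [rho / r', rho / r1]. The last
   inequality excludes z with rho < r1, because s >= 1. *)
have As s : 0 < s -> A0 (0 + s^-1 *: (z - x)) -> rho / r' <= s <= rho / r1 /\ r1 * s <= rho.
  move=> s0 /A0P; rewrite add0r enormZ gtr0_norm ?invr_gt0// -/rho => /andP[a b].
  have h : r1 * s <= rho by rewrite -ler_pdivlMr// mulrC.
  split => //; rewrite ler_pdivrMr ?(lt_le_trans r10)// ler_pdivlMr// [s * r1]mulrC h andbT.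
  by apply: ltW; rewrite -ltr_pdivrMl.
rewrite patchE; case: ifPn => [|]; last first.
  rewrite notin_setE /eball/= => /contrapT rhor1.
  rewrite integral0_eq// => s _; rewrite /H2/= indicE.
  have [|_] := boolP (s \in _); last by rewrite !mul0r.
  rewrite inE/= in_itv/= => /andP[s1 _].
  have s0 : 0 < s by exact: lt_le_trans s1.
  rewrite /q_ indicE (_ : (_ \in A0) = false) ?mul0r ?mulr0//.
  apply/negP; rewrite inE => /(As _ s0)[_ h].
  have h' : r1 <= r1 * s by rewrite ler_peMr// ltW.
  by have := lt_le_trans rhor1 (le_trans h' h); rewrite ltxx.
rewrite inE /eball/= => /negP; rewrite -leNgt -/rho => rhor1.
have rho0 := lt_le_trans r10 rhor1; have r'0 := lt_le_trans r10 r1r'.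
have n0 : 1 + m%:R != 0 :> R by rewrite addrC natr1 pnatr_eq0.
(* The Jacobian s^(-n) times |y| = rho / s equals rho s^(-n-1), and [J] evaluates to (r'^n - r1^n) /
   rho^n. One factor rho remains, turning rho^(-n) into the weight rho^(-m). *)
pose J : \bar R := (\int[mu]_(s in `[(rho / r')%R, (rho / r1)%R])
    (n%:R * (s^-1) ^+ n.+1)%:E)%E.
apply: (@le_trans _ _ ((N z * rho / n%:R)%:E * J)%E); rewrite /J; last first.
  rewrite integral_invX ?divr_gt0 ?ler_pM2l ?lef_pV2//.
  rewrite -!EFinM lee_fin !invf_div !expr_div_n le_eqVlt; apply/orP; left; apply/eqP.
  rewrite exprVn [rho ^+ n]exprS -/(N z).
  move: (rho ^+ m) (expf_neq0 m (lt0r_neq0 rho0)) (r' ^+ n) (r1 ^+ n) => u u0 v w.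
  field.
  by rewrite u0 n0 gt_eqF.
rewrite -ge0_integralZl_EFin//; last 3 first.
- move=> s /=; rewrite in_itv/= => /andP[s0 _]; rewrite lee_fin mulr_ge0// exprn_ge0// invr_ge0.
  by apply: le_trans s0; rewrite divr_ge0// ltW.
- apply: measurable_funTS; apply/measurable_EFinP; apply: measurable_funM => //.
  by apply: measurable_funX; exact: measurable_inv.
- by rewrite !mulr_ge0 ?(ltW rho0).
have wpos t : rho / r' <= t ->
    (0 <= (N z * rho / n%:R)%:E * (n%:R * (t^-1) ^+ n.+1)%:E)%E.
  move=> t0; rewrite -EFinM lee_fin; apply: mulr_ge0.
    by rewrite divr_ge0// mulr_ge0// ltW.
  apply: mulr_ge0 => //; apply: exprn_ge0; rewrite invr_ge0.
  by apply: le_trans t0; rewrite divr_ge0// ltW.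
rewrite [leRHS]integral_mkcond; apply: le_integral_ge0 => s _; first by rewrite lee_fin.
rewrite /H2/= indicE; have [|_] := boolP (s \in `[1, T]%classic); last first.
  rewrite !mul0r; apply: erestrict_ge0 => t /=; rewrite in_itv/= => /andP[t0 _].
  exact: wpos.
rewrite inE/= in_itv/= => /andP[s1 _]; have s0 : 0 < s by exact: lt_le_trans s1.
rewrite mul1r /q_ indicE; have [|_] := boolP (_ \in A0); last first.
  rewrite !mul0r mulr0; apply: erestrict_ge0 => t /=; rewrite in_itv/= => /andP[t0 _].
  exact: wpos.
rewrite inE => /(As _ s0)[sI _]; rewrite patchE mem_set; last by rewrite /= in_itv/=.
rewrite -EFinM lee_fin mul1r add0r enormZ gtr0_norm ?invr_gt0// -/rho.
rewrite le_eqVlt; apply/orP; left; apply/eqP.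
rewrite [in RHS]exprSr; field.
by rewrite n0 gt_eqF.
Qed.
End shell_integral.

(** * The lower bound *)

Section lorentz_comparison.
Context {R : realType} {n : nat}.
Implicit Types (Omega : set 'rV[R]_n) (f : 'rV[R]_n -> R).

Lemma rearrangement_ge0 Omega f t : (0 <= rearrangement Omega f t)%E.
Proof. by apply: le_ereal_inf_tmp => _ [v [v0 _] <-]; rewrite lee_fin. Qed.

Lemma rearrangement_nonincreasing Omega f s t : s <= t ->
  (rearrangement Omega f t <= rearrangement Omega f s)%E.
Proof.
move=> st; apply: ereal_inf_le_tmp => _ [v [v0 vs] <-]; exists v => //; split => //.
by apply: le_trans vs _; rewrite lee_fin.
Qed.

Lemma rearrangement_le_avg Omega f t : 0 < t ->
  (rearrangement Omega f t <= rearrangement_avg Omega f t)%E.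
Proof.
move=> t0; rewrite /rearrangement_avg.
apply: (@le_trans _ _ ((t^-1)%:E * \int[lebesgue_measure]_(s in `[0%R, t])
    rearrangement Omega f t)%E).
  rewrite integral_cst// [X in (_ * (_ * X))%E](_ : _ = t%:E).
    rewrite [(rearrangement _ _ _ * _)%E]muleC muleA -EFinM mulVf ?mul1e//.
    by rewrite gt_eqF.
  rewrite (_ : _ `[0%R, t]%classic = lebesgue_measure `[0%R, t]%classic)//.
  by rewrite lebesgue_measure_itv/= lte_fin t0 -EFinB subr0.
apply: lee_wpmul2l; first by rewrite lee_fin invr_ge0 ltW.
apply: le_integral_ge0 => s; first by move=> _; exact: rearrangement_ge0.
by rewrite /= in_itv/= => /andP[_ st]; exact: rearrangement_nonincreasing.
Qed.

(** Closeness in [H10] is measured with f^**, the capacity with f^*; this transfers small errors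
    from the former to the latter. *)
Lemma lorentz_le_avg Omega f : (lorentz Omega f <= lorentz_avg Omega f)%E.
Proof.
apply: le_integral_ge0 => t; rewrite /= in_itv/= andbT => t0.
  by rewrite mule_ge0 ?rearrangement_ge0// lee_fin divr_ge0 ?powR_ge0// ltW.
apply: lee_wpmul2l; first by rewrite lee_fin divr_ge0 ?powR_ge0// ltW.
exact: rearrangement_le_avg.
Qed.

Lemma lorentz_ge0 Omega f : (0 <= lorentz Omega f)%E.
Proof.
apply: integral_ge0 => t; rewrite /= in_itv/= andbT => t0.
by rewrite mule_ge0 ?rearrangement_ge0// lee_fin divr_ge0 ?powR_ge0// ltW.
Qed.
End lorentz_comparison.

Section lower_bound.
Context {R : realType} {m : nat}.
Notation n := m.+1.
Notation leb := (lebesgue_rV n).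
Let p : R := n%:R^-1.
Let Om : R := fine (leb (eball (0 : 'rV[R]_n) 1)).

(** On the shell 1 <= |phi| + |u - phi| almost everywhere. The first term goes through the ray
    estimate; the second is compared with the weight, which is at least r'^(-m) there. The triangle
    inequality for |grad phi| is applied inside the weighted integral, which is additive, and not to
    the Lorentz quasinorm; each piece is then bounded by its own quasinorm. *)
Lemma sobolev_lower_eps (Omega : set 'rV[R]_n) (x : 'rV[R]_n) (r1 r' M e : R)
    (u : 'rV[R]_n -> R) (v : 'rV[R]_n -> 'rV[R]_n) :
  open Omega -> Omega `<=` eball x M -> 0 < r1 -> r1 < r' -> r' <= M ->
  eball x r' `<=` Omega -> H10 Omega u v -> 0 < e ->
  {ae leb, forall y, eball x r' y -> 1 <= u y} ->
  ((Om * (r' ^+ n - r1 ^+ n))%:E <=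
    ((r' ^+ n - r1 ^+ n) / n%:R)%:E *
      ((((Om * (1 - (r1 / M) ^+ n)) ^+ m) `^ p)%:E *
        (lorentz Omega (enorm \o v) + e%:E)) +
    (r' ^+ m * ((Om * (1 - (r1 / M) ^+ n)) ^+ m) `^ p)%:E * e%:E)%E.
Proof.
move=> oO OM r10 r1r' r'M r'O [[[[mu_ _] mv _] _] app] e0 u1.
set K := (_ `^ p)%R; pose c := r' ^+ n - r1 ^+ n; rewrite -/c.
have mv_ i := (mv i).1.
have mO : measurable Omega by exact: measurable_open_rV.
have r'0 := lt_trans r10 r1r'; have r1M := le_trans (ltW r1r') r'M.
have M0 := lt_le_trans r10 r1M.
have K0 : 0 <= K by exact: powR_ge0.
have c0 : 0 <= c by rewrite subr_ge0 lerXn2r ?nnegrE// ltW.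
have [phi [tphi small]] := app e e0.
have sphi := test_fun_smooth tphi.
have [S [_ SO phi0]] := test_fun_support tphi.
have small1 : (lorentz Omega (u \- phi)%R <= e%:E)%E.
  apply: le_trans (ltW small); apply: le_trans (lorentz_le_avg _ _) _.
  by apply: leeDl; apply: le_trans (lorentz_le_avg _ _); exact: lorentz_ge0.
have small2 : (lorentz Omega (enorm \o (v \- grad phi)%R) <= e%:E)%E.
  apply: le_trans (ltW small); apply: le_trans (lorentz_le_avg _ _) _.
  by apply: leeDr; apply: le_trans (lorentz_le_avg _ _); exact: lorentz_ge0.
have mphi : measurable_fun setT phi.
  by apply: measurable_continuous_rV; exact: smooth_continuous.
have mgphi i : measurable_fun setT (fun z => grad phi z ord0 i).
  rewrite (_ : (fun _ => _) = partial i phi); last by apply/funext => z; rewrite mxE.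
  by apply: measurable_continuous_rV; exact: smooth_continuous_partial.
have muphi : measurable_fun Omega (u \- phi).
  by apply: measurable_funB => //; exact: measurable_funTS.
have mvphi : measurable_fun Omega (enorm \o (v \- grad phi)%R).
  apply: measurable_enorm_comp => // i.
  rewrite (_ : (fun _ => _) = (fun z => v z ord0 i) \- (fun z => grad phi z ord0 i)).
    by apply: measurable_funB => //; exact: measurable_funTS.
  by apply/funext => z; rewrite /= [LHS]mxE [X in _ + X = _]mxE.
have mnv : measurable_fun Omega (enorm \o v) by exact: measurable_enorm_comp.
pose A := eball x r' `\` eball x r1.
have mA : measurable A by apply: measurableD; exact: measurable_eball.
have AO : A `<=` Omega by move=> z [/r'O].
pose g (z : 'rV[R]_n) : R := ((enorm (z - x))^-1) ^+ m.
have g0 z : 0 <= g z by rewrite exprn_ge0// invr_ge0 enorm_ge0.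
have mg : measurable_fun setT g.
  apply: measurable_funX; apply: (measurableT_comp (@measurable_inv R)).
  by apply: measurable_continuous_rV; exact: continuous_enormB.
rewrite -(lebesgue_shell x (ltW r10) (ltW r1r')) -/A.
have mOr : measurable (Omega `\` eball x r1).
  by apply: measurableD => //; exact: measurable_eball.
have bnd (f : 'rV[R]_n -> R) := @integral_weight_le_lorentz R m Omega f x r1 M mO OM r10 r1M.
apply: (@le_trans _ _ (\int[leb]_(z in A) (`|phi z|%:E + `|(u \- phi) z|%:E))%E).
  have -> : leb A = (\int[leb]_(z in A) (cst 1%E) z)%E by rewrite integral_cst// mul1e.
  have m2 : measurable_fun A (fun z => (`|phi z|%:E + `|(u \- phi) z|%:E)%E).
    apply: emeasurable_funD; apply/measurable_EFinP.
      by apply: measurable_funTS; exact: measurableT_comp.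
    by apply: measurableT_comp => //; exact: measurable_funS muphi.
  apply: ae_ge0_le_integral => //.
    by move=> z _; rewrite -EFinD lee_fin addr_ge0.
  move: u1; apply: filterS => z uz Az; rewrite -EFinD lee_fin.
  have := uz (Az.1); have := ler_norm (phi z); have := ler_norm ((u \- phi) z).
  by rewrite /=; lra.
rewrite ge0_integralD//; last 2 first.
- by apply/measurable_EFinP; apply: measurable_funTS; exact: measurableT_comp.
- by apply/measurable_EFinP; apply: measurableT_comp => //; exact: measurable_funS muphi.
apply: leeD.
  (* At parameter M / r1 or beyond, a ray with |y| >= r1 is at distance at least M from x, hence
     outside [Omega], where phi vanishes. *)
  have T1 : 1 <= Num.max 1 (M / r1) by rewrite le_max lexx.
  have phiT y : r1 <= enorm y -> phi (x + Num.max 1 (M / r1) *: y) = 0.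
    move=> yr1; apply: (phi0 [::]) => /SO/OM; rewrite /eball/= [x + _]addrC addrK enormZ.
    rewrite ger0_norm ?le_max ?ler01//; apply/negP; rewrite -leNgt.
    apply: (@le_trans _ _ (M / r1 * r1)); first by rewrite divfK// gt_eqF.
    by rewrite ler_pM// ?le_max ?lexx ?orbT// ?ltW// divr_gt0.
  apply: le_trans (shell_integral_bound sphi r10 (ltW r1r') T1 phiT) _.
  apply: lee_wpmul2l; first by rewrite lee_fin divr_ge0.
  apply: (@le_trans _ _ (\int[leb]_(z in Omega `\` eball x r1)
     ((`|(enorm \o v) z| * g z)%:E + (`|(enorm \o (v \- grad phi)%R) z| * g z)%:E))%E).
    rewrite integral_mkcond [leRHS]integral_mkcond; apply: le_integral_ge0 => z _.
      by apply: erestrict_ge0 => t _; rewrite lee_fin; apply: mulr_ge0; [exact: enorm_ge0|exact: g0].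
    set F := (X in (_ <= (X \_ _) z)%E).
    have rhs0 : (0 <= (F \_ (Omega `\` eball x r1)) z)%E.
      apply: erestrict_ge0 => t _; rewrite /F -EFinD lee_fin.
      by rewrite addr_ge0// mulr_ge0//; exact: g0.
    rewrite [leLHS]patchE; case: ifPn => [zr|_]; last exact: rhs0.
    have [zO|zO] := pselect (Omega z); last first.
      rewrite (_ : grad phi z = 0) ?enorm0 ?mul0r//.
      apply/rowP => i; rewrite !mxE.
      by apply: (phi0 [:: i]) => /SO.
    rewrite patchE mem_set; last by split => //; rewrite inE in zr.
    rewrite /F.
    rewrite -EFinD lee_fin -mulrDl; apply: ler_wpM2r; first exact: g0.
    rewrite !ger0_norm ?enorm_ge0//=.
    have := enormD (v z) (grad phi z - v z); rewrite [v z + _]addrC subrK.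
    by rewrite [enorm (grad phi z - v z)]enormB.
  rewrite ge0_integralD//; last 4 first.
  - by move=> z _; rewrite lee_fin mulr_ge0.
  - apply/measurable_EFinP; apply: measurable_funM; last exact: measurable_funTS.
    by apply: measurableT_comp => //; apply: measurable_funS mnv => //; exact: subDsetl.
  - by move=> z _; rewrite lee_fin mulr_ge0.
  - apply/measurable_EFinP; apply: measurable_funM; last exact: measurable_funTS.
    by apply: measurableT_comp => //; apply: measurable_funS mvphi => //; exact: subDsetl.
  rewrite ge0_muleDr ?lorentz_ge0 ?lee_fin ?(ltW e0)//; apply: leeD; first exact: bnd.
  apply: (le_trans (bnd _ mvphi)).
  apply: lee_wpmul2l; [rewrite lee_fin; exact: K0|exact: small2].
rewrite EFinM -muleA.
(* On the shell |z - x| < r', so 1 <= r'^m |z - x|^(-m). *)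
apply: (@le_trans _ _ ((r' ^+ m)%:E * \int[leb]_(z in Omega `\` eball x r1)
   (`|(u \- phi)%R z| * g z)%:E)%E); last first.
  apply: lee_wpmul2l; first by rewrite lee_fin exprn_ge0// ltW.
  apply: (le_trans (bnd _ muphi)).
  apply: lee_wpmul2l; [rewrite lee_fin; exact: K0|exact: small1].
rewrite -ge0_integralZl_EFin//; last 3 first.
- by move=> z _; rewrite lee_fin mulr_ge0.
- apply/measurable_EFinP; apply: measurable_funM; last exact: measurable_funTS.
  by apply: measurableT_comp => //; apply: measurable_funS muphi => //; exact: subDsetl.
- by rewrite exprn_ge0// ltW.
rewrite integral_mkcond [leRHS]integral_mkcond; apply: le_integral_ge0 => z _.
  by apply: erestrict_ge0 => t _; rewrite lee_fin.
rewrite [leLHS]patchE; case: ifPn => zA; last first.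
  apply: erestrict_ge0 => t _; rewrite -EFinM lee_fin; apply: mulr_ge0.
    by rewrite exprn_ge0// ltW.
  by apply: mulr_ge0 => //; exact: g0.
have [zr' zr1] := set_mem zA.
rewrite patchE mem_set; last by split => //; exact: AO (set_mem zA).
rewrite -EFinM lee_fin mulrCA ler_peMr//.
move/negP: zr1; rewrite -leNgt => zr1; have z0 := lt_le_trans r10 zr1.
rewrite /g exprVn -lef_pV2 ?posrE; last 2 first.
- by rewrite divr_gt0 ?exprn_gt0.
- exact: ltr01.
rewrite invf_div invr1 ler_pdivrMr ?exprn_gt0// mul1r.
by apply: lerXn2r; rewrite ?nnegrE ?(ltW z0) ?(ltW r'0)//; exact: ltW.
Qed.
End lower_bound.

Section capacity_lower.
Context {R : realType} {m : nat}.
Notation n := m.+1.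
Notation leb := (lebesgue_rV n).
Let p : R := n%:R^-1.
Let Om : R := fine (leb (eball (0 : 'rV[R]_n) 1)).

(** Letting e tend to 0 in [sobolev_lower_eps] and cancelling r'^n - r1^n leaves n Om <= K N, with N
    the norm of the gradient; the n-th power of this is the claim with r1 in place of r. That is the
    stronger bound, since 1 - (r1/M)^n <= 1 - (r/M)^n. *)
Lemma capacity_ge (Omega : set 'rV[R]_n) (x : 'rV[R]_n) (r M : R) :
  open Omega -> Omega `<=` eball x M -> 0 <= r -> r < M ->
  ((n%:R ^+ n * Om / (1 - (r / M) ^+ n) ^+ m)%:E <=
    capacity (closed_eball x r) Omega)%E.
Proof.
move=> oO OM r0 rM; have M0 := le_lt_trans r0 rM.
apply: le_ereal_inf_tmp => _ [u [v [Huv [U [oU rU UO u1]] ->]]].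
have [r2 rr2 r2U] := closed_eball_sub_open oU rU.
(* r1 is positive even when r = 0, as the weight estimates require, and the shell between r1 and r'
   has r1 < r'. *)
pose r' := Num.min r2 M; pose r1 := (r + r') / 2.
have rr' : r < r' by rewrite lt_min rr2.
have r'M : r' <= M by rewrite ge_min lexx orbT.
have r1r' : r1 < r' by rewrite /r1; lra.
have rr1 : r < r1 by rewrite /r1; lra.
have r10 := le_lt_trans r0 rr1.
have r'U : eball x r' `<=` U.
  by move=> y yr'; apply: r2U; apply: lt_le_trans yr' _; rewrite ge_min lexx.
have u1' : {ae leb, forall y, eball x r' y -> 1 <= u y}.
  by move: u1; apply: filterS => y uy /r'U.
have H e e0 := @sobolev_lower_eps R m Omega x r1 r' M e u v oO OM r10 r1r' r'M
  (fun y yr => UO y (r'U y yr)) Huv e0 u1'.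
have N0 := lorentz_ge0 Omega (enorm \o v).
case: (lorentz Omega _) N0 H => [N| |//] N0 H; last by rewrite expeS gt0_mulye ?expe_gt0// leey.
rewrite lee_fin in N0.
set K := ((Om * (1 - (r1 / M) ^+ n)) ^+ m) `^ p in H.
pose c := r' ^+ n - r1 ^+ n.
have Om0 : 0 <= Om by exact: fine_ge0.
have c0 : 0 < c by rewrite subr_gt0 ltrXn2r ?nnegrE// ltW// (lt_trans r10).
have K0 : 0 <= K by exact: powR_ge0.
have r'0 := lt_trans r10 r1r'.
have key : Om * c <= c / n%:R * (K * N).
  apply/ler_addgt0Pr => d d0.
  pose C := c / n%:R * K + r' ^+ m * K.
  have C0 : 0 <= C.
    by rewrite addr_ge0// mulr_ge0// ?divr_ge0 ?exprn_ge0// ltW.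
  (* C is the total coefficient of e in the two error terms; the added 1 keeps the denominator
     positive. *)
  have e0 : 0 < d / (C + 1) by rewrite divr_gt0// ltr_wpDl.
  have h : ((Om * c)%:E <= (c / n%:R * (K * (N + d / (C + 1))) +
      r' ^+ m * K * (d / (C + 1)))%:E)%E by exact: H.
  rewrite lee_fin in h.
  apply: (le_trans h); rewrite (_ : _ + _ = c / n%:R * (K * N) + C * (d / (C + 1))).
    rewrite lerD2l mulrA ler_pdivrMr ?ltr_wpDl// mulrC ler_wpM2l ?(ltW d0)//.
    by rewrite lerDl.
  by rewrite /C; ring.
have key2 : n%:R * Om <= K * N.
  have n0 : n%:R != 0 :> R by rewrite pnatr_eq0.
  rewrite -(ler_pM2l c0).
  have -> : c * (n%:R * Om) = n%:R * (Om * c) by rewrite mulrCA [c * Om]mulrC.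
  have -> : c * (K * N) = n%:R * (c / n%:R * (K * N)).
    by rewrite mulrA [n%:R * _]mulrC divfK.
  by apply: ler_wpM2l.
(* The claimed bound is 0 in this case; otherwise the common factor Om^m can be cancelled. *)
have [Om00|Omn0] := eqVneq Om 0.
  rewrite Om00 mulr0 mul0r; elim: n => [|k ih]; first by rewrite lee_fin.
  by rewrite expeS mule_ge0// lee_fin.
have Omp : 0 < Om by rewrite lt_neqAle eq_sym Omn0.
rewrite -EFin_expe lee_fin.
have q01 (t : R) : 0 <= t -> t < M -> 0 < 1 - (t / M) ^+ n.
  move=> t0 tM; rewrite subr_gt0 exprn_ilt1// ?divr_ge0 ?(ltW M0)//.
  by rewrite ltr_pdivrMr// mul1r.
have d0 := q01 _ r0 rM.
have d1 := q01 _ (ltW r10) (lt_le_trans r1r' r'M).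
have Kn : K ^+ n = (Om * (1 - (r1 / M) ^+ n)) ^+ m.
  by apply: root_pow; rewrite exprn_ge0// mulr_ge0// ltW.
have dd : (1 - (r1 / M) ^+ n) ^+ m <= (1 - (r / M) ^+ n) ^+ m.
  apply: lerXn2r; rewrite ?nnegrE ?(ltW d0) ?(ltW d1)// lerD2l lerN2.
  apply: lerXn2r; [| |by rewrite ler_pM2r ?invr_gt0// ltW].
    by rewrite nnegrE divr_ge0// ltW.
  by rewrite nnegrE divr_ge0// ltW.
move: (1 - (r1 / M) ^+ n) (1 - (r / M) ^+ n) d0 d1 dd Kn => c1 c2 c20 c10 dd Kn.
have : (n%:R * Om) ^+ n <= (K * N) ^+ n.
  by rewrite lerXn2r ?nnegrE ?mulr_ge0.
rewrite !exprMn Kn exprMn.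
rewrite [Om ^+ n]exprS mulrA [_ * Om ^+ m]mulrC -mulrA ler_pM2l ?exprn_gt0// => h.
rewrite ler_pdivrMr ?exprn_gt0// mulrC [X in _ <= X]mulrC [Om * _]mulrC.
by apply: (le_trans h); rewrite ler_wpM2r ?exprn_ge0.
Qed.
End capacity_lower.

(** * Smooth radial cutoffs *)

Section flat.
Context {R : realType}.
Variable e : R.
Hypothesis e0 : 0 < e.

(* The powers t^(-j) make the family closed under differentiation up to linear
   combinations.  As e tends to 0, flat 0 tends to the indicator of t > 0. *)
Definition flat (j : nat) (t : R) : R :=
  if 0 < t then (t^-1) ^+ j * expR (- (e / t)) else 0.

Lemma flat_ge0 j t : 0 <= flat j t.
Proof.
rewrite /flat; case: ifPn => // t0.
by rewrite mulr_ge0 ?expR_ge0// exprn_ge0// invr_ge0 ltW.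
Qed.

Lemma flat0_le1 t : flat 0 t <= 1.
Proof.
rewrite /flat; case: ifPn => [t0|_]; last exact: ler01.
by rewrite expr0 mul1r -[leRHS]expR0 ler_expR oppr_le0 divr_ge0// ltW.
Qed.

Lemma flat_npos j t : t <= 0 -> flat j t = 0.
Proof. by move=> t0; rewrite /flat ltNge t0. Qed.

(** Raise exp z >= 1 + z >= z, at z = y / (k+1), to the power k+1. *)
Lemma expR_ge_pow (y : R) k : 0 <= y -> (y / k.+1%:R) ^+ k.+1 <= expR y.
Proof.
move=> y0; have yk : 0 <= y / k.+1%:R by rewrite divr_ge0.
have -> : expR y = expR (y / k.+1%:R) ^+ k.+1.
  by rewrite -expRM_natl mulrC divfK// pnatr_eq0.
apply: lerXn2r; rewrite ?nnegrE ?expR_ge0//.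
by apply: le_trans (expR_ge1Dx _); rewrite lerDr.
Qed.

(** The bound exp (e/t) >= (e / (t (j+2)))^(j+2) absorbs t^(-j) and leaves a spare t^2. A quadratic
    bound gives derivative 0 at the origin, for every j. *)
Lemma flat_quadratic j : exists2 C, 0 <= C & forall t, `|flat j t| <= C * t ^+ 2.
Proof.
exists ((j.+2%:R / e) ^+ j.+2); first by rewrite exprn_ge0// divr_ge0// ltW.
move=> t; rewrite ger0_norm ?flat_ge0// /flat; case: ifPn => [t0|_]; last first.
  by rewrite mulr_ge0 ?sqr_ge0// exprn_ge0// divr_ge0// ltW.
have et : 0 < e / t by rewrite divr_gt0.
rewrite expRN -ler_pdivlMr ?invr_gt0 ?expR_gt0// invrK.
have h := @expR_ge_pow (e / t) j.+1 (ltW et).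
have p0 : 0 < (e / t / j.+2%:R) ^+ j.+2 by rewrite exprn_gt0// divr_gt0.
have c0 : 0 <= (j.+2%:R / e) ^+ j.+2 * t ^+ 2.
  by rewrite mulr_ge0 ?sqr_ge0// exprn_ge0// divr_ge0// ltW.
apply: le_trans (ler_wpM2l c0 h).
rewrite le_eqVlt; apply/orP; left; apply/eqP.
rewrite mulrAC -exprMn (_ : _ / e * _ = t^-1); last first.
  by field; rewrite !gt_eqF// ltr0n.
by rewrite -addn2 exprD -mulrA -exprMn mulVf ?gt_eqF// expr1n mulr1.
Qed.

Lemma is_derive_flat0 j : is_derive (0 : R) 1 (flat j) 0.
Proof.
have [C C0 hC] := flat_quadratic j.
have H : (fun h : R => h^-1 *: ((flat j \o shift 0) (h *: 1) - flat j 0)) @ 0^' --> (0 : R).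
  apply/cvgrPdist_le => d d0; near=> h.
  have h0 : h != 0 by near: h; exact: nbhs_dnbhs_neq.
  rewrite /= (_ : h *: (1 : R) = h); last exact: mulr1.
  rewrite addr0 (@flat_npos j 0)// subr0 sub0r normrN normrM normfV.
  rewrite ler_pdivrMl ?normr_gt0//; apply: le_trans (hC h) _.
  rewrite -real_normK ?num_real// expr2 mulrCA ler_pM2l ?normr_gt0//.
  have hd : `|h| < d / (C + 1).
    by near: h; apply: dnbhs0_lt; rewrite divr_gt0// ltr_wpDl.
  apply: (@le_trans _ _ ((C + 1) * `|h|)); first by rewrite ler_wpM2r// lerDl.
  by rewrite mulrC -ler_pdivlMr ?ltr_wpDl// ltW.
by split; [apply/cvg_ex; exists 0|exact/cvg_lim].
Unshelve. all: by end_near. Qed.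

Lemma is_derive_flat j (t : R) :
  is_derive t 1 (flat j) (e * flat j.+2 t - j%:R * flat j.+1 t).
Proof.
have [t0|t0|->] := ltgtP t 0.
- rewrite !flat_npos ?(ltW t0)// !mulr0 subr0.
  have h := @is_derive_near0 R _ (flat j) t (1 : R) [set s | s < 0].
  apply: h => //.
  by move=> s /= s0; rewrite flat_npos// ltW.
- have h := @is_derive_near_eq R _ (flat j)
    (fun s : R => (s^-1) ^+ j * expR (- (e * s^-1))) t (1 : R)
    (e * flat j.+2 t - j%:R * flat j.+1 t) [set s | 0 < s].
  apply: h => //.
    by move=> s /= s0; rewrite /flat s0.
  have d1 := is_derive_invX j t0.
  have d2 := is_derive_invX 1 t0.
  have d3 := is_deriveN (@is_deriveZ _ _ _ _ e _ _ _ d2).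
  have d4 := @is_derive1_comp R _ _ _ _ _ (is_derive_expR _) d3.
  apply: (@is_derive_eq _ _ _ _ _ _ _ _ (is_deriveM d1 d4)).
  rewrite /GRing.scale/= /flat t0.
  have -> : (- (e \*: (fun s : R => s^-1 ^+ 1))) t = - (e / t) by [].
  move: (expR _) (t^-1 ^+ j) (exprS t^-1 j) (exprS t^-1 j.+1) => E w -> ->.
  by ring.
- rewrite !flat_npos// !mulr0 subr0; exact: is_derive_flat0.
Qed.
End flat.

Section continuous_ops.
Context {T : topologicalType} {R : realType}.
Implicit Types f g : T -> R.

Lemma continuous_addr f g : continuous f -> continuous g ->
  continuous (fun x => f x + g x).
Proof. by move=> cf cg x; apply: cvgD; [exact: cf|exact: cg]. Qed.

Lemma continuous_mulr f g : continuous f -> continuous g ->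
  continuous (fun x => f x * g x).
Proof. by move=> cf cg x; apply: cvgM; [exact: cf|exact: cg]. Qed.

Lemma continuous_oppr f : continuous f -> continuous (fun x => - f x).
Proof. by move=> cf x; apply: cvgN; exact: cf. Qed.

Lemma continuous_invr f : (forall x, f x != 0) -> continuous f ->
  continuous (fun x => (f x)^-1).
Proof. by move=> f0 cf x; apply: cvgV; [exact: f0|exact: cf]. Qed.

Lemma continuous_constr (c : R) : continuous (fun _ : T => c).
Proof. by move=> x; exact: cvg_cst. Qed.
End continuous_ops.

Section chain.
Context {R : realType} {n : nat}.

(** A directional derivative is a one-variable derivative along a line, so the one-variable chain
    rule carries over to compositions h (f x). *)
Lemma is_derive_lineP (f : 'rV[R]_n -> R) (x v : 'rV[R]_n) (df : R) :
  is_derive (0 : R) 1 (fun t : R => f (x + t *: v)) df <-> is_derive x v f df.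
Proof.
have e : (fun h : R => h^-1 *: (((fun t : R => f (x + t *: v)) \o shift 0) (h *: 1) -
      f (x + 0 *: v))) =
    (fun h : R => h^-1 *: ((f \o shift x) (h *: v) - f x)).
  apply/funext => h /=; rewrite (_ : h *: (1 : R) = h); last exact: mulr1.
  by rewrite addr0 scale0r addr0 [x + _]addrC.
split=> -[d v_]; split.
- by rewrite /derivable -e.
- by rewrite /derive -e.
- by rewrite /derivable e.
- by rewrite /derive e.
Qed.

Lemma is_derive_rV_comp (h : R -> R) (f : 'rV[R]_n -> R) (x v : 'rV[R]_n) (dh df : R) :
  is_derive (f x) 1 h dh -> is_derive x v f df ->
  is_derive x v (fun z => h (f z)) (dh * df).
Proof.
move=> dh_ /is_derive_lineP df_; apply/is_derive_lineP.
have dh' : is_derive ((fun t : R => f (x + t *: v)) 0) 1 h dh.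
  rewrite /= scale0r addr0; exact: dh_.
exact: (@is_derive1_comp R h _ 0 _ _ dh' df_).
Qed.
End chain.

Section smooth_distance.
Context {R : realType} {n : nat}.
Variables (a : 'rV[R]_n) (d : R).
Hypothesis d0 : 0 < d.

(* The distance to a itself is not differentiable at a. *)
Definition sdist (x : 'rV[R]_n) : R := Num.sqrt (d ^+ 2 + enorm (x - a) ^+ 2).

Lemma sdist_gt0 x : 0 < sdist x.
Proof. by rewrite sqrtr_gt0 ltr_wpDr ?sqr_ge0// exprn_gt0. Qed.

Lemma sdist_sqr x : sdist x ^+ 2 = d ^+ 2 + enorm (x - a) ^+ 2.
Proof. by rewrite sqr_sqrtr// addr_ge0 ?sqr_ge0. Qed.

Lemma enorm_le_sdist x : enorm (x - a) <= sdist x.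
Proof.
rewrite -(@ler_pXn2r _ 2)// ?nnegrE ?enorm_ge0 ?(ltW (sdist_gt0 x))//.
by rewrite sdist_sqr lerDr sqr_ge0.
Qed.

(** Together with [enorm_le_sdist], the smooth distance exceeds the true one by at most d. In a
    cutoff only the inner radius has to be enlarged; the outer one can stay. *)
Lemma sdist_le x : sdist x <= enorm (x - a) + d.
Proof.
rewrite -(@ler_pXn2r _ 2)// ?nnegrE ?addr_ge0 ?enorm_ge0 ?(ltW d0) ?(ltW (sdist_gt0 x))//.
rewrite sdist_sqr sqrrD addrC lerD2r lerDl mulrn_wge0// mulr_ge0 ?enorm_ge0//.
exact: ltW.
Qed.

Lemma continuous_sdist : continuous sdist.
Proof.
move=> x.
have c : {for x, continuous (fun x : 'rV[R]_n => d ^+ 2 + enorm (x - a) ^+ 2)}.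
  apply: continuous_addr; first exact: continuous_constr.
  by apply: continuous_mulr; exact: continuous_enormB.
exact: (@continuous_comp _ _ _ _ (@Num.sqrt R) x c (@sqrt_continuous R _)).
Qed.

Lemma is_derive_coord (i j : 'I_n) (x : 'rV[R]_n) :
  is_derive x (delta_mx ord0 j) (fun x : 'rV[R]_n => x ord0 i - a ord0 i) (i == j)%:R.
Proof.
apply/is_derive_lineP.
rewrite (_ : (fun t : R => _) =
    (fun t : R => x ord0 i - a ord0 i + t * (i == j)%:R)); last first.
  by apply/funext => t; rewrite !mxE eqxx/= addrAC.
have h := is_deriveD (is_derive_cst (x ord0 i - a ord0 i) (0 : R) 1)
  (@is_deriveZ _ _ _ _ ((i == j)%:R) _ _ _ (@is_derive_id R R (0 : R) 1)).
rewrite (_ : (fun t : R => _) = cst (x ord0 i - a ord0 i) + ((i == j)%:R \*: id)).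
  apply: (@is_derive_eq _ _ _ _ _ _ _ _ h).
  by rewrite add0r; exact: mulr1.
by apply/funext => t /=; rewrite mulrC.
Qed.

Lemma is_derive_sdist (i : 'I_n) (x : 'rV[R]_n) :
  is_derive x (delta_mx ord0 i) sdist ((x ord0 i - a ord0 i) * (sdist x)^-1).
Proof.
have S0 : 0 < d ^+ 2 + enorm (x - a) ^+ 2.
  by rewrite ltr_wpDr ?sqr_ge0// exprn_gt0.
have dS : is_derive x (delta_mx ord0 i) (fun x : 'rV[R]_n => d ^+ 2 + enorm (x - a) ^+ 2)
    (2 * (x ord0 i - a ord0 i)).
  have h (j : 'I_n) := is_deriveM (is_derive_coord j i x) (is_derive_coord j i x).
  have h2 := is_deriveD (is_derive_cst (d ^+ 2) x (delta_mx ord0 i)) (is_derive_sum h).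
  rewrite (_ : (fun x => _) = cst (d ^+ 2) + \sum_(j < n)
      ((fun x : 'rV[R]_n => x ord0 j - a ord0 j) *
        (fun x : 'rV[R]_n => x ord0 j - a ord0 j))); last first.
    apply/funext => y /=; congr (_ + _); rewrite enorm_sqr fct_sumE.
    by apply: eq_bigr => j _; rewrite !mxE.
  apply: (@is_derive_eq _ _ _ _ _ _ _ _ h2).
  rewrite add0r (bigD1 i)//= big1 ?addr0 => [|j ji].
    by rewrite eqxx /GRing.scale/= !mulr1 mulrDl mul1r.
  by rewrite (negbTE ji) !scaler0 addr0.
apply: (@is_derive_eq _ _ _ _ _ _ _ _ (is_derive_rV_comp (is_derive1_sqrt S0) dS)).
rewrite -/(sdist x) invfM mulrACA mulVf ?mul1r ?pnatr_eq0//.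
by rewrite mulrC.
Qed.
End smooth_distance.

Section plateau.
Context {R : realType}.
Notation mu := (@lebesgue_measure R).
Variables (e rho1 rho2 : R).
Hypotheses (e0 : 0 < e) (rho10 : 0 < rho1) (rho12 : rho1 < rho2).

(** A smooth bump supported in [rho1, rho2], close to 1 inside for small e: up to a constant factor,
    minus the radial slope of the cutoff. *)
Definition plateau (t : R) : R := flat e 0 (t - rho1) * flat e 0 (rho2 - t).

(** The plateau vanishes below rho1 > 0, so starting at 0 loses no mass; the cutoff evaluates the
    primitive only at [sdist], which is positive, so a derivative at interior points suffices. *)
Definition plateau_primitive (t : R) : R := (\int[mu]_(s in `[0, t]) plateau s)%R.

Lemma plateau_ge0 t : 0 <= plateau t.
Proof. by rewrite mulr_ge0 ?flat_ge0. Qed.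

Lemma plateau_le1 t : plateau t <= 1.
Proof. by rewrite mulr_ile1 ?flat_ge0 ?flat0_le1. Qed.

Lemma plateau_eq0 t : t <= rho1 \/ rho2 <= t -> plateau t = 0.
Proof.
by rewrite /plateau => -[h|h]; [rewrite flat_npos ?mul0r|rewrite [X in _ * X]flat_npos ?mulr0];
  rewrite ?subr_le0.
Qed.

Lemma continuous_flat j : continuous (flat e j).
Proof.
by move=> t; apply/differentiable_continuous/derivable1_diffP; case: (is_derive_flat e0 j t).
Qed.

Lemma continuous_plateau : continuous plateau.
Proof.
apply: continuous_mulr => t.
  apply: (@continuous_comp _ _ _ (fun t => t - rho1) (flat e 0)).
    by apply: cvgB; [exact: cvg_id|exact: cvg_cst].
  exact: continuous_flat.
apply: (@continuous_comp _ _ _ (fun t => rho2 - t) (flat e 0)).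
  by apply: cvgB; [exact: cvg_cst|exact: cvg_id].
exact: continuous_flat.
Qed.

Lemma integrable_plateau a b : mu.-integrable `[a, b] (EFin \o plateau).
Proof.
apply: continuous_compact_integrable; first exact: segment_compact.
exact: (continuous_subspaceT continuous_plateau).
Qed.

Lemma is_derive_plateau_primitive (t : R) : 0 < t ->
  is_derive t 1 plateau_primitive (plateau t).
Proof.
move=> t0; have tu : t < t + 1 by rewrite ltrDl.
have [d v] := continuous_FTC1_closed tu (integrable_plateau 0 (t + 1)) t0
  (@continuous_plateau t).
by split; [exact: d|rewrite -derive1E].
Qed.

Lemma plateau_primitive_eq0 t : t <= rho1 -> plateau_primitive t = 0.
Proof.
move=> t1; rewrite /plateau_primitive /Rintegral integral0_eq// => s.
rewrite /= in_itv/= => /andP[_ st].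
by rewrite plateau_eq0//; left; exact: le_trans st t1.
Qed.

Lemma plateau_primitive_const t : rho2 <= t -> plateau_primitive t = plateau_primitive rho2.
Proof.
move=> t2; rewrite /plateau_primitive /Rintegral; congr fine.
rewrite integral_mkcond [RHS]integral_mkcond; apply: eq_integral => s _.
rewrite !patchE; have [s2|s2] := ltP s rho2; last first.
  by rewrite plateau_eq0 ?if_same//; right.
congr (if _ then _ else _).
apply/idP/idP; rewrite !inE/= !in_itv/= => /andP[-> _]/=; first exact: ltW.
by apply: ltW; exact: lt_le_trans s2 t2.
Qed.

End plateau.

(** As e tends to 0 the plateau tends to the indicator of ]rho1, rho2[, whose mass is rho2 - rho1 >
    c; the proof makes this quantitative. *)
Lemma plateau_mass (R : realType) (rho1 rho2 c : R) :
  0 < rho1 -> 0 < c -> c < rho2 - rho1 ->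
  exists2 e, 0 < e & c <= plateau_primitive e rho1 rho2 rho2.
Proof.
move=> rho10 c0 cr.
(* A margin eta is given up at each end; l is the length of what remains and still exceeds c. *)
pose eta := (rho2 - rho1 - c) / 4; pose l := (rho2 - rho1 + c) / 2.
have eta0 : 0 < eta by rewrite /eta; lra.
have l0 : 0 < l by rewrite /l; lra.
have cl : c < l by rewrite /l; lra.
(* With this s, (1 - s)^2 >= 1 - 2 s = c / l. Taking e = eta s makes each flat factor at least 1 - e
   / eta = 1 - s on the inner interval, whose integral is then at least c. *)
pose s := (1 - c / l) / 2.
have cl1 : c / l < 1 by rewrite ltr_pdivrMr// mul1r.
have s0 : 0 < s by rewrite /s; lra.
have cl0 : 0 < c / l by rewrite divr_gt0.
have s1 : s < 1 by rewrite /s; lra.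
exists (eta * s); first by rewrite mulr_gt0.
set e := eta * s; have e0 : 0 < e by rewrite mulr_gt0.
have fl t : eta <= t -> 1 - s <= flat e 0 t.
  move=> et; have t0 := lt_le_trans eta0 et.
  rewrite /flat t0 expr0 mul1r; apply: le_trans (expR_ge1Dx _).
  by rewrite lerD2l lerN2 ler_pdivrMr// [leRHS]mulrC ler_pM2r.
have ab : rho1 + eta <= rho2 - eta by rewrite /eta; lra.
set J := (\int[lebesgue_measure]_(t in `[0%R, rho2]) (plateau e rho1 rho2 t)%:E)%E.
have J_fin : J \is a fin_num by apply: integrable_fin_num => //; exact: integrable_plateau.
suff : (c%:E <= J)%E by rewrite -(fineK J_fin) lee_fin.
rewrite /J.
have -> : c%:E = (\int[lebesgue_measure]_(t in `[(rho1 + eta)%R, (rho2 - eta)%R]) (c / l)%:E)%E.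
  rewrite integral_cst//.
  rewrite (_ : _ `[_, _]%classic = lebesgue_measure `[rho1 + eta, rho2 - eta]%classic)//.
  rewrite lebesgue_measure_itv/= lte_fin; case: ifPn => [_|].
    rewrite -EFinB -EFinM (_ : _ - _ = l); last by rewrite /l /eta; lra.
    by rewrite divfK// gt_eqF.
  by rewrite -leNgt => h; exfalso; move: h; rewrite /eta; lra.
rewrite integral_mkcond [leRHS]integral_mkcond; apply: le_integral_ge0 => t _.
  by apply: erestrict_ge0 => r _; rewrite lee_fin divr_ge0// ltW.
rewrite patchE; case: ifPn => [|_]; last first.
  by apply: erestrict_ge0 => r _; rewrite lee_fin plateau_ge0.
rewrite inE/= in_itv/= => /andP[t1 t2].
rewrite patchE mem_set/=; last by rewrite in_itv/=; apply/andP; split; lra.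
rewrite lee_fin; apply: (@le_trans _ _ ((1 - s) * (1 - s))).
  have : 0 <= s ^+ 2 by exact: sqr_ge0.
  have : c / l = 1 - 2 * s by rewrite /s; lra.
  by move=> ->; lra.
by apply: ler_pM; rewrite ?subr_ge0 ?(ltW s1)//; apply: fl; lra.
Qed.

Section cutoff_class.
Context {R : realType} {n : nat}.
Variables (a : 'rV[R]_n) (d e rho1 rho2 : R).
Hypotheses (d0 : 0 < d) (e0 : 0 < e) (rho10 : 0 < rho1).
Notation w := (sdist a d).

(* A class closed under partial derivatives that contains the cutoff: membership
   gives smoothness without computing iterated derivatives. *)
Inductive cutoff_class : ('rV[R]_n -> R) -> Prop :=
| cutoff_cst c : cutoff_class (fun _ => c)
| cutoff_coord i : cutoff_class (fun x => x ord0 i - a ord0 i)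
| cutoff_add f g : cutoff_class f -> cutoff_class g ->
    cutoff_class (fun x => f x + g x)
| cutoff_mul f g : cutoff_class f -> cutoff_class g ->
    cutoff_class (fun x => f x * g x)
| cutoff_inv : cutoff_class (fun x => (w x)^-1)
| cutoff_flatl j : cutoff_class (fun x => flat e j (w x - rho1))
| cutoff_flatr j : cutoff_class (fun x => flat e j (rho2 - w x))
| cutoff_primitive : cutoff_class (fun x => plateau_primitive e rho1 rho2 (w x)).

Lemma cutoff_class_continuous f : cutoff_class f -> continuous f.
Proof.
have cw : continuous w by exact: continuous_sdist.
have cN : continuous (fun x => - w x).
  exact: continuous_oppr.
elim => {f} [c|i|f g _ cf _ cg|f g _ cf _ cg||j|j|].
- exact: continuous_constr.
- apply: continuous_addr; last exact: continuous_constr.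
  exact: coord_continuous.
- exact: continuous_addr.
- exact: continuous_mulr.
- by apply: continuous_invr => // x; rewrite gt_eqF// sdist_gt0.
- move=> x; apply: (@continuous_comp _ _ _ (fun x => w x - rho1) (flat e j)).
    by apply: continuous_addr => //; exact: continuous_constr.
  exact: continuous_flat.
- move=> x; apply: (@continuous_comp _ _ _ (fun x => rho2 - w x) (flat e j)).
    by apply: continuous_addr => //; exact: continuous_constr.
  exact: continuous_flat.
- move=> x; apply: (@continuous_comp _ _ _ w (plateau_primitive e rho1 rho2)).
    exact: cw.
  apply/differentiable_continuous/derivable1_diffP.
  by case: (is_derive_plateau_primitive rho1 rho2 e0 (sdist_gt0 a d0 x)).
Qed.

Lemma cutoff_class_derive f i : cutoff_class f ->
  exists2 g, cutoff_class g & forall x, is_derive x (delta_mx ord0 i) f (g x).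
Proof.
pose W := fun x : 'rV[R]_n => (x ord0 i - a ord0 i) * (w x)^-1.
have cW : cutoff_class W by apply: cutoff_mul; [exact: cutoff_coord|exact: cutoff_inv].
have dw (x : 'rV[R]_n) : is_derive x (delta_mx ord0 i) w (W x) by exact: is_derive_sdist.
(* The remaining generators, apart from constants and coordinates, are functions of [w] alone; this
   is the chain rule for them. *)
have lift h h' : (forall x, is_derive (w x) 1 h (h' x)) -> cutoff_class h' ->
    exists2 g, cutoff_class g &
      forall x, is_derive x (delta_mx ord0 i) (fun x => h (w x)) (g x).
  move=> dh ch; exists (fun x => h' x * W x); first exact: cutoff_mul.
  by move=> x; exact: (is_derive_rV_comp (dh x) (dw x)).
elim => {f} [c|j|f g cf [f' cf' df] cg [g' cg' dg]|f g cf [f' cf' df] cg [g' cg' dg]||j|j|].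
- by exists (fun _ => 0) => [|x]; [exact: cutoff_cst|exact: is_derive_cst].
- exists (fun _ => (j == i)%:R) => [|x]; first exact: cutoff_cst.
  exact: is_derive_coord.
- exists (fun x => f' x + g' x) => [|x]; first exact: cutoff_add.
  exact: (is_deriveD (df x) (dg x)).
- exists (fun x => f x * g' x + g x * f' x) => [|x].
    by apply: cutoff_add; exact: cutoff_mul.
  exact: (is_deriveM (df x) (dg x)).
- apply: (lift (fun s => s^-1) (fun x => -1 * ((w x)^-1 * (w x)^-1))).
    by move=> x; exact: (is_derive_invX 1 (sdist_gt0 a d0 x)).
  apply: cutoff_mul; first exact: cutoff_cst.
  by apply: cutoff_mul; exact: cutoff_inv.
- apply: (lift (fun s => flat e j (s - rho1))
    (fun x => (e * flat e j.+2 (w x - rho1) + (- j%:R) * flat e j.+1 (w x - rho1)) * 1)).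
    move=> x.
    have h1 := is_deriveB (@is_derive_id R R (w x) 1) (is_derive_cst rho1 (w x) 1).
    apply: (@is_derive_eq _ _ _ _ _ _ _ _ (@is_derive1_comp R _ _ _ _ _ (is_derive_flat e0 j _) h1)).
    by rewrite subr0 mulNr.
  apply: cutoff_mul; last exact: cutoff_cst.
  by apply: cutoff_add; apply: cutoff_mul; by [exact: cutoff_cst|exact: cutoff_flatl].
- apply: (lift (fun s => flat e j (rho2 - s))
    (fun x => (e * flat e j.+2 (rho2 - w x) + (- j%:R) * flat e j.+1 (rho2 - w x)) * -1)).
    move=> x.
    have h1 := is_deriveB (is_derive_cst rho2 (w x) 1) (@is_derive_id R R (w x) 1).
    apply: (@is_derive_eq _ _ _ _ _ _ _ _ (@is_derive1_comp R _ _ _ _ _ (is_derive_flat e0 j _) h1)).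
    by rewrite sub0r mulNr.
  apply: cutoff_mul; last exact: cutoff_cst.
  by apply: cutoff_add; apply: cutoff_mul; by [exact: cutoff_cst|exact: cutoff_flatr].
- apply: (lift (plateau_primitive e rho1 rho2) (fun x => plateau e rho1 rho2 (w x))).
    by move=> x; apply: is_derive_plateau_primitive => //; exact: sdist_gt0.
  by apply: cutoff_mul; [exact: cutoff_flatl|exact: cutoff_flatr].
Qed.

Lemma cutoff_class_partial f i : cutoff_class f -> cutoff_class (partial i f).
Proof.
move=> cf; have [g cg dg] := cutoff_class_derive i cf.
by rewrite (_ : partial i f = g)//; apply/funext => x; exact: derive_val.
Qed.

Lemma cutoff_class_smooth f : cutoff_class f -> smooth setT f.
Proof.
move=> cf s x _.
have cs : cutoff_class (foldr partial f s).
  by elim: s => //= i s; exact: cutoff_class_partial.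
split; first exact: cutoff_class_continuous.
by move=> i; have [g _ dg] := cutoff_class_derive i cs; case: (dg x).
Qed.
End cutoff_class.

(** The cutoff is 1 - F / I, with F the plateau primitive of the smooth distance and I its total
    mass. The plateau is at most 1 and the gradient of the smooth distance has length at most 1, so
    the slope is at most 1 / I, and [plateau_mass] provides I >= 1 / L. *)
Lemma radial_cutoff (R : realType) (n : nat) (a : 'rV[R]_n) (r1 r2 L : R) :
  0 <= r1 -> r1 < r2 -> (r2 - r1)^-1 < L ->
  exists phi : 'rV[R]_n -> R,
    [/\ smooth setT phi,
        forall x, enorm (x - a) <= r1 -> phi x = 1,
        forall x, r2 <= enorm (x - a) -> phi x = 0,
        forall x, enorm (grad phi x) <= L
      & forall x, ~ (r1 <= enorm (x - a) < r2) -> grad phi x = 0].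
Proof.
move=> r10 r12 hL.
have r210 : 0 < r2 - r1 by rewrite subr_gt0.
have L0 : 0 < L by apply: lt_trans hL; rewrite invr_gt0.
have iL : L^-1 < r2 - r1 by rewrite -ltf_pV2 ?posrE ?invr_gt0// invrK.
(* Half of the slack pays for replacing the distance by [sdist], the other half for the mass lost by
   the plateau. *)
pose d := (r2 - r1 - L^-1) / 2.
have d0 : 0 < d by rewrite divr_gt0// subr_gt0.
pose rho1 := r1 + d.
have rho10 : 0 < rho1 by rewrite ltr_wpDl.
have cr : L^-1 < r2 - rho1 by rewrite /rho1 /d; lra.
have iL0 : 0 < L^-1 by rewrite invr_gt0.
have [e e0 mass] := plateau_mass rho10 iL0 cr.
set I := plateau_primitive e rho1 r2 r2 in mass.
have I0 : 0 < I by exact: lt_le_trans mass.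
pose w := sdist a d.
pose F (x : 'rV[R]_n) := plateau_primitive e rho1 r2 (w x).
pose phi (x : 'rV[R]_n) := 1 + (- I^-1) * F x.
have cphi : cutoff_class a d e rho1 r2 phi.
  apply: cutoff_add; first exact: cutoff_cst.
  by apply: cutoff_mul; [exact: cutoff_cst|exact: cutoff_primitive].
have gphi x : grad phi x = (- (I^-1 * plateau e rho1 r2 (w x) / w x)) *: (x - a).
  apply/rowP => i; rewrite !mxE /partial.
  have dF := is_derive_rV_comp (is_derive_plateau_primitive rho1 r2 e0 (sdist_gt0 a d0 x))
    (is_derive_sdist a d0 i x).
  have := is_deriveD (is_derive_cst (1 : R) x (delta_mx ord0 i)) (is_deriveZ (- I^-1) dF).
  move=> dphi; have -> := @derive_val _ _ _ _ _ _ _ dphi.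
  by rewrite add0r /GRing.scale/= -/w; ring.
exists phi; split.
- exact: cutoff_class_smooth cphi.
- move=> x xr; rewrite /phi /F plateau_primitive_eq0 ?mulr0 ?addr0//.
  by apply: le_trans (sdist_le a d0 x) _; rewrite lerD2r.
- move=> x xr; rewrite /phi /F plateau_primitive_const; last first.
    exact: le_trans xr (enorm_le_sdist a d0 x).
  by rewrite mulNr mulVf ?subrr// gt_eqF.
- move=> x; rewrite gphi enormZ normrN.
  have w0 : 0 < w x by exact: sdist_gt0.
  have p0 : 0 <= plateau e rho1 r2 (w x) by exact: plateau_ge0.
  have p1 : plateau e rho1 r2 (w x) <= 1 by exact: plateau_le1.
  rewrite ger0_norm; last by rewrite mulr_ge0 ?invr_ge0 ?(ltW w0)// mulr_ge0 ?invr_ge0 ?(ltW I0).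
  apply: (@le_trans _ _ (I^-1 * 1)); last first.
    by rewrite mulr1 -[L]invrK lef_pV2 ?posrE.
  have q0 : 0 <= (w x)^-1 * enorm (x - a).
    by rewrite mulr_ge0 ?invr_ge0 ?enorm_ge0// ltW.
  have q1 : (w x)^-1 * enorm (x - a) <= 1.
    by rewrite ler_pdivrMl// mulr1; exact: enorm_le_sdist.
  rewrite -(mulrA _ _ (enorm _)) -(mulrA I^-1).
  apply: ler_wpM2l; first by rewrite invr_ge0 ltW.
  exact: (mulr_ile1 p0 q0 p1 q1).
- move=> x xr; rewrite gphi plateau_eq0 ?mulr0 ?mul0r ?oppr0 ?scale0r//.
  have [xr1|xr1] := ltP (enorm (x - a)) r1.
    by left; apply: le_trans (sdist_le a d0 x) _; rewrite lerD2r ltW.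
  right; apply: le_trans (enorm_le_sdist a d0 x); rewrite leNgt.
  by apply/negP => xr2; apply: xr; rewrite xr1.
Qed.

(** * Test functions as Sobolev-Lorentz functions *)

(** Boundedness refers to the sup norm; comparing it with the Euclidean length costs the factor
    n. *)
Lemma bounded_sub_eball (R : realType) (n : nat) (A : set 'rV[R]_n) (x : 'rV[R]_n) :
  bounded_set A -> exists2 M, 0 < M & A `<=` eball x M.
Proof.
move=> [M0 [_ AM]].
pose M := `|M0| + 1; have M0M : M0 < M by rewrite (le_lt_trans (ler_norm _))// ltrDl.
have Mp : 0 < M by rewrite ltr_wpDl.
exists (n%:R * M + enorm x + 1).
  by rewrite ltr_wpDl// addr_ge0 ?enorm_ge0// mulr_ge0// ltW.
move=> y /(AM _ M0M) /= yM; rewrite /eball/=.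
apply: (@le_lt_trans _ _ (enorm y + enorm x)); last first.
  rewrite -addrA; apply: (@le_lt_trans _ _ (n%:R * M + enorm x)); last by rewrite addrA ltrDl.
  by rewrite lerD2r (le_trans (enorm_le_norm _))// ler_wpM2l.
by rewrite -[enorm x]enormN; exact: enormD.
Qed.

Lemma integrable_indic_lty d (T : measurableType d) (R : realType)
    (mu : {measure set T -> \bar R}) (A : set T) :
  measurable A -> (mu A < +oo)%E ->
  mu.-integrable setT (fun x : T => (\1_A x)%:E).
Proof.
move=> mA Aoo; apply/integrableP; split; first exact/measurable_EFinP.
rewrite (eq_integral (fun x => (\1_A x)%:E)); first by rewrite integral_indicT.
by move=> t _; rewrite gee0_abs// lee_fin.
Qed.

(** * Translation invariance and integration by parts *)

Section integration_by_parts.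
Context {R : realType} {m : nat}.
Notation n := m.+1.
Notation leb := (lebesgue_rV n).

Lemma integral_translate (f : 'rV[R]_n -> \bar R) (c : 'rV[R]_n) :
  measurable_fun setT f -> (\int[leb]_x f (c + x)%R = \int[leb]_x f x)%E.
Proof.
move=> mf.
have h (g : 'rV[R]_n -> \bar R) : measurable_fun setT g -> (forall x, 0 <= g x)%E ->
    (\int[leb]_x g (c + x)%R = \int[leb]_x g x)%E.
  move=> mg g0; rewrite [RHS](integral_affine_rV c ltr01 mg g0) expr1n mul1e.
  by apply: eq_integral => x _; rewrite scale1r.
rewrite integralE [RHS]integralE; congr (_ - _)%E.
  rewrite -(h _ (measurable_funepos mf) (fun x => funepos_ge0 f x)).
  by apply: eq_integral => x _; rewrite !funeposE.
rewrite -(h _ (measurable_funeneg mf) (fun x => funeneg_ge0 f x)).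
by apply: eq_integral => x _; rewrite !funenegE.
Qed.

Lemma integrable_bounded_support (f : 'rV[R]_n -> R) (C M : R) :
  0 <= M -> measurable_fun setT f -> (forall x, `|f x| <= C) ->
  (forall x, ~ eball 0 M x -> f x = 0) -> leb.-integrable setT (EFin \o f).
Proof.
move=> M0 mf fC f0.
have C0 : 0 <= C by exact: le_trans (fC 0).
have mB : measurable (eball (0 : 'rV[R]_n) M) by exact: measurable_eball.
apply: (@le_integrable _ _ _ _ _ measurableT _
  (fun x => (C * \1_(eball (0 : 'rV[R]_n) M) x)%:E)).
- exact/measurable_EFinP.
- move=> x _ /=; rewrite lee_fin indicE.
  have [|] := boolP (x \in _); first by rewrite mulr1 [leRHS]ger0_norm.
  by rewrite notin_setE => /f0 ->; rewrite normr0.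
- rewrite (_ : (fun _ => _) = (fun x => C%:E * (\1_(eball (0 : 'rV[R]_n) M) x)%:E)%E)//.
  apply: integrableZl => //; apply: integrable_indic_lty => //.
  by rewrite -[X in (X < _)%E]/(leb _) lebesgue_eballE// ltry.
Qed.

(* The difference quotients of f have integral 0 by translation invariance. *)
Lemma integral_partial_eq0 (f : 'rV[R]_n -> R) (K : set 'rV[R]_n) (i : 'I_n) :
  compact K -> (forall x, ~ K x -> f x = 0) ->
  (forall x, ~ K x -> partial i f x = 0) ->
  continuous f -> continuous (partial i f) ->
  (forall x, derivable f x (delta_mx ord0 i)) ->
  (\int[leb]_x (partial i f x)%:E = 0)%E.
Proof.
move=> cK f0 pf0 cf cpf df.
have [M M0 KM] := bounded_sub_eball 0 (compact_bounded cK).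
have [C C0 pC] := continuous_compact_bounded cK cpf pf0.
have [C' C'0 fC'] := continuous_compact_bounded cK cf f0.
have mf : measurable_fun setT f by exact: measurable_continuous_rV.
have mpf : measurable_fun setT (partial i f) by exact: measurable_continuous_rV.
pose v : 'rV[R]_n := delta_mx ord0 i.
pose h (k : nat) : R := k.+1%:R^-1.
have h0 k : 0 < h k by rewrite invr_gt0.
have h1 k : h k <= 1 by rewrite invf_le1// ler1n.
pose q (k : nat) x : R := (h k)^-1 * (f (h k *: v + x) - f x).
have mfk k : measurable_fun setT (fun x => f (h k *: v + x)).
  have := measurable_affine_rV (h k *: v) 1; under eq_fun do rewrite scale1r.
  by move=> ma; exact: (measurableT_comp mf ma).
have mq k : measurable_fun setT (q k).
  by apply: measurable_funM => //; apply: measurable_funB.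
(* By the mean value theorem a difference quotient is a value of the partial derivative at a nearby
   point. So the quotients share the bound C and the support ball B(0, M + 1), which gives a
   dominating function, and they converge pointwise by continuity. *)
have qE k x : exists2 xi, `|xi| <= h k & q k x = partial i f (x + xi *: v).
  have [xi xih] := @mean_value0 R (fun t => f (x + t *: v))
    (fun t => partial i f (x + t *: v)) (h k) (fun t => is_derive_line (df _)).
  rewrite scale0r addr0 => e; exists xi.
    by rewrite -[leRHS]gtr0_norm.
  by rewrite /q [h k *: v + x]addrC e mulKf// gt_eqF.
have qC k x : `|q k x| <= C by have [xi _ ->] := qE k x.
have v1 : enorm v <= 1.
  rewrite /enorm (bigD1 i)//= big1 ?addr0 => [|j ji].
    by rewrite mxE !eqxx expr1n sqrtr1.
  by rewrite mxE (negbTE ji) andbF expr0n.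
have q0 k x : ~ eball 0 (M + 1) x -> q k x = 0.
  move=> xM; have [xi /le_trans/(_ (h1 k)) xi1 ->] := qE k x.
  apply: pf0 => /KM; rewrite /eball/= subr0 => h2.
  apply: xM; rewrite /eball/= subr0.
  have -> : x = (x + xi *: v) - xi *: v by rewrite addrK.
  apply: le_lt_trans (enormD _ _) _; rewrite enormN enormZ.
  by apply: ltr_leD => //; rewrite mulr_ile1 ?enorm_ge0.
have iq0 k : (\int[leb]_x (q k x)%:E = 0)%E.
  have i1 : leb.-integrable setT (EFin \o f).
    by apply: (integrable_bounded_support (ltW M0) mf fC') => x xM; apply: f0 => /KM.
  have i2 : leb.-integrable setT (EFin \o (fun x => f (h k *: v + x))).
    apply: (@integrable_bounded_support _ C' (M + 1)) => //.
    - by rewrite addr_ge0// ltW.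
    - move=> x xM; apply: f0 => /KM; rewrite /eball/= subr0 => h2.
      apply: xM; rewrite /eball/= subr0.
      have -> : x = (h k *: v + x) - h k *: v by rewrite addrAC subrr add0r.
      apply: le_lt_trans (enormD _ _) _; rewrite enormN enormZ.
      by apply: ltr_leD => //; rewrite mulr_ile1 ?enorm_ge0// gtr0_norm.
  under eq_integral do rewrite /q EFinM EFinB.
  rewrite integralZl//; last exact: integrableB.
  rewrite integralB// (integral_translate (h k *: v) (f := EFin \o f)); last exact/measurable_EFinP.
  rewrite subee ?mule0//; exact: integrable_fin_num.
have qcvg x : (q k x)%:E @[k --> \oo] --> (partial i f x)%:E.
  apply: cvg_EFin; first exact: nearW.
  apply/cvgrPdist_lt => eps eps0.
  have nx : nbhs x [set z | `|partial i f x - partial i f z| < eps].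
    exact: (@cvgr_dist_lt _ _ _ (nbhs x) _ _ _ (cpf x) _ eps0).
  have [del /= del0 delP] := (nbhs_ballP x _).1 nx.
  have [k0 _ k0P] := near_infty_natSinv_lt (PosNum del0).
  exists k0 => // k /k0P /= hk; have [xi xih ->] := qE k x.
  apply: delP; rewrite -ball_normE /ball_/= opprD addrA subrr sub0r normrN normrZ.
  apply: le_lt_trans hk; rewrite -[leRHS]mulr1; apply: ler_pM => //.
  exact: le_trans (norm_le_enorm v) v1.
have ig : leb.-integrable setT
    (fun x => (C * \1_(eball (0 : 'rV[R]_n) (M + 1)) x)%:E).
  rewrite (_ : (fun _ => _) = (fun x => C%:E * (\1_(eball (0 : 'rV[R]_n) (M + 1)) x)%:E)%E)//.
  apply: integrableZl => //; apply: integrable_indic_lty; first exact: measurable_eball.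
  by rewrite -[X in (X < _)%E]/(leb _) lebesgue_eballE ?ltry// addr_ge0// ltW.
have dom k x : (`|(q k x)%:E| <= (C * \1_(eball (0 : 'rV[R]_n) (M + 1)) x)%:E)%E.
  rewrite /= lee_fin indicE; have [|] := boolP (x \in _); first by rewrite mulr1.
  by rewrite notin_setE => /q0 ->; rewrite normr0 mulr0.
have [_ _] := @dominated_convergence _ _ R leb setT measurableT
  (fun k x => (q k x)%:E) (fun x => (partial i f x)%:E)
  (fun x => (C * \1_(eball (0 : 'rV[R]_n) (M + 1)) x)%:E)
  (fun k => (measurable_EFinP _ _).2 (mq k)) ((measurable_EFinP _ _).2 mpf)
  (aeW leb (fun x _ => qcvg x)) ig (aeW leb (fun x k _ => dom k x)).
move=> /cvg_lim <-//.
by under eq_fun do rewrite iq0; rewrite lim_cst.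
Qed.
End integration_by_parts.

(** * Lorentz norms of bounded functions supported on sets of finite measure *)

Section lorentz_upper.
Context {R : realType} {m : nat}.
Notation n := m.+1.
Notation leb := (lebesgue_rV n).
Notation mu := (@lebesgue_measure R).
Let p : R := n%:R^-1.

(** The tail of the f^** norm: it converges because 1/n < 1. *)
Lemma integral_powR_div2_le : (0 < m)%N ->
  (\int[mu]_(t in `]1%R, +oo[) (t `^ p / t / t)%:E <= ((1 - p)^-1)%:E)%E.
Proof.
move=> m0.
have p1 : p < 1 by rewrite invf_lt1// ltr1n.
have q0 : 0 < 1 - p by rewrite subr_gt0.
pose f (t : R) := t `^ p / t / t.
have fE (t : R) : 0 < t -> f t = t `^ (p - 1 - 1).
  move=> t0; rewrite /f powRB ?powRB ?powRr1 ?(ltW t0)//; apply/implyP => _; exact: lt0r_neq0.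
have f0 (t : R) : 0 <= t -> 0 <= f t by move=> t0; rewrite !divr_ge0// powR_ge0.
have mf : measurable_fun setT (fun t => (f t)%:E).
  apply/measurable_EFinP; apply: measurable_funM; last exact: measurable_inv.
  exact: measurable_powR_div.
pose F (k : nat) : set (measurableTypeR R) := `[1, k.+1%:R]%classic.
have FE : \bigcup_k F k = `[1%R, +oo[%classic.
  apply/seteqP; split => t /=.
    by move=> [k _]; rewrite /F/= !in_itv/= => /andP[->].
  rewrite in_itv/= andbT => t1; exists (Num.truncn t) => //.
  by rewrite /F/= in_itv/= t1 ltW// truncnS_gt.
rewrite integral_itv_obnd_cbnd; last exact: measurable_funTS.
rewrite -FE.
have ndF : nondecreasing_seq F.
  move=> i j ij; rewrite subsetEset => t; rewrite /F/= !in_itv/= => /andP[-> ti]/=.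
  by apply: le_trans ti _; rewrite ler_nat ltnS.
have mF i : measurable (F i) by exact: measurable_itv.
have cF := @ge0_nondecreasing_set_cvg_integral _ _ R F (fun t => (f t)%:E) mu ndF mF
  (fun i => measurable_funTS mf).
have f0F i t : F i t -> (0 <= (f t)%:E)%E.
  by rewrite /F/= in_itv/= => /andP[t1 _]; rewrite lee_fin f0// (le_trans _ t1).
rewrite -(cvg_lim _ (cF f0F))//.
apply: lime_le; first by apply: cvgP; exact: (cF f0F).
apply: nearW => k; rewrite /F.
have k1 : 1 <= k.+1%:R :> R by rewrite ler1n.
have d (t : R) : 1 <= t <= k.+1%:R ->
    is_derive t 1 (fun t : R => - (1 - p)^-1 * t `^ (p - 1)) (f t).
  move=> /andP[t1 _]; have t0 : 0 < t by exact: lt_le_trans t1.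
  have h := @is_deriveZ _ _ _ _ (- (1 - p)^-1) _ _ _ (is_derive1_powR (p - 1) t0).
  apply: (@is_derive_eq _ _ _ _ _ _ _ _ h).
  rewrite /GRing.scale/= fE// mulrA mulNr -mulrN opprB mulVf ?mul1r//.
  by rewrite gt_eqF.
have c : {within `[1, k.+1%:R], continuous f}.
  apply: continuous_in_subspaceT => t; rewrite inE/= in_itv/= => /andP[t1 _].
  have t0 : 0 < t by exact: lt_le_trans t1.
  have c1 : {for t, continuous (fun t : R => t `^ p)}.
    apply/differentiable_continuous/derivable1_diffP.
    by case: (is_derive1_powR p t0).
  have c2 := @inv_continuous R t (lt0r_neq0 t0).
  by apply: cvgM; [apply: cvgM; [exact: c1|exact: c2]|exact: c2].
rewrite (integral_itv_is_derive k1 c d) lee_fin powR1 mulr1 !mulNr opprK addrC.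
by rewrite gerBl mulr_ge0 ?powR_ge0// invr_ge0 ltW.
Qed.

Section bounded_finite_support.
Variables (Omega : set 'rV[R]_n) (f : 'rV[R]_n -> R) (L a : R).
Hypotheses (L0 : 0 <= L) (a0 : 0 <= a).
Hypothesis fL : forall x, Omega x -> `|f x| <= L.
Hypothesis fa : (leb (Omega `&` [set x | (0 < `|f x|)%R]) <= a%:E)%E.

Lemma rearrangement_le_bound t : 0 <= t -> (rearrangement Omega f t <= L%:E)%E.
Proof.
move=> t0; apply: ereal_inf_lbound; exists L => //; split => //.
rewrite /distribution_fun (_ : _ `&` _ = set0) ?measure0 ?lee_fin//.
apply/seteqP; split => // x [/fL fx /=]; by rewrite ltNge fx.
Qed.

Lemma rearrangement_eq0 t : a <= t -> rearrangement Omega f t = 0%E.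
Proof.
move=> at_; apply/eqP; rewrite eq_le rearrangement_ge0 andbT.
apply: ereal_inf_lbound; exists 0 => //; split => //.
by apply: le_trans fa _; rewrite lee_fin.
Qed.

(** f^* is at most L and vanishes from a on, so it is dominated by a step function. For a cutoff, a
    is the measure of the shell that carries the gradient. *)
Lemma lorentz_le : (lorentz Omega f <= (n%:R * L * a `^ p)%:E)%E.
Proof.
apply: (@le_trans _ _ (\int[mu]_(t in `]0%R, a]) (L%:E * (t `^ p / t)%:E))%E).
  rewrite /lorentz integral_mkcond [leRHS]integral_mkcond.
  apply: le_integral_ge0 => t _.
    apply: erestrict_ge0 => s; rewrite /= in_itv/= andbT => s0.
    by rewrite mule_ge0 ?rearrangement_ge0// lee_fin divr_ge0 ?powR_ge0// ltW.
  have rhs0 : (0 <= ((fun t : R => (L%:E * (t `^ p / t)%:E)%E) \_ `]0%R, a]%classic) t)%E.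
    apply: erestrict_ge0 => s; rewrite /= in_itv/= => /andP[s0 _].
    by rewrite mule_ge0// lee_fin divr_ge0 ?powR_ge0// ltW.
  rewrite [leLHS]patchE; case: ifPn => [|_]; last exact: rhs0.
  rewrite inE/= in_itv/= andbT => t0.
  have [at_|ta] := leP a t; first by rewrite rearrangement_eq0// mule0.
  rewrite patchE mem_set/=; last by rewrite in_itv/= t0 ltW.
  rewrite muleC; apply: lee_wpmul2r; last by apply: rearrangement_le_bound; exact: ltW.
  by rewrite lee_fin divr_ge0 ?powR_ge0// ltW.
rewrite ge0_integralZl_EFin//; last 2 first.
- move=> s; rewrite /= in_itv/= => /andP[s0 _].
  by rewrite lee_fin divr_ge0 ?powR_ge0// ltW.
- by apply: measurable_funTS; apply/measurable_EFinP; exact: measurable_powR_div.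
by rewrite integral_powR_div// -EFinM lee_fin mulrCA mulrA.
Qed.

Lemma rearrangement_avg_le t : 0 < t ->
  (rearrangement_avg Omega f t <= L%:E)%E /\
  (rearrangement_avg Omega f t <= (L * a / t)%:E)%E.
Proof.
move=> t0.
have itvE (b : R) : 0 <= b -> (\int[mu]_(s in `[0%R, b]) (cst L%:E) s = (L * b)%:E)%E.
  move=> b0; rewrite integral_cst//.
  rewrite (_ : _ `[0%R, b]%classic = lebesgue_measure `[0%R, b]%classic)//.
  rewrite lebesgue_measure_itv/= lte_fin.
  move: b0; rewrite le_eqVlt => /predU1P[<-|->]; first by rewrite ltxx mule0 mulr0.
  by rewrite -EFinB subr0 EFinM.
split.
  apply: (@le_trans _ _ ((t^-1)%:E * (L * t)%:E)%E).
    apply: lee_wpmul2l; first by rewrite lee_fin invr_ge0 ltW.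
    rewrite -itvE ?(ltW t0)//; apply: le_integral_ge0 => s.
      by move=> _; exact: rearrangement_ge0.
    by rewrite /= in_itv/= => /andP[s0 _]; exact: rearrangement_le_bound.
  by rewrite -EFinM lee_fin mulrC mulfK// gt_eqF.
rewrite [X in (_ <= X)%E](_ : _ = ((t^-1)%:E * (L * a)%:E)%E); last first.
  by rewrite -EFinM mulrC.
apply: lee_wpmul2l; first by rewrite lee_fin invr_ge0 ltW.
rewrite -itvE// integral_mkcond [leRHS]integral_mkcond.
apply: le_integral_ge0 => s _.
  by apply: erestrict_ge0 => r _; exact: rearrangement_ge0.
have rhs0 : (0 <= ((cst L%:E : R -> \bar R) \_ `[0%R, a]%classic) s)%E.
  by apply: erestrict_ge0 => r _; rewrite lee_fin.
rewrite [leLHS]patchE; case: ifPn => [|_]; last exact: rhs0.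
rewrite inE/= in_itv/= => /andP[s0 _].
have [as_|sa] := leP a s; first by rewrite rearrangement_eq0.
by rewrite patchE mem_set/= ?in_itv/= ?s0 ?(ltW sa)//; exact: rearrangement_le_bound.
Qed.

(** Split at t = 1, with f^** <= L below and f^** <= L a / t above. Later only the finiteness of the
    bound and its vanishing for L = 0 matter. *)
Lemma lorentz_avg_le : (0 < m)%N ->
  (lorentz_avg Omega f <= (L * (n%:R + a / (1 - p)))%:E)%E.
Proof.
move=> m0.
pose g1 (t : R) : \bar R := (L%:E * (t `^ p / t)%:E)%E.
pose g2 (t : R) : \bar R := ((L * a)%:E * (t `^ p / t / t)%:E)%E.
have mpw := @measurable_powR_div R m.
have mg1 : measurable_fun setT g1.
  by apply/measurable_EFinP; apply: measurable_funM.
have mg2 : measurable_fun setT g2.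
  apply/measurable_EFinP; apply: measurable_funM => //; apply: measurable_funM => //.
  exact: measurable_inv.
have g10 t : `]0%R, 1%R]%classic t -> (0 <= g1 t)%E.
  rewrite /= in_itv/= => /andP[t0 _].
  by rewrite mule_ge0// lee_fin divr_ge0 ?powR_ge0// ltW.
have g20 t : `]1%R, +oo[%classic t -> (0 <= g2 t)%E.
  rewrite /= in_itv/= andbT => t1; have t0 := lt_trans ltr01 t1.
  by rewrite mule_ge0// lee_fin ?mulr_ge0// ?invr_ge0 ?powR_ge0// ltW.
apply: (@le_trans _ _ (\int[mu]_t ((g1 \_ `]0%R, 1%R]%classic) t +
    (g2 \_ `]1%R, +oo[%classic) t))%E).
  rewrite /lorentz_avg integral_mkcond; apply: le_integral_ge0 => t _.
    apply: erestrict_ge0 => s; rewrite /= in_itv/= andbT => s0.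
    apply: mule_ge0; first by rewrite lee_fin divr_ge0 ?powR_ge0// ltW.
    by apply: le_trans (rearrangement_le_avg _ _ s0); exact: rearrangement_ge0.
  rewrite [leLHS]patchE; case: ifPn => [|_]; last first.
    by apply: adde_ge0; apply: erestrict_ge0.
  rewrite inE/= in_itv/= andbT => t0; have [h1 h2] := rearrangement_avg_le t0.
  have w0 : (0 <= (t `^ p / t)%:E)%E by rewrite lee_fin divr_ge0 ?powR_ge0// ltW.
  have [t1|t1] := leP t 1.
    rewrite patchE mem_set/= ?in_itv/= ?t0//.
    rewrite -[leLHS]adde0; apply: leeD; last exact: erestrict_ge0.
    by rewrite /g1 muleC; apply: lee_wpmul2r.
  rewrite [X in (_ <= _ + X)%E]patchE mem_set/= ?in_itv/= ?t1//.
  rewrite -[leLHS]add0e; apply: leeD; first exact: erestrict_ge0.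
  rewrite /g2 -EFinM [X in (_ <= X%:E)%E](_ : _ = t `^ p / t * (L * a / t)); last by ring.
  by rewrite [leRHS]EFinM; apply: lee_wpmul2l.
rewrite ge0_integralD//=; last 4 first.
- by move=> t _; exact: erestrict_ge0.
- exact: (measurable_restrictT g1 (measurable_itv _)).1 (measurable_funTS mg1).
- by move=> t _; exact: erestrict_ge0.
- exact: (measurable_restrictT g2 (measurable_itv _)).1 (measurable_funTS mg2).
rewrite -!integral_mkcond ge0_integralZl_EFin//; last 2 first.
- move=> s; rewrite /= in_itv/= => /andP[s0 _].
  by rewrite lee_fin divr_ge0 ?powR_ge0// ltW.
- by apply: measurable_funTS; apply/measurable_EFinP.
rewrite integral_powR_div// powR1 mulr1.
rewrite ge0_integralZl_EFin//; last 3 first.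
- move=> s; rewrite /= in_itv/= andbT => s1; have s0 := lt_trans ltr01 s1.
  by rewrite lee_fin !divr_ge0 ?powR_ge0// ltW.
- apply: measurable_funTS; apply/measurable_EFinP; apply: measurable_funM => //.
  exact: measurable_inv.
- exact: mulr_ge0.
rewrite mulrDr EFinD EFinM; apply: leeD2l.
rewrite mulrA EFinM; apply: lee_wpmul2l; first by rewrite lee_fin mulr_ge0.
exact: integral_powR_div2_le.
Qed.
End bounded_finite_support.
End lorentz_upper.

Section test_functions_in_sobolev.
Context {R : realType} {m : nat}.
Notation n := m.+1.
Notation leb := (lebesgue_rV n).
Let Om : R := fine (leb (eball (0 : 'rV[R]_n) 1)).
Implicit Types (Omega K : set 'rV[R]_n) (f phi : 'rV[R]_n -> R).

Lemma integrable_compact_support f K : compact K -> continuous f ->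
  (forall x, ~ K x -> f x = 0) -> leb.-integrable setT (EFin \o f).
Proof.
move=> cK cf f0.
have [M M0 KM] := bounded_sub_eball 0 (compact_bounded cK).
have [C C0 fC] := continuous_compact_bounded cK cf f0.
apply: (@integrable_bounded_support R m f C M (ltW M0)) => //.
  exact: measurable_continuous_rV.
by move=> x xM; apply: f0 => /KM.
Qed.

Lemma Rintegral_supported Omega f : (forall x, ~ Omega x -> f x = 0) ->
  \int[leb]_(x in Omega) f x = \int[leb]_x f x.
Proof.
move=> f0; rewrite Rintegral_mkcond; congr Rintegral.
apply/funext => x; rewrite patchE; case: ifPn => //.
by rewrite notin_setE => /f0.
Qed.

Lemma loc_integrable_compact_support Omega f K :
  compact K -> continuous f -> (forall x, ~ K x -> f x = 0) ->
  loc_integrable Omega f.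
Proof.
move=> cK cf f0; split; first by apply: measurable_funTS; exact: measurable_continuous_rV.
move=> K' cK' _; apply: (@integrableS _ _ _ leb setT) => //.
  rewrite -(setCK K'); apply: measurableC; apply: measurable_open_rV.
  by apply: closed_openC; apply: compact_closed => //; exact: norm_hausdorff.
exact: integrable_compact_support cK cf f0.
Qed.

(** The product rule for phi eta, together with the fact that a partial derivative of a compactly
    supported function has integral 0. *)
Lemma weak_grad_test Omega phi : test_fun Omega phi -> weak_grad Omega phi (grad phi).
Proof.
move=> tphi; have [K [cK KO phi0]] := test_fun_support tphi.
have sphi := test_fun_smooth tphi.
have cphi := smooth_continuous sphi.
have cpphi := smooth_continuous_partial sphi.
have gE i : (fun x => grad phi x ord0 i) = partial i phi.
  by apply/funext => x; rewrite mxE.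
split.
- exact: loc_integrable_compact_support cK cphi (phi0 [::]).
- move=> i; rewrite gE.
  exact: loc_integrable_compact_support cK (cpphi i) (phi0 [:: i]).
move=> eta i teta; have seta := test_fun_smooth teta.
have ceta := smooth_continuous seta.
have cpeta : continuous (partial i eta).
  by exact: smooth_continuous_partial.
have [K' [_ _ eta0]] := test_fun_support teta.
have -> : \int[leb]_(x in Omega) (grad phi x ord0 i * eta x) =
    \int[leb]_(x in Omega) (partial i phi x * eta x).
  by congr Rintegral; apply/funext => x; rewrite mxE.
have Kn x : ~ Omega x -> ~ K x by move=> h /KO.
rewrite Rintegral_supported; last first.
  by move=> x /Kn/(phi0 [::]) /= ->; rewrite mul0r.
rewrite [X in - X]Rintegral_supported; last first.
  by move=> x /Kn/(phi0 [:: i]) /= ->; rewrite mul0r.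
apply/eqP; rewrite -addr_eq0; apply/eqP.
have c1 : continuous (fun x => phi x * partial i eta x).
  exact: continuous_mulr.
have c2 : continuous (fun x => partial i phi x * eta x).
  exact: continuous_mulr.
rewrite -RintegralD//=; last 2 first.
- apply: integrable_compact_support cK c1 _ => x /(phi0 [::]) /= ->; exact: mul0r.
- apply: integrable_compact_support cK c2 _ => x /(phi0 [:: i]) /= ->; exact: mul0r.
have dphi x : derivable phi x (delta_mx ord0 i) by exact: smooth_derivable.
have deta x : derivable eta x (delta_mx ord0 i) by exact: smooth_derivable.
have pE x : partial i (fun y => phi y * eta y) x =
    phi x * partial i eta x + partial i phi x * eta x.
  rewrite /partial (deriveM (dphi x) (deta x)).
  by rewrite /GRing.scale/= [X in _ + X]mulrC.
have cf : continuous (fun y => phi y * eta y) by exact: continuous_mulr.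
have fE : partial i (fun y => phi y * eta y) =
    (fun x => phi x * partial i eta x + partial i phi x * eta x).
  by apply/funext => x; exact: pE.
have z : (\int[leb]_x (partial i (fun y => phi y * eta y)%R x)%:E = 0)%E.
  apply: (integral_partial_eq0 cK).
  - by move=> x /(phi0 [::]) /= ->; rewrite mul0r.
  - move=> x Kx; rewrite fE; have /= -> := phi0 [::] x Kx.
    by have /= -> := phi0 [:: i] x Kx; rewrite !mul0r addr0.
  - exact: cf.
  - by rewrite fE; exact: continuous_addr.
  - by move=> x; exact: derivableM (dphi x) (deta x).
by rewrite fE in z; rewrite /Rintegral z.
Qed.

Lemma lorentz_avg_test_lty Omega f K : (0 < m)%N -> open Omega ->
  compact K -> continuous f -> (forall x, ~ K x -> f x = 0) ->
  (lorentz_avg Omega f < +oo)%E.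
Proof.
move=> m0 oO cK cf f0.
have [M M0 KM] := bounded_sub_eball 0 (compact_bounded cK).
have [C C0 fC] := continuous_compact_bounded cK cf f0.
have mf : measurable_fun setT f by exact: measurable_continuous_rV.
apply: (@le_lt_trans _ _ (C * (n%:R + (Om * M ^+ n) / (1 - n%:R^-1)))%:E); last exact: ltry.
apply: lorentz_avg_le => //.
  by rewrite mulr_ge0 ?exprn_ge0 ?(ltW M0)//; exact: fine_ge0.
rewrite -(lebesgue_eballE 0 (ltW M0)); apply: le_measure; rewrite ?inE.
- by apply: measurable_superlevel; [exact: measurable_open_rV|exact: measurable_funTS].
- exact: measurable_eball.
move=> x [_ /= fx]; apply: contrapT => xM; move: fx.
by rewrite f0 ?normr0 ?ltxx// => /KM.
Qed.

Lemma lorentz_avg0 Omega f : (0 < m)%N -> (forall x, f x = 0) ->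
  (lorentz_avg Omega f <= 0)%E.
Proof.
move=> m0 f0.
have -> : 0%E = (0 * (n%:R + 0 / (1 - n%:R^-1)) : R)%:E by rewrite mul0r.
apply: lorentz_avg_le => //; first by move=> x _; rewrite f0 normr0.
rewrite (_ : _ `&` _ = set0) ?measure0//.
by apply/seteqP; split => // x [_ /=]; rewrite f0 normr0 ltxx.
Qed.

(** phi approximates itself with error 0; what remains is that its Sobolev norm is finite, which is
    where n >= 2 enters. *)
Lemma H10_test Omega phi : (0 < m)%N -> open Omega -> test_fun Omega phi ->
  H10 Omega phi (grad phi).
Proof.
move=> m0 oO tphi; have [K [cK KO phi0]] := test_fun_support tphi.
have sphi := test_fun_smooth tphi.
have sub0 (e : R) : 0 < e ->
    (sobolev_norm Omega (phi \- phi)%R (grad phi \- grad phi)%R < e%:E)%E.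
  move=> e0; apply: (@le_lt_trans _ _ 0%E); last by rewrite lte_fin.
  rewrite -[leRHS]adde0; apply: leeD; apply: lorentz_avg0 => // x /=.
    by rewrite subrr.
  by rewrite subrr enorm0.
split; last by move=> e e0; exists phi; split => //; exact: sub0.
split; first exact: weak_grad_test.
move=> e e0; exists phi; split; [by have [] := tphi| |exact: sub0].
apply: lte_add_pinfty; apply: (@lorentz_avg_test_lty _ _ K) => //.
- exact: smooth_continuous.
- exact: (phi0 [::]).
- exact: continuous_enorm_grad.
move=> x Kx /=; rewrite (_ : grad phi x = 0) ?enorm0//.
by apply/rowP => i; rewrite !mxE; exact: (phi0 [:: i]).
Qed.

(** The cutoff lives between r1 > r and r2 < s: it is 1 on a neighborhood of [E], its support is a
    compact subset of [Omega], and its gradient vanishes off the shell from r to s. *)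
Lemma capacity_le_eps Omega (E : set 'rV[R]_n) (x : 'rV[R]_n) (r s L : R) :
  (0 < m)%N -> open Omega -> eball x s `<=` Omega -> 0 <= r -> r < s ->
  E `<=` closed_eball x r -> (s - r)^-1 < L ->
  (capacity E Omega <= ((n%:R * L) ^+ n * (Om * (s ^+ n - r ^+ n)))%:E)%E.
Proof.
move=> m0 oO sO r0 rs Er hL.
have sr0 : 0 < s - r by rewrite subr_gt0.
have L0 : 0 < L by apply: lt_trans hL; rewrite invr_gt0.
have iL : L^-1 < s - r by rewrite -ltf_pV2 ?posrE ?invr_gt0// invrK.
(* Each radius moves by a third of the slack, and the last third keeps r2 - r1 > 1 / L. *)
pose d := (s - r - L^-1) / 3.
have d0 : 0 < d by rewrite /d; lra.
pose r1 := r + d; pose r2 := s - d.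
have iL0 : 0 < L^-1 by rewrite invr_gt0.
have r21 : L^-1 < r2 - r1 by rewrite /r1 /r2 /d; lra.
have r12 : r1 < r2 by rewrite -subr_gt0 (lt_trans iL0).
have r10 : 0 <= r1 by rewrite addr_ge0// ltW.
have hL2 : (r2 - r1)^-1 < L by rewrite -[L]invrK ltf_pV2 ?posrE// (lt_trans iL0).
have [phi [sphi phi1 phi0 gL g0]] := radial_cutoff x r10 r12 hL2.
have rr1 : r < r1 by rewrite ltrDl.
have r2s : r2 < s by rewrite gtrBl.
have tphi : test_fun Omega phi.
  split; first by move=> i y _; exact: sphi.
  exists (closed_eball x r2); split; first exact: compact_closed_eball.
    by move=> y /= h; apply: sO; exact: le_lt_trans r2s.
  by move=> y /negP; rewrite -ltNge => /ltW; exact: phi0.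
pose a := Om * (s ^+ n - r ^+ n).
have a0 : 0 <= a.
  rewrite mulr_ge0//; first exact: fine_ge0.
  by rewrite subr_ge0 lerXn2r ?nnegrE ?(ltW rs)// (le_trans r0) ?ltW.
apply: (@le_trans _ _ (lorentz Omega (enorm \o grad phi) ^+ n)%E).
  apply: ereal_inf_lbound; exists phi, (grad phi); split => //; first exact: H10_test.
  exists (eball x r1); split.
  - exact: open_eball.
  - by move=> y /Er /= yr; exact: le_lt_trans rr1.
  - move=> y /= yr; apply: sO; apply: (lt_trans yr); exact: lt_trans r2s.
  - by apply: aeW => y /= yr; rewrite phi1// ltW.
have -> : (n%:R * L) ^+ n * a = (n%:R * L * a `^ n%:R^-1) ^+ n.
  by rewrite [RHS]exprMn root_pow.
have N1 : (lorentz Omega (enorm \o grad phi) <= (n%:R * L * a `^ n%:R^-1)%:E)%E.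
  apply: (lorentz_le (ltW L0) a0) => [y _|] /=.
    by rewrite ger0_norm ?enorm_ge0.
  rewrite -(lebesgue_shell x r0 (ltW rs)); apply: le_measure; rewrite ?inE.
  - apply: measurable_superlevel; first exact: measurable_open_rV.
    by apply: measurable_funTS; apply: measurable_continuous_rV; exact: continuous_enorm_grad.
  - by apply: measurableD; exact: measurable_eball.
  move=> y [_ /= gy]; have : grad phi y != 0.
    by apply/eqP => gy0; move: gy; rewrite gy0 enorm0 normr0 ltxx.
  move=> /eqP gy0; have /andP[h1 h2] : r1 <= enorm (y - x) < r2.
    by apply/negPn/negP => h; apply: gy0; apply: g0; apply/negP.
  split => /=; first exact: lt_trans r2s.
  by apply/negP; rewrite -leNgt (le_trans (ltW rr1)).
move: (lorentz_ge0 Omega (enorm \o grad phi)) N1.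
case: (lorentz Omega _) => [N| |//] N0 h; last by move: h; rewrite leye_eq.
rewrite -EFin_expe !lee_fin in N0 h *.
by rewrite lerXn2r ?nnegrE// (le_trans N0).
Qed.
End test_functions_in_sobolev.

(** [capacity_le_eps] needs L > 1 / (s - r) strictly; its bound is continuous in L, so L decreases
    to 1 / (s - r). *)
Lemma capacity_le (R : realType) (m : nat) (Omega E : set 'rV[R]_m.+1)
    (x : 'rV[R]_m.+1) (r s : R) :
  let Om := fine (lebesgue_rV m.+1 (eball (0 : 'rV[R]_m.+1) 1)) in
  (0 < m)%N -> open Omega -> eball x s `<=` Omega -> 0 <= r -> r < s ->
  E `<=` closed_eball x r ->
  (capacity E Omega <=
    (m.+1%:R ^+ m.+1 * Om * ((s ^+ m.+1 - r ^+ m.+1) / (s - r) ^+ m.+1))%:E)%E.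
Proof.
move=> Om m0 oO sO r0 rs Er.
have sr0 : 0 < s - r by rewrite subr_gt0.
have cL (L : R) : (s - r)^-1 < L -> (capacity E Omega <=
    ((m.+1%:R * L) ^+ m.+1 * (Om * (s ^+ m.+1 - r ^+ m.+1)))%:E)%E.
  by move=> h; exact: (capacity_le_eps m0 oO sO r0 rs Er h).
pose f (L : R) := (m.+1%:R * L) ^+ m.+1 * (Om * (s ^+ m.+1 - r ^+ m.+1)).
have -> : m.+1%:R ^+ m.+1 * Om * ((s ^+ m.+1 - r ^+ m.+1) / (s - r) ^+ m.+1) =
    f (s - r)^-1.
  by rewrite /f exprMn exprVn; ring.
have cf : f L @[L --> (s - r)^-1^'+] --> f (s - r)^-1.
  apply: cvg_at_right_filter; apply: cvgMr_tmp.
  have h : (fun L : R => m.+1%:R * L) @ (s - r)^-1 --> m.+1%:R * (s - r)^-1.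
    by apply: cvgMl_tmp; exact: cvg_id.
  exact: (continuous_comp h (@exprn_continuous _ m.+1 _)).
have cE : (f L)%:E @[L --> (s - r)^-1^'+] --> (f (s - r)^-1)%:E.
  by apply: cvg_EFin => //; exact: nearW.
rewrite -(cvg_lim _ cE)//; apply: lime_ge; first by apply: cvgP; exact: cE.
by near=> L; apply: cL; near: L; exact: nbhs_right_gt.
Unshelve. all: by end_near.
Qed.

Theorem theorem6p2 (R : realType) (n : nat) (hn : (2 <= n)%N) :
  let Omega_n : \bar R := lebesgue_rV n (eball 0 1) in
  (forall r : R, 0 <= r < 1 ->
    ((n%:R ^+ n)%:E * Omega_n * ((1 - r ^+ n) ^ (1 - n%:Z))%:E
       <= capacity (closed_eball (0 : 'rV[R]_n) r) (eball 0 1)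
       <= (n%:R ^+ n)%:E * Omega_n * ((1 - r ^+ n) / (1 - r) ^+ n)%:E)%E) /\
  (forall (x : 'rV[R]_n) (Omega : set 'rV[R]_n),
    bounded_set Omega -> open Omega -> Omega x ->
    capacity [set x] Omega = ((n%:R ^+ n)%:E * Omega_n)%E).
Proof.
case: n hn => // m m0 Omega_n; rewrite ltnS in m0.
have OmE : Omega_n = (fine Omega_n)%:E by rewrite fineK// unit_ball_fin_num.
split=> [r /andP[r0 r1]|x Omega bO oO Ox].
  rewrite OmE -!EFinM; apply/andP; split.
    have := capacity_ge (@open_eball R m.+1 0 1) (@subset_refl _ _) r0 r1.
    (* The exponent 1 - n is the negative integer -m, so the power is the inverse of an m-th
       power. *)
    rewrite divr1 (_ : 1 - m.+1%:Z = - m%:Z); last by rewrite intS opprD addrA subrr add0r.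
    by rewrite -exprnN.
  have := capacity_le m0 (@open_eball R m.+1 0 1) (@subset_refl _ _) r0 r1 (@subset_refl _ _).
  by rewrite expr1n.
(* A point is the closed ball of radius 0, so both ball estimates apply to it. *)
have xE : [set x] = closed_eball x 0.
  apply/seteqP; split => y; rewrite /closed_eball/=; first by move=> ->; rewrite subrr enorm0.
  move=> yx; apply/eqP; rewrite -subr_eq0; apply/eqP/enorm_eq0/eqP.
  by rewrite eq_le yx enorm_ge0.
apply/eqP; rewrite eq_le OmE -EFinM; apply/andP; split.
  (* For r = 0 the ratio (e^n - r^n) / (e - r)^n is 1 whatever e is, and likewise 1 - (r/M)^n is 1
     whatever M is: any inscribed and any enclosing ball give the same constant. *)
  have [e e0 eO] := nbhs_eball (open_nbhs_nbhs (conj oO Ox)).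
  have := @capacity_le R m Omega [set x] x 0 e m0 oO eO (lexx 0) e0.
  rewrite xE subr0 expr0n/= subr0 divff ?mulr1; last by rewrite expf_neq0// gt_eqF.
  by apply; exact: subset_refl.
have [M M0 OM] := bounded_sub_eball x bO.
have := capacity_ge oO OM (lexx 0) M0.
by rewrite mul0r expr0n/= subr0 expr1n divr1 -xE.
Qed.
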